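(* Let $\mathcal{U}$ be a (not necessarily finite) semisimple ribbon category, and let $\{\mathsf{U}_i\}_{i\in I}$ be a set of distinct (pairwise non-isomorphic) simple objects of $\mathcal{U}$, with $0\in I$ and $\mathsf{U}_0=\mathbf{1}_{\mathcal{U}}$. Let $\mathcal{V}$ be a ribbon category (not necessarily semisimple). Let $$\mathsf{A}=\bigoplus_{i\in I}\mathsf{U}_i\boxtimes\mathsf{V}_i$$ be a simple commutative associative unital algebra in $\mathcal{C}=\mathcal{U}\boxtimes\mathcal{V}$ (in $\mathcal{C}_\oplus$ if $I$ is infinite), where the $\mathsf{V}_i$ are objects of $\mathcal{V}$, not assumed to be simple except for $\mathsf{V}_0=\mathbf{1}_{\mathcal{V}}$. Assume $$\dim\mathrm{Hom}_{\mathcal{U}}(\mathsf{U}_0,\mathsf{U}_i)=\delta_{i,0}=\dim\mathrm{Hom}_{\mathcal{V}}(\mathsf{V}_0,\mathsf{V}_i)\qquad(i\in I),$$ and that there is a partition $I=I^0\sqcup I^1$ with $0\in I^0$ such that $\theta_{\mathsf{A}}|_{\mathsf{U}_i\boxtimes\mathsf{V}_i}=(-1)^j\,\mathrm{Id}_{\mathsf{U}_i\boxtimes\mathsf{V}_i}$ for each $i\in I^j$, $j=0,1$. Let $\mathcal{F}:\mathcal{C}\to\mathrm{Rep}\,\mathsf{A}$ be the induction functor. Then for all $i\in I$, $$\mathcal{F}(\mathsf{U}_i\boxtimes\mathbf{1}_{\mathcal{V}})\cong\mathcal{F}\big((\mathbf{1}_{\mathcal{U}}\boxtimes\mathsf{V}_i)^*\big)\quad\text{in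 }\mathrm{Rep}\,\mathsf{A}.$$
   Context: All categories are linear over a fixed field $\mathbb{F}$ (one may take $\mathbb F=\mathbb C$). A tensor category is an abelian monoidal category with bilinear $\otimes$, right exact in each variable, unit $\mathbf 1$, unit isomorphisms $l,r$ and associativity isomorphisms $\mathcal A_{\mathsf X,\mathsf Y,\mathsf Z}:\mathsf X\otimes(\mathsf Y\otimes\mathsf Z)\to(\mathsf X\otimes\mathsf Y)\otimes\mathsf Z$; braided means with a braiding $\mathcal R$. A ribbon category is a rigid braided tensor category with a twist: a natural isomorphism $\theta:\mathrm{Id}\to\mathrm{Id}$ with $\theta_{\mathbf 1}=\mathrm{Id}$, $\theta_{\mathsf X^*}=(\theta_{\mathsf X})^*$ and $\theta_{\mathsf X\otimes\mathsf Y}=\mathcal R_{\mathsf Y,\mathsf X}\circ\mathcal R_{\mathsf X,\mathsf Y}\circ(\theta_{\mathsf X}\otimes\theta_{\mathsf Y})$. Semisimple means every object is a finite direct sum of simple objects. The Deligne product $\mathcal U\boxtimes\mathcal V$ carries the componentwise braided tensor structure and twist. The direct sum completion $\mathcal C_\oplus$ has objects $\bigoplus_{s\in S}\mathsf X_s$ ($S$ any set, $\mathsf X_s$ in $\mathcal C$), and morphisms $\bigoplus_s\mathsf X_s\to\bigoplus_t\mathsf Y_t$ are families $(f_{s,t}:\mathsf X_s\to\mathsf Y_t)$ with, for each $s$, $f_{s,t}=0$ for all but finitely many $t$; braided tensor structure and twist extend componentwise. A commutative associative unital algebra $(\mathsf A,\mu,\iota)$ has $\mu:\mathsf A\otimes\mathsf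 A\to\mathsf A$ and $\iota:\mathbf 1\to\mathsf A$ with $\mu(\mathrm{Id}\otimes\mu)=\mu(\mu\otimes\mathrm{Id})\mathcal A_{\mathsf A,\mathsf A,\mathsf A}$, $\mu(\iota\otimes\mathrm{Id})=l_{\mathsf A}$, $\mu(\mathrm{Id}\otimes\iota)=r_{\mathsf A}$, $\mu\mathcal R_{\mathsf A,\mathsf A}=\mu$. $\mathrm{Rep}\,\mathsf A$ is the category of left $\mathsf A$-modules in $\mathcal C$ (resp. $\mathcal C_\oplus$): pairs $(\mathsf X,\mu_{\mathsf X}:\mathsf A\otimes\mathsf X\to\mathsf X)$ with $\mu_{\mathsf X}(\iota\otimes\mathrm{Id})=l_{\mathsf X}$ and $\mu_{\mathsf X}(\mathrm{Id}\otimes\mu_{\mathsf X})=\mu_{\mathsf X}(\mu\otimes\mathrm{Id})\mathcal A_{\mathsf A,\mathsf A,\mathsf X}$, with morphisms commuting with the actions. The algebra $\mathsf A$ is called simple if it is simple as an object of $\mathrm{Rep}\,\mathsf A$. The induction functor is $\mathcal F(\mathsf W)=\mathsf A\otimes\mathsf W$ with action $(\mu\otimes\mathrm{Id}_{\mathsf W})\circ\mathcal A_{\mathsf A,\mathsf A,\mathsf W}$, and $\mathcal F(f)=\mathrm{Id}_{\mathsf A}\otimes f$.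
   Formalization: The formal statement additionally assumes that every V_i is nonzero; without this the claim fails, e.g. A = 1, I = {0,1}, U_1 a simple object not isomorphic to 1 and V_1 = 0, where the left side is U_1⊠1 ≠ 0 and the right side is 0. *)

(* Defs.v *)
From HB Require Import structures.
From mathcomp Require Import all_boot all_order all_algebra.
From mathcomp Require Import boolp classical_sets functions cardinality fsbigop.

Set Implicit Arguments.
Unset Strict Implicit.
Unset Printing Implicit Defensive.

Import GRing.Theory.
Local Open Scope classical_set_scope.
Local Open Scope ring_scope.

Declare Scope cat_scope.
Delimit Scope cat_scope with cat.
Local Open Scope cat_scope.

Local Obligation Tactic := idtac.

Reserved Notation "g ∘ f" (at level 40, left associativity).
Reserved Notation "X ⊗ Y" (at level 35, right associativity).
Reserved Notation "f ⊗^ g" (at level 35, right associativity).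

Record linCat (F : fieldType) := LinCat {
  ob :> Type;
  mor : ob -> ob -> lmodType F;
  idm : forall X, mor X X;
  mcomp : forall X Y Z, mor Y Z -> mor X Y -> mor X Z;
  comp_linl : forall X Y Z (f : mor X Y),
    linear (fun g : mor Y Z => mcomp g f);
  comp_linr : forall X Y Z (g : mor Y Z),
    linear (fun f : mor X Y => mcomp g f);
  compA : forall X Y Z T (h : mor Z T) (g : mor Y Z) (f : mor X Y),
    mcomp h (mcomp g f) = mcomp (mcomp h g) f;
  comp1m : forall X Y (f : mor X Y), mcomp (idm Y) f = f;
  compm1 : forall X Y (f : mor X Y), mcomp f (idm X) = f }.

Arguments mor {F l} X Y.
Arguments idm {F l} X.
Arguments mcomp {F l X Y Z} g f.

Notation "g ∘ f" := (mcomp g f) : cat_scope.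

Section Category.
Context {F : fieldType} {C : linCat F}.
Implicit Types X Y Z : C.

Record iso X Y := Iso {
  ifwd : mor X Y;
  inv : mor Y X;
  invK : inv ∘ ifwd = idm X;
  fwdK : ifwd ∘ inv = idm Y }.

Definition isomorphic X Y := inhabited (iso X Y).

Definition is_iso X Y (f : mor X Y) := exists i : iso X Y, ifwd i = f.

Definition is_mono X Y (f : mor X Y) :=
  forall Z (g h : mor Z X), f ∘ g = f ∘ h -> g = h.

Definition is_epi X Y (f : mor X Y) :=
  forall Z (g h : mor Y Z), g ∘ f = h ∘ f -> g = h.

Definition is_zero X := forall Y,
  (forall f : mor X Y, f = 0) /\ (forall f : mor Y X, f = 0).

Definition is_kernel X Y Z (f : mor X Y) (g : mor Y Z) :=
  g ∘ f = 0 /\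
  forall T (h : mor T Y), g ∘ h = 0 -> exists! k : mor T X, f ∘ k = h.

Definition is_cokernel X Y Z (f : mor X Y) (g : mor Y Z) :=
  g ∘ f = 0 /\
  forall T (h : mor Y T), h ∘ f = 0 -> exists! k : mor Z T, k ∘ g = h.

Record biproduct (I : choiceType) (X : I -> C) (A : C) := Biproduct {
  inc : forall i, mor (X i) A;
  prj : forall i, mor A (X i);
  prj_inc : forall i, prj i ∘ inc i = idm (X i);
  prj_inc0 : forall i j, i <> j -> prj j ∘ inc i = 0;
  biproduct_fin : finite_set [set: I];
  inc_prj : \sum_(i \in [set: I]) (inc i ∘ prj i) = idm A }.

(* Y is the zero subobject exactly when f = 0. This is also used in module  *)
(* categories over a direct sum completion, which need not be abelian.      *)
Definition simple X := ~ is_zero X /\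
  forall Y (f : mor Y X), is_mono f -> f = 0 \/ is_iso f.

End Category.

Definition abelian (F : fieldType) (C : linCat F) :=
  [/\ exists X : C, is_zero X,
      forall X : bool -> C, exists A : C, inhabited (biproduct X A),
      forall (X Y : C) (f : mor X Y),
        (exists (K : C) (k : mor K X), is_kernel k f) /\
        (exists (Q : C) (q : mor Y Q), is_cokernel f q),
      forall (X Y : C) (f : mor X Y), is_mono f ->
        exists (Z : C) (g : mor Y Z), is_kernel f g &
      forall (X Y : C) (f : mor X Y), is_epi f ->
        exists (Z : C) (g : mor Z X), is_cokernel g f].

Definition semisimple (F : fieldType) (C : linCat F) :=
  forall A : C, exists (n : nat) (S : 'I_n -> C),
    (forall k, simple (S k)) /\ inhabited (biproduct S A).

(* dim M = n, for a possibly infinite-dimensional M                         *)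
Definition has_dim (F : fieldType) (M : lmodType F) (n : nat) :=
  inhabited (Vector.axiom n M).

Record linFun (F : fieldType) (C D : linCat F) := LinFun {
  fob :> C -> D;
  fmap : forall X Y, mor X Y -> mor (fob X) (fob Y);
  fmap_lin : forall X Y, linear (@fmap X Y);
  fmap1 : forall X, fmap (idm X) = idm (fob X);
  fmapM : forall X Y Z (g : mor Y Z) (f : mor X Y),
    fmap (g ∘ f) = fmap g ∘ fmap f }.

Arguments fmap {F C D} H {X Y} f : rename.

Record bifun (F : fieldType) (C C' D : linCat F) := Bifun {
  bob :> C -> C' -> D;
  bmap : forall X1 X2 Y1 Y2, mor X1 X2 -> mor Y1 Y2 ->
    mor (bob X1 Y1) (bob X2 Y2);
  bmap_linl : forall X1 X2 Y1 Y2 (g : mor Y1 Y2),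
    linear (fun f : mor X1 X2 => bmap f g);
  bmap_linr : forall X1 X2 Y1 Y2 (f : mor X1 X2),
    linear (fun g : mor Y1 Y2 => bmap f g);
  bmap1 : forall X Y, bmap (idm X) (idm Y) = idm (bob X Y);
  bmapM : forall X1 X2 X3 Y1 Y2 Y3 (f' : mor X2 X3) (f : mor X1 X2)
      (g' : mor Y2 Y3) (g : mor Y1 Y2),
    bmap (f' ∘ f) (g' ∘ g) = bmap f' g' ∘ bmap f g }.

Arguments bmap {F C C' D} B {X1 X2 Y1 Y2} f g : rename.

(* For linear functors, right exactness is preservation of cokernels.       *)
Definition right_exact (F : fieldType) (C D : linCat F) (H : linFun C D) :=
  forall (X Y Z : C) (f : mor X Y) (g : mor Y Z),
    is_cokernel f g -> is_cokernel (fmap H f) (fmap H g).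

Definition right_exact2 (F : fieldType) (C C' D : linCat F)
    (B : bifun C C' D) :=
  (forall (X Y Z : C) (f : mor X Y) (g : mor Y Z) (W : C'),
     is_cokernel f g ->
     is_cokernel (bmap B f (idm W)) (bmap B g (idm W))) /\
  (forall (W : C) (X Y Z : C') (f : mor X Y) (g : mor Y Z),
     is_cokernel f g ->
     is_cokernel (bmap B (idm W) f) (bmap B (idm W) g)).

Record monCat (F : fieldType) := MonCat {
  mcat :> linCat F;
  tens : bifun mcat mcat mcat;
  munit : mcat;
  assoc : forall X Y Z, iso (tens X (tens Y Z)) (tens (tens X Y) Z);
  lunit : forall X, iso (tens munit X) X;
  runit : forall X, iso (tens X munit) X;
  assoc_nat : forall X1 X2 Y1 Y2 Z1 Z2
      (f : mor X1 X2) (g : mor Y1 Y2) (h : mor Z1 Z2),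
    ifwd (assoc X2 Y2 Z2) ∘ bmap tens f (bmap tens g h)
    = bmap tens (bmap tens f g) h ∘ ifwd (assoc X1 Y1 Z1);
  lunit_nat : forall X Y (f : mor X Y),
    ifwd (lunit Y) ∘ bmap tens (idm munit) f = f ∘ ifwd (lunit X);
  runit_nat : forall X Y (f : mor X Y),
    ifwd (runit Y) ∘ bmap tens f (idm munit) = f ∘ ifwd (runit X);
  pentagon : forall X Y Z W,
    ifwd (assoc (tens X Y) Z W) ∘ ifwd (assoc X Y (tens Z W))
    = bmap tens (ifwd (assoc X Y Z)) (idm W) ∘ ifwd (assoc X (tens Y Z) W)
      ∘ bmap tens (idm X) (ifwd (assoc Y Z W));
  triangle : forall X Y,
    bmap tens (ifwd (runit X)) (idm Y) ∘ ifwd (assoc X munit Y)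
    = bmap tens (idm X) (ifwd (lunit Y)) }.

Arguments tens {F m}.
Arguments munit {F m}.
Arguments assoc {F m} X Y Z.
Arguments lunit {F m} X.
Arguments runit {F m} X.

Notation "X ⊗ Y" := (bob tens X Y) : cat_scope.
Notation "f ⊗^ g" := (bmap tens f g) : cat_scope.

Record braidedCat (F : fieldType) := BraidedCat {
  bcat :> monCat F;
  braid : forall X Y : bcat, iso (X ⊗ Y) (Y ⊗ X);
  braid_nat : forall (X1 X2 Y1 Y2 : bcat) (f : mor X1 X2) (g : mor Y1 Y2),
    ifwd (braid X2 Y2) ∘ (f ⊗^ g) = (g ⊗^ f) ∘ ifwd (braid X1 Y1);
  hexagon1 : forall X Y Z,
    ifwd (braid X (Y ⊗ Z))
    = ifwd (assoc Y Z X) ∘ (idm Y ⊗^ ifwd (braid X Z)) ∘ inv (assoc Y X Z)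
      ∘ (ifwd (braid X Y) ⊗^ idm Z) ∘ ifwd (assoc X Y Z);
  hexagon2 : forall X Y Z,
    ifwd (braid (X ⊗ Y) Z)
    = inv (assoc Z X Y) ∘ (ifwd (braid X Z) ⊗^ idm Y) ∘ ifwd (assoc X Z Y)
      ∘ (idm X ⊗^ ifwd (braid Y Z)) ∘ inv (assoc X Y Z) }.

Arguments braid {F b} X Y.

(* Rigidity is not part of this structure, since the direct sum completion  *)
(* is not rigid.                                                            *)
Record twistedCat (F : fieldType) := TwistedCat {
  tcat :> braidedCat F;
  twist : forall X : tcat, iso X X;
  twist_nat : forall (X Y : tcat) (f : mor X Y),
    ifwd (twist Y) ∘ f = f ∘ ifwd (twist X);
  twist1 : ifwd (twist munit) = idm munit;
  twistM : forall X Y : tcat,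
    ifwd (twist (X ⊗ Y))
    = ifwd (braid Y X) ∘ ifwd (braid X Y)
      ∘ (ifwd (twist X) ⊗^ ifwd (twist Y)) }.

Arguments twist {F t} X.

(* A left dual of X. In a braided category it is also a right dual, so that *)
(* rigidity amounts to the existence of left duals.                         *)
Record dual_of (F : fieldType) (C : monCat F) (X : C) := DualOf {
  dual :> C;
  ev : mor (dual ⊗ X) munit;
  coev : mor munit (X ⊗ dual);
  dual_zig :
    ifwd (runit X) ∘ (idm X ⊗^ ev) ∘ inv (assoc X dual X)
      ∘ (coev ⊗^ idm X) ∘ inv (lunit X) = idm X;
  dual_zag :
    ifwd (lunit dual) ∘ (ev ⊗^ idm dual) ∘ ifwd (assoc dual X dual)
      ∘ (idm dual ⊗^ coev) ∘ inv (runit dual) = idm dual }.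

Definition dual_map (F : fieldType) (C : monCat F) (X Y : C)
    (X' : dual_of X) (Y' : dual_of Y) (f : mor X Y) : mor (dual Y') (dual X') :=
  ifwd (lunit (dual X')) ∘ (ev Y' ⊗^ idm (dual X'))
    ∘ ifwd (assoc (dual Y') Y (dual X'))
    ∘ (idm (dual Y') ⊗^ (f ⊗^ idm (dual X')))
    ∘ (idm (dual Y') ⊗^ coev X') ∘ inv (runit (dual Y')).

Definition is_tensorCat (F : fieldType) (C : monCat F) :=
  abelian C /\ right_exact2 (@tens F C).

Record ribbonCat (F : fieldType) := RibbonCat {
  rcat :> twistedCat F;
  ribbon_tensorCat : is_tensorCat rcat;
  rdual : forall X : rcat, dual_of X;
  twist_dual : forall X : rcat,
    ifwd (twist (dual (rdual X)))
    = dual_map (rdual X) (rdual X) (ifwd (twist X)) }.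

(* The universal property: for every abelian D, composition with B is an    *)
(* equivalence from right exact linear functors C -> D to bilinear functors *)
(* U x V -> D right exact in each variable. The two clauses are essential   *)
(* surjectivity and full faithfulness.                                      *)
Definition is_deligne (F : fieldType) (U V C : linCat F) (B : bifun U V C) :=
  [/\ abelian C, right_exact2 B &
   forall D : linCat F, abelian D ->
    (forall G : bifun U V D, right_exact2 G ->
       exists2 H : linFun C D, right_exact H &
       exists eta : forall X Y, iso (H (B X Y)) (G X Y),
       forall (X1 X2 : U) (Y1 Y2 : V) (f : mor X1 X2) (g : mor Y1 Y2),
         ifwd (eta X2 Y2) ∘ fmap H (bmap B f g)
         = bmap G f g ∘ ifwd (eta X1 Y1)) /\
    (forall H K : linFun C D, right_exact H -> right_exact K ->
       forall a : forall X Y, mor (H (B X Y)) (K (B X Y)),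
       (forall (X1 X2 : U) (Y1 Y2 : V) (f : mor X1 X2) (g : mor Y1 Y2),
          a X2 Y2 ∘ fmap H (bmap B f g) = fmap K (bmap B f g) ∘ a X1 Y1) ->
       exists! b : forall Z, mor (H Z) (K Z),
         (forall (Z1 Z2 : C) (h : mor Z1 Z2),
            b Z2 ∘ fmap H h = fmap K h ∘ b Z1) /\
         (forall X Y, b (B X Y) = a X Y))].

(* The braided tensor structure and twist of C are the componentwise ones:  *)
(* B is a strong braided monoidal functor compatible with the twists. As    *)
(* the tensor product of C is right exact, this determines it.              *)
Record componentwise (F : fieldType) (U V C : twistedCat F)
    (B : bifun U V C) := Componentwise {
  cw_tens : forall (X X' : U) (Y Y' : V),
    iso (B X Y ⊗ B X' Y') (B (X ⊗ X') (Y ⊗ Y'));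
  cw_one : iso munit (B munit munit);
  cw_nat : forall (X1 X2 X1' X2' : U) (Y1 Y2 Y1' Y2' : V)
      (f : mor X1 X2) (f' : mor X1' X2') (g : mor Y1 Y2) (g' : mor Y1' Y2'),
    ifwd (cw_tens X2 X2' Y2 Y2') ∘ (bmap B f g ⊗^ bmap B f' g')
    = bmap B (f ⊗^ f') (g ⊗^ g') ∘ ifwd (cw_tens X1 X1' Y1 Y1');
  cw_assoc : forall (X1 X2 X3 : U) (Y1 Y2 Y3 : V),
    bmap B (ifwd (assoc X1 X2 X3)) (ifwd (assoc Y1 Y2 Y3))
      ∘ ifwd (cw_tens X1 (X2 ⊗ X3) Y1 (Y2 ⊗ Y3))
      ∘ (idm (B X1 Y1) ⊗^ ifwd (cw_tens X2 X3 Y2 Y3))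
    = ifwd (cw_tens (X1 ⊗ X2) X3 (Y1 ⊗ Y2) Y3)
      ∘ (ifwd (cw_tens X1 X2 Y1 Y2) ⊗^ idm (B X3 Y3))
      ∘ ifwd (assoc (B X1 Y1) (B X2 Y2) (B X3 Y3));
  cw_lunit : forall (X : U) (Y : V),
    bmap B (ifwd (lunit X)) (ifwd (lunit Y)) ∘ ifwd (cw_tens munit X munit Y)
      ∘ (ifwd cw_one ⊗^ idm (B X Y))
    = ifwd (lunit (B X Y));
  cw_runit : forall (X : U) (Y : V),
    bmap B (ifwd (runit X)) (ifwd (runit Y)) ∘ ifwd (cw_tens X munit Y munit)
      ∘ (idm (B X Y) ⊗^ ifwd cw_one)
    = ifwd (runit (B X Y));
  cw_braid : forall (X X' : U) (Y Y' : V),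
    bmap B (ifwd (braid X X')) (ifwd (braid Y Y'))
      ∘ ifwd (cw_tens X X' Y Y')
    = ifwd (cw_tens X' X Y' Y) ∘ ifwd (braid (B X Y) (B X' Y'));
  cw_twist : forall (X : U) (Y : V),
    ifwd (twist (B X Y)) = bmap B (ifwd (twist X)) (ifwd (twist Y)) }.

(* C is the Deligne product of U and V as a braided tensor category with    *)
(* twist.                                                                   *)
Record deligneProduct (F : fieldType) (U V C : twistedCat F) :=
  DeligneProduct {
    dprod : bifun U V C;
    dprod_tensorCat : is_tensorCat C;
    dprod_universal : is_deligne dprod;
    dprod_componentwise : componentwise dprod }.

Record comAlg (F : fieldType) (C : braidedCat F) (A : C) := ComAlg {
  amul : mor (A ⊗ A) A;
  aone : mor munit A;
  amulA : amul ∘ (idm A ⊗^ amul)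
          = amul ∘ (amul ⊗^ idm A) ∘ ifwd (assoc A A A);
  amul1m : amul ∘ (aone ⊗^ idm A) = ifwd (lunit A);
  amulm1 : amul ∘ (idm A ⊗^ aone) = ifwd (runit A);
  amulC : amul ∘ ifwd (braid A A) = amul }.

Section LinearTheory.
Context {F : fieldType} {C : linCat F}.
Implicit Types X Y Z : C.

Lemma linear_sum (M N : lmodType F) (u : M -> N) I r (P : pred I) G :
  linear u -> u (\sum_(i <- r | P i) G i) = \sum_(i <- r | P i) u (G i).
Proof.
move=> lu; have uD x y : u (x + y) = u x + u y.
  by have := lu 1 x y; rewrite !scale1r.
have u0 : u 0 = 0 by apply: (addrI (u 0)); rewrite -uD !addr0.
by elim/big_rec2: _ => // i x y _ <-.
Qed.

Lemma linear0 (M N : lmodType F) (u : M -> N) : linear u -> u 0 = 0.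
Proof. by move=> lu; have := linear_sum [::] xpredT id lu; rewrite !big_nil. Qed.

Lemma comp0m X Y Z (f : mor X Y) : (0 : mor Y Z) ∘ f = 0.
Proof. exact: linear0 (comp_linl f). Qed.

Lemma compm0 X Y Z (g : mor Y Z) : g ∘ (0 : mor X Y) = 0.
Proof. exact: linear0 (comp_linr g). Qed.

Lemma compDl X Y Z k (g h : mor Y Z) (f : mor X Y) :
  (k *: g + h) ∘ f = k *: (g ∘ f) + h ∘ f.
Proof. exact: comp_linl. Qed.

Lemma compDr X Y Z k (g : mor Y Z) (f h : mor X Y) :
  g ∘ (k *: f + h) = k *: (g ∘ f) + g ∘ h.
Proof. exact: comp_linr. Qed.

Lemma comp_suml X Y Z I r (P : pred I) (G : I -> mor Y Z) (f : mor X Y) :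
  (\sum_(i <- r | P i) G i) ∘ f = \sum_(i <- r | P i) (G i ∘ f).
Proof. exact: (linear_sum _ _ _ (comp_linl f)). Qed.

Lemma comp_sumr X Y Z I r (P : pred I) (g : mor Y Z) (G : I -> mor X Y) :
  g ∘ (\sum_(i <- r | P i) G i) = \sum_(i <- r | P i) (g ∘ G i).
Proof. exact: (linear_sum _ _ _ (comp_linr g)). Qed.

End LinearTheory.

Section MonoidalTheory.
Context {F : fieldType} {C : monCat F}.
Implicit Types X Y Z : C.

Lemma tensM X1 X2 X3 Y1 Y2 Y3 (f' : mor X2 X3) (f : mor X1 X2)
    (g' : mor Y2 Y3) (g : mor Y1 Y2) :
  (f' ∘ f) ⊗^ (g' ∘ g) = (f' ⊗^ g') ∘ (f ⊗^ g).
Proof. exact: bmapM. Qed.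

Lemma tens1M X Y1 Y2 Y3 (g' : mor Y2 Y3) (g : mor Y1 Y2) :
  idm X ⊗^ (g' ∘ g) = (idm X ⊗^ g') ∘ (idm X ⊗^ g).
Proof. by rewrite -tensM comp1m. Qed.

Lemma tensM1 X Y1 Y2 Y3 (g' : mor Y2 Y3) (g : mor Y1 Y2) :
  (g' ∘ g) ⊗^ idm X = (g' ⊗^ idm X) ∘ (g ⊗^ idm X).
Proof. by rewrite -tensM comp1m. Qed.

Lemma tens_suml X1 X2 Y1 Y2 I r (P : pred I) (G : I -> mor X1 X2)
    (g : mor Y1 Y2) :
  (\sum_(i <- r | P i) G i) ⊗^ g = \sum_(i <- r | P i) (G i ⊗^ g).
Proof. exact: (linear_sum _ _ _ (bmap_linl tens g)). Qed.

Lemma tens_sumr X1 X2 Y1 Y2 I r (P : pred I) (f : mor X1 X2)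
    (G : I -> mor Y1 Y2) :
  f ⊗^ (\sum_(i <- r | P i) G i) = \sum_(i <- r | P i) (f ⊗^ G i).
Proof. exact: (linear_sum _ _ _ (bmap_linr tens f)). Qed.

Lemma tens0m X1 X2 Y1 Y2 (g : mor Y1 Y2) : (0 : mor X1 X2) ⊗^ g = 0.
Proof. exact: linear0 (bmap_linl tens g). Qed.

Lemma tensm0 X1 X2 Y1 Y2 (f : mor X1 X2) : f ⊗^ (0 : mor Y1 Y2) = 0.
Proof. exact: linear0 (bmap_linr tens f). Qed.

Lemma fwd_inj X Y Z (i : iso X Y) (f g : mor Z X) :
  ifwd i ∘ f = ifwd i ∘ g -> f = g.
Proof. by move/(congr1 (mcomp (inv i))); rewrite !compA !invK !comp1m. Qed.

Lemma inv_inj X Y Z (i : iso X Y) (f g : mor Y Z) :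
  f ∘ ifwd i = g ∘ ifwd i -> f = g.
Proof.
by move/(congr1 (fun h => h ∘ inv i)); rewrite -!compA !fwdK !compm1.
Qed.

Lemma tens_one_inj X Y (f g : mor X Y) :
  idm munit ⊗^ f = idm munit ⊗^ g -> f = g.
Proof.
move=> e; apply: (@inv_inj _ _ _ (lunit X)).
by rewrite -!lunit_nat e.
Qed.

Lemma lunit_tens X Y :
  ifwd (lunit (X ⊗ Y)) = (ifwd (lunit X) ⊗^ idm Y) ∘ ifwd (assoc munit X Y).
Proof.
apply: tens_one_inj; apply: (@fwd_inj _ _ _ (assoc munit X Y)).
rewrite -triangle compA -(bmap1 tens X Y) assoc_nat -compA.
rewrite pentagon !compA -tensM1 triangle tens1M compA assoc_nat.
by [].
Qed.

End MonoidalTheory.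

Section Modules.
Context {F : fieldType} {C : braidedCat F} {A : C} (a : comAlg A).

Record amod := AMod {
  amod_ob :> C;
  act : mor (A ⊗ amod_ob) amod_ob;
  act1 : act ∘ (aone a ⊗^ idm amod_ob) = ifwd (lunit amod_ob);
  actA : act ∘ (idm A ⊗^ act)
         = act ∘ (amul a ⊗^ idm amod_ob) ∘ ifwd (assoc A A amod_ob) }.

Definition amod_hom_pred (M N : amod) : {pred mor M N} :=
  fun f => f ∘ act M == act N ∘ (idm A ⊗^ f).
Arguments amod_hom_pred : clear implicits.

Lemma amod_hom_closed (M N : amod) : submod_closed (amod_hom_pred M N).
Proof.
split=> [|k f g]; rewrite !unfold_in /amod_hom_pred.
  by rewrite comp0m tensm0 compm0.
move=> /eqP fE /eqP gE; rewrite compDl fE gE.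
by rewrite (bmap_linr tens (idm A) k f g) compDr.
Qed.

HB.instance Definition _ (M N : amod) :=
  GRing.isSubmodClosed.Build F (mor M N) (amod_hom_pred M N)
    (amod_hom_closed M N).

Record amod_hom (M N : amod) : Type := AModHom {
  amod_map : mor M N;
  _ : amod_map \in amod_hom_pred M N }.

HB.instance Definition _ (M N : amod) := [isSub of amod_hom M N for @amod_map M N].
HB.instance Definition _ (M N : amod) := [Choice of amod_hom M N by <:].
HB.instance Definition _ (M N : amod) :=
  [SubChoice_isSubLmodule of amod_hom M N by <:].

Lemma amod_mapP (M N : amod) (f : amod_hom M N) :
  amod_map f ∘ act M = act N ∘ (idm A ⊗^ amod_map f).
Proof. by case: f => f /= /eqP. Qed.

Fact amod_id_subproof (M : amod) : idm M \in amod_hom_pred M M.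
Proof. by rewrite unfold_in; apply/eqP; rewrite comp1m bmap1 compm1. Qed.

Fact amod_comp_subproof (M N P : amod) (g : amod_hom N P) (f : amod_hom M N) :
  amod_map g ∘ amod_map f \in amod_hom_pred M P.
Proof.
rewrite unfold_in; apply/eqP.
by rewrite -compA amod_mapP compA amod_mapP -compA -tens1M.
Qed.

Program Definition Rep : linCat F := {|
  ob := amod;
  mor := fun M N => amod_hom M N;
  idm := fun M => AModHom (amod_id_subproof M);
  mcomp := fun M N P g f => AModHom (amod_comp_subproof g f) |}.
Next Obligation. by move=> M N P f k g h; apply: val_inj; exact: compDl. Qed.
Next Obligation. by move=> M N P g k f h; apply: val_inj; exact: compDr. Qed.
Next Obligation. by move=> M N P Q h g f; apply: val_inj; exact: compA. Qed.
Next Obligation. by move=> M N f; apply: val_inj; exact: comp1m. Qed.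
Next Obligation. by move=> M N f; apply: val_inj; exact: compm1. Qed.

Program Definition regular : Rep := {| amod_ob := A; act := amul a |}.
Next Obligation. exact: amul1m. Qed.
Next Obligation. exact: amulA. Qed.

Definition simple_alg := simple regular.

Definition ind_act (W : C) : mor (A ⊗ (A ⊗ W)) (A ⊗ W) :=
  (amul a ⊗^ idm W) ∘ ifwd (assoc A A W).

Fact ind_act1 W : ind_act W ∘ (aone a ⊗^ idm (A ⊗ W)) = ifwd (lunit (A ⊗ W)).
Proof.
rewrite -(bmap1 tens A W) -compA assoc_nat compA -tensM1 amul1m.
by rewrite lunit_tens.
Qed.

Fact ind_actA W :
  ind_act W ∘ (idm A ⊗^ ind_act W)
  = ind_act W ∘ (amul a ⊗^ idm (A ⊗ W)) ∘ ifwd (assoc A A (A ⊗ W)).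
Proof.
rewrite /ind_act -(bmap1 tens A W) -[in RHS](compA (amul a ⊗^ idm W)).
rewrite assoc_nat tens1M compA -(compA (amul a ⊗^ idm W)) assoc_nat.
rewrite !compA -!tensM1 amulA -[in RHS]compA pentagon.
by rewrite !compA -!tensM1.
Qed.

Definition ind_ob (W : C) : Rep := AMod (ind_act1 W) (ind_actA W).

Fact ind_map_subproof (W X : C) (f : mor W X) :
  idm A ⊗^ f \in amod_hom_pred (ind_ob W) (ind_ob X).
Proof.
rewrite unfold_in; apply/eqP; rewrite /= /ind_act compA -tensM.
rewrite comp1m compm1 -compA assoc_nat compA -tensM bmap1.
by rewrite compm1 comp1m.
Qed.

Program Definition induction : linFun C Rep := {|
  fob := ind_ob;
  fmap := fun W X f => AModHom (ind_map_subproof f) |}.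
Next Obligation.
by move=> W X k f g; apply: val_inj; exact: (bmap_linr tens).
Qed.
Next Obligation. by move=> W; apply: val_inj; exact: bmap1. Qed.
Next Obligation. by move=> W X Y g f; apply: val_inj; exact: tens1M. Qed.

End Modules.

(* Formal direct sums. Sets are rendered as choiceTypes, which is no       *)
(* restriction classically (gen_choiceMixin).                               *)
Record dsob (F : fieldType) (C : linCat F) := DsOb {
  dsidx : choiceType;
  dsfam :> dsidx -> C }.

Record dshom (F : fieldType) (C : linCat F) (X Y : dsob C) : Type := DsHom {
  entry :> forall s t, mor (X s) (Y t);
  entry_fin : forall s, finite_set [set t | entry s t <> 0] }.

Section DsLin.
Context {F : fieldType} {C : linCat F}.
Implicit Types X Y Z W : dsob C.

Lemma dshomP X Y (f g : dshom X Y) : (forall s t, f s t = g s t) -> f = g.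
Proof.
case: f g => f fP [g gP] /= e.
have {e} e : f = g by apply: functional_extensionality_dep => s;
  apply: functional_extensionality_dep => t.
by case: g / e gP => gP; congr DsHom; exact: Prop_irrelevance.
Qed.

HB.instance Definition _ X Y := gen_eqMixin (dshom X Y).
HB.instance Definition _ X Y := gen_choiceMixin (dshom X Y).

Fact dszero_fin X Y (s : dsidx X) :
  finite_set [set t : dsidx Y | (0 : mor (X s) (Y t)) <> 0].
Proof. by apply: (@sub_finite_set _ _ set0) => // t /= /(_ erefl). Qed.

Definition dszero X Y : dshom X Y := DsHom (@dszero_fin X Y).

Fact dsopp_fin X Y (f : dshom X Y) s : finite_set [set t | - f s t <> 0].
Proof.
apply: sub_finite_set (entry_fin f s) => t /= f0 e; apply: f0.
by rewrite e oppr0.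
Qed.

Definition dsopp X Y (f : dshom X Y) : dshom X Y := DsHom (dsopp_fin f).

Fact dsadd_fin X Y (f g : dshom X Y) s :
  finite_set [set t | f s t + g s t <> 0].
Proof.
apply: (@sub_finite_set _ _ ([set t | f s t <> 0] `|` [set t | g s t <> 0])).
  move=> t /= fg0; apply: contrapT => /not_orP[/contrapT f0 /contrapT g0].
  by apply: fg0; rewrite f0 g0 addr0.
by rewrite finite_setU; split; exact: entry_fin.
Qed.

Definition dsadd X Y (f g : dshom X Y) : dshom X Y := DsHom (dsadd_fin f g).

Fact dsscale_fin X Y (k : F) (f : dshom X Y) s :
  finite_set [set t | k *: f s t <> 0].
Proof.
apply: sub_finite_set (entry_fin f s) => t /= f0 e; apply: f0.
by rewrite e scaler0.
Qed.

Definition dsscale X Y (k : F) (f : dshom X Y) : dshom X Y :=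
  DsHom (dsscale_fin k f).

Section Module.
Variables X Y : dsob C.

Fact dsaddA : associative (@dsadd X Y).
Proof. by move=> f g h; apply: dshomP => s t /=; rewrite addrA. Qed.
Fact dsaddC : commutative (@dsadd X Y).
Proof. by move=> f g; apply: dshomP => s t /=; rewrite addrC. Qed.
Fact dsadd0 : left_id (@dszero X Y) (@dsadd X Y).
Proof. by move=> f; apply: dshomP => s t /=; rewrite add0r. Qed.
Fact dsaddN : left_inverse (@dszero X Y) (@dsopp X Y) (@dsadd X Y).
Proof. by move=> f; apply: dshomP => s t /=; rewrite addNr. Qed.

HB.instance Definition _ :=
  GRing.isZmodule.Build (dshom X Y) dsaddA dsaddC dsadd0 dsaddN.

Fact dsscaleA (k l : F) (f : dshom X Y) :
  dsscale k (dsscale l f) = dsscale (k * l) f.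
Proof. by apply: dshomP => s t /=; rewrite scalerA. Qed.
Fact dsscale1 : left_id 1 (@dsscale X Y).
Proof. by move=> f; apply: dshomP => s t /=; rewrite scale1r. Qed.
Fact dsscaleDr : right_distributive (@dsscale X Y) +%R.
Proof. by move=> k f g; apply: dshomP => s t /=; rewrite scalerDr. Qed.
Fact dsscaleDl (f : dshom X Y) :
  {morph (@dsscale X Y)^~ f : k l / k + l}.
Proof. by move=> k l; apply: dshomP => s t /=; rewrite scalerDl. Qed.

HB.instance Definition _ := GRing.Zmodule_isLmodule.Build F (dshom X Y)
  dsscaleA dsscale1 dsscaleDr dsscaleDl.

End Module.

Lemma finite_suppP (I : choiceType) (A : set I) : finite_set A ->
  exists2 r : seq I, uniq r & forall i, A i -> i \in r.
Proof.
move=> /finite_seqP[r ->]; exists (undup r); first exact: undup_uniq.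
by move=> i; rewrite mem_undup.
Qed.

Lemma fsum_seq (I : choiceType) (M : nmodType) (r : seq I) (G : I -> M) :
  uniq r -> (forall i, G i <> 0 -> i \in r) ->
  \sum_(i \in [set: I]) G i = \sum_(i <- r) G i.
Proof.
move=> ur Gr; rewrite (fsbigE r) //; first by apply: eq_bigl => i; apply: mem_set.
by move=> i _ /negP ir; apply: contrapT => /Gr.
Qed.

Lemma fsum1 (I : choiceType) (M : nmodType) (j : I) (G : I -> M) :
  (forall i, i <> j -> G i = 0) -> \sum_(i \in [set: I]) G i = G j.
Proof.
move=> Gj; rewrite (@fsum_seq _ _ [:: j]) ?big_seq1 // => i Gi.
by rewrite inE; apply/eqP; apply: contrapT => /Gj.
Qed.

Fact dscomp_fin X Y Z (g : dshom Y Z) (f : dshom X Y) s :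
  finite_set [set u | \sum_(t \in [set: dsidx Y]) (g t u ∘ f s t) <> 0].
Proof.
apply: (@sub_finite_set _ _
  (\bigcup_(t in [set t | f s t <> 0]) [set u | g t u <> 0])).
  move=> u /=; apply: contra_notP => gf0; apply: fsbig1 => t _.
  apply: contrapT => gft; apply: gf0; exists t => /= e; apply: gft.
    by rewrite e compm0.
  by rewrite e comp0m.
by apply: bigcup_finite => [|t _]; exact: entry_fin.
Qed.

Definition dscomp X Y Z (g : dshom Y Z) (f : dshom X Y) : dshom X Z :=
  DsHom (dscomp_fin g f).

Lemma dscompE X Y Z (g : dshom Y Z) (f : dshom X Y) s u (r : seq (dsidx Y)) :
  uniq r -> (forall t, f s t <> 0 -> t \in r) ->
  dscomp g f s u = \sum_(t <- r) (g t u ∘ f s t).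
Proof.
move=> ur fr; apply: fsum_seq => // t gf; apply: fr => f0; apply: gf.
by rewrite f0 compm0.
Qed.

(* The morphism with component h s from the summand s to the summand phi s. *)
Definition dspure_entry X Y (phi : dsidx X -> dsidx Y)
    (h : forall s, mor (X s) (Y (phi s))) s t : mor (X s) (Y t) :=
  match phi s =P t with
  | ReflectT e => ecast t (mor (X s) (Y t)) e (h s)
  | ReflectF _ => 0
  end.

Lemma dspure_entryE X Y (phi : dsidx X -> dsidx Y)
    (h : forall s, mor (X s) (Y (phi s))) s :
  dspure_entry h s (phi s) = h s.
Proof.
by rewrite /dspure_entry; case: eqP => // e; rewrite (eq_axiomK e).
Qed.

Lemma dspure_entry0 X Y (phi : dsidx X -> dsidx Y)
    (h : forall s, mor (X s) (Y (phi s))) s t :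
  t <> phi s -> dspure_entry h s t = 0.
Proof. by rewrite /dspure_entry; case: eqP => // e /(_ (esym e)). Qed.

Fact dspure_fin X Y (phi : dsidx X -> dsidx Y)
    (h : forall s, mor (X s) (Y (phi s))) s :
  finite_set [set t | dspure_entry h s t <> 0].
Proof.
apply: (@sub_finite_set _ _ [set phi s]) => // t /=.
by apply: contra_notP => /dspure_entry0 ->.
Qed.

Definition dspure X Y (phi : dsidx X -> dsidx Y)
    (h : forall s, mor (X s) (Y (phi s))) : dshom X Y := DsHom (dspure_fin h).

Lemma dspure_ext X Y (phi psi : dsidx X -> dsidx Y)
    (h : forall s, mor (X s) (Y (phi s))) (k : forall s, mor (X s) (Y (psi s))) :
  (forall s, existT (fun t => mor (X s) (Y t)) (phi s) (h s)
             = existT (fun t => mor (X s) (Y t)) (psi s) (k s)) ->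
  dspure h = dspure k.
Proof.
move=> e; apply: dshomP => s t; rewrite /= /dspure_entry.
exact: (congr1 (fun p : {u & mor (X s) (Y u)} =>
  match projT1 p =P t with
  | ReflectT e => ecast t (mor (X s) (Y t)) e (projT2 p)
  | ReflectF _ => 0
  end) (e s)).
Qed.

Lemma dscomp_pure X Y Z (f : dshom Y Z) (phi : dsidx X -> dsidx Y)
    (h : forall s, mor (X s) (Y (phi s))) s t :
  dscomp f (dspure h) s t = f (phi s) t ∘ h s.
Proof.
rewrite /= (@fsum1 _ _ (phi s)) ?dspure_entryE // => u /dspure_entry0 ->.
exact: compm0.
Qed.

Lemma dspure_comp X Y Z (f : dshom X Y) (psi : dsidx Y -> dsidx Z)
    (k : forall s, mor (Y s) (Z (psi s))) s t : injective psi ->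
  dscomp (dspure k) f s (psi t) = k t ∘ f s t.
Proof.
move=> psiI; rewrite /= (@fsum1 _ _ t) ?dspure_entryE // => u ut.
by rewrite dspure_entry0 ?comp0m // => /psiI /esym.
Qed.

Lemma dspureM X Y Z (psi : dsidx Y -> dsidx Z)
    (k : forall s, mor (Y s) (Z (psi s))) (phi : dsidx X -> dsidx Y)
    (h : forall s, mor (X s) (Y (phi s))) :
  dscomp (dspure k) (dspure h)
  = dspure (phi := fun s => psi (phi s)) (fun s => k (phi s) ∘ h s).
Proof.
apply: dshomP => s t; rewrite dscomp_pure /= /dspure_entry.
by case: eqP => [e|_]; [case: t / e | rewrite comp0m].
Qed.

Definition dsid X : dshom X X := dspure (phi := id) (fun s => idm (X s)).

Fact dscomp_linl X Y Z (f : dshom X Y) :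
  linear (fun g : dshom Y Z => dscomp g f).
Proof.
move=> k g h; apply: dshomP => s u.
have [r ur fr] := finite_suppP (entry_fin f s).
transitivity (k *: dscomp g f s u + dscomp h f s u); last by [].
rewrite !(dscompE _ _ ur fr).
by rewrite scaler_sumr -big_split; apply: eq_bigr => t _; exact: compDl.
Qed.

Fact dscomp_linr X Y Z (g : dshom Y Z) :
  linear (fun f : dshom X Y => dscomp g f).
Proof.
move=> k f h; apply: dshomP => s u.
have [r ur fhr] : exists2 r, uniq r &
    forall t, ([set t | f s t <> 0] `|` [set t | h s t <> 0]) t -> t \in r.
  by apply: finite_suppP; rewrite finite_setU; split; exact: entry_fin.
have fr t : f s t <> 0 -> t \in r by move=> ?; apply: fhr; left.
have hr t : h s t <> 0 -> t \in r by move=> ?; apply: fhr; right.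
transitivity (k *: dscomp g f s u + dscomp g h s u); last by [].
rewrite (dscompE _ _ ur fr) (dscompE _ _ ur hr) (@dscompE _ _ _ _ _ _ _ r) //.
  by rewrite scaler_sumr -big_split; apply: eq_bigr => t _; exact: compDr.
move=> t /= fh0; apply: fhr => /=; apply: contrapT.
by move=> /not_orP[/contrapT f0 /contrapT h0]; apply: fh0;
  rewrite f0 h0 scaler0 addr0.
Qed.

Fact dscompA X Y Z W (h : dshom Z W) (g : dshom Y Z) (f : dshom X Y) :
  dscomp h (dscomp g f) = dscomp (dscomp h g) f.
Proof.
apply: dshomP => s v.
have [r ur fr] := finite_suppP (entry_fin f s).
have [q uq gq] : exists2 q, uniq q & forall u,
    (\bigcup_(t in [set t | t \in r]) [set u | g t u <> 0]) u -> u \in q.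
  apply: finite_suppP; apply: bigcup_finite => [|t _]; last exact: entry_fin.
  by apply/finite_seqP; exists r.
rewrite (dscompE _ _ ur fr) (@dscompE _ _ _ _ _ _ _ q) //; last first.
  move=> u; rewrite (dscompE _ _ ur fr) => gf; apply: gq.
  apply: contrapT => n; apply: gf; rewrite big_seq big1 // => t tr.
  have [->|/eqP g0] := eqVneq (g t u) 0; first exact: comp0m.
  by case: n; exists t.
under eq_bigr => u _ do rewrite (dscompE _ _ ur fr) comp_sumr.
rewrite exchange_big [LHS]big_seq [RHS]big_seq; apply: eq_bigr => t tr.
rewrite (@dscompE _ _ _ _ _ _ _ q) //.
  by rewrite comp_suml; apply: eq_bigr => u _; rewrite compA.
by move=> u gtu; apply: gq; exists t.
Qed.

Fact dscomp1m X Y (f : dshom X Y) : dscomp (dsid Y) f = f.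
Proof.
apply: dshomP => s t; have := @dspure_comp X Y Y f id (fun s => idm (Y s)) s t.
by rewrite comp1m; exact.
Qed.

Fact dscompm1 X Y (f : dshom X Y) : dscomp f (dsid X) = f.
Proof. by apply: dshomP => s t; rewrite dscomp_pure compm1. Qed.

End DsLin.

Definition dsLin (F : fieldType) (C : linCat F) : linCat F := {|
  ob := dsob C;
  mor := fun X Y => dshom X Y;
  idm := @dsid F C;
  mcomp := @dscomp F C;
  comp_linl := @dscomp_linl F C;
  comp_linr := @dscomp_linr F C;
  compA := @dscompA F C;
  comp1m := @dscomp1m F C;
  compm1 := @dscompm1 F C |}.

Section DsMon.
Context {F : fieldType} {C : monCat F}.
Implicit Types X Y Z W : dsob C.

Definition dstens X Y : dsob C :=
  {| dsidx := (dsidx X * dsidx Y)%type; dsfam := fun p => X p.1 ⊗ Y p.2 |}.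

Fact dstensm_fin X1 X2 Y1 Y2 (f : dshom X1 X2) (g : dshom Y1 Y2)
    (p : dsidx (dstens X1 Y1)) :
  finite_set [set q : dsidx (dstens X2 Y2)
             | f p.1 q.1 ⊗^ g p.2 q.2 <> 0].
Proof.
apply: (@sub_finite_set _ _
  ([set t | f p.1 t <> 0] `*` [set t | g p.2 t <> 0])).
  by move=> [t u] /= fg; split=> /= e; apply: fg; rewrite e ?tens0m ?tensm0.
by apply: finite_setX; exact: entry_fin.
Qed.

Definition dstensm X1 X2 Y1 Y2 (f : dshom X1 X2) (g : dshom Y1 Y2) :
  dshom (dstens X1 Y1) (dstens X2 Y2) := DsHom (dstensm_fin f g).

Lemma dstensm_pure X1 X2 Y1 Y2
    (phi : dsidx X1 -> dsidx X2) (h : forall s, mor (X1 s) (X2 (phi s)))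
    (psi : dsidx Y1 -> dsidx Y2) (k : forall s, mor (Y1 s) (Y2 (psi s))) :
  dstensm (dspure h) (dspure k)
  = @dspure F C (dstens X1 Y1) (dstens X2 Y2)
      (fun p => (phi p.1, psi p.2)) (fun p => h p.1 ⊗^ k p.2).
Proof.
apply: dshomP => -[s1 s2] [t1 t2] /=.
have [-> | /eqP t1s] := eqVneq t1 (phi s1); last first.
  by rewrite (dspure_entry0 h t1s) tens0m dspure_entry0 // => -[].
have [-> | /eqP t2s] := eqVneq t2 (psi s2); last first.
  by rewrite (dspure_entry0 k t2s) tensm0 dspure_entry0 // => -[].
by rewrite !dspure_entryE.
Qed.

Fact dstensm1 X Y : dstensm (dsid X) (dsid Y) = dsid (dstens X Y).
Proof.
rewrite dstensm_pure; apply: dspure_ext => -[s t] /=.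
by congr existT; exact: bmap1.
Qed.

Fact dstensmM X1 X2 X3 Y1 Y2 Y3 (f' : dshom X2 X3) (f : dshom X1 X2)
    (g' : dshom Y2 Y3) (g : dshom Y1 Y2) :
  dstensm (dscomp f' f) (dscomp g' g)
  = dscomp (dstensm f' g') (dstensm f g).
Proof.
apply: dshomP => -[s1 s2] [u1 u2].
have [r ur fr] := finite_suppP (entry_fin f s1).
have [q uq gq] := finite_suppP (entry_fin g s2).
rewrite (@dscompE _ _ _ (dstens X2 Y2) _ _ _ _ _
  [seq (x, y) | x <- r, y <- q]); first last.
- move=> [t1 t2] /= fg; apply/allpairsP; exists (t1, t2); split=> //=.
    by apply: fr => e; apply: fg; rewrite e tens0m.
  by apply: gq => e; apply: fg; rewrite e tensm0.
- by apply: allpairs_uniq => // -[? ?] [? ?] _ _ [-> ->].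
transitivity (dscomp f' f s1 u1 ⊗^ dscomp g' g s2 u2); first by [].
rewrite (dscompE _ _ ur fr) (dscompE _ _ uq gq) big_allpairs tens_suml.
apply: eq_bigr => t1 _; rewrite tens_sumr; apply: eq_bigr => t2 _.
by rewrite tensM.
Qed.

Fact dstensm_linl X1 X2 Y1 Y2 (g : dshom Y1 Y2) :
  linear (fun f : dshom X1 X2 => dstensm f g).
Proof. by move=> k f f'; apply: dshomP => s t; exact: (bmap_linl tens). Qed.

Fact dstensm_linr X1 X2 Y1 Y2 (f : dshom X1 X2) :
  linear (fun g : dshom Y1 Y2 => dstensm f g).
Proof. by move=> k g g'; apply: dshomP => s t; exact: (bmap_linr tens). Qed.

Definition dsTens : bifun (dsLin C) (dsLin C) (dsLin C) :=
  @Bifun F (dsLin C) (dsLin C) (dsLin C) dstens dstensm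
    dstensm_linl dstensm_linr dstensm1 dstensmM.

Definition dsone (X : C) : dsLin C := @DsOb F C unit (fun _ => X).

Program Definition dsassoc (X Y Z : dsLin C) :
    iso (dsTens X (dsTens Y Z)) (dsTens (dsTens X Y) Z) := {|
  ifwd := @dspure F C (dstens X (dstens Y Z)) (dstens (dstens X Y) Z)
    (fun p => ((p.1, p.2.1), p.2.2))
    (fun p => ifwd (assoc (X p.1) (Y p.2.1) (Z p.2.2)));
  inv := @dspure F C (dstens (dstens X Y) Z) (dstens X (dstens Y Z))
    (fun p => (p.1.1, (p.1.2, p.2)))
    (fun p => inv (assoc (X p.1.1) (Y p.1.2) (Z p.2))) |}.
Next Obligation.
move=> X Y Z; rewrite /= dspureM; apply: dspure_ext => -[s [t u]] /=.
by rewrite invK.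
Qed.
Next Obligation.
move=> X Y Z; rewrite /= dspureM; apply: dspure_ext => -[[s t] u] /=.
by rewrite fwdK.
Qed.

Program Definition dslunit (X : dsLin C) : iso (dsTens (dsone munit) X) X := {|
  ifwd := @dspure F C (dstens (dsone munit) X) X
    snd (fun p => ifwd (lunit (X p.2)));
  inv := @dspure F C X (dstens (dsone munit) X)
    (fun s => (tt, s)) (fun s => inv (lunit (X s))) |}.
Next Obligation.
move=> X; rewrite /= dspureM; apply: dspure_ext => -[[] s] /=.
by rewrite invK.
Qed.
Next Obligation.
by move=> X; rewrite /= dspureM; apply: dspure_ext => s /=; rewrite fwdK.
Qed.

Program Definition dsrunit (X : dsLin C) : iso (dsTens X (dsone munit)) X := {|
  ifwd := @dspure F C (dstens X (dsone munit)) X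
    fst (fun p => ifwd (runit (X p.1)));
  inv := @dspure F C X (dstens X (dsone munit))
    (fun s => (s, tt)) (fun s => inv (runit (X s))) |}.
Next Obligation.
move=> X; rewrite /= dspureM; apply: dspure_ext => -[s []] /=.
by rewrite invK.
Qed.
Next Obligation.
by move=> X; rewrite /= dspureM; apply: dspure_ext => s /=; rewrite fwdK.
Qed.

Program Definition dsMon : monCat F := {|
  mcat := dsLin C;
  tens := dsTens;
  munit := dsone munit;
  assoc := dsassoc;
  lunit := dslunit;
  runit := dsrunit |}.
Next Obligation.
move=> X1 X2 Y1 Y2 Z1 Z2 f g h; apply: dshomP => -[s1 [s2 s3]] [[t1 t2] t3].
rewrite [RHS]dscomp_pure.
apply: etrans (@dspure_comp _ _ _ (dstens X2 (dstens Y2 Z2))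
  (dstens (dstens X2 Y2) Z2) _ (fun p => ((p.1, p.2.1), p.2.2)) _ _
  (t1, (t2, t3)) _) _; last exact: assoc_nat.
by move=> [? [? ?]] [? [? ?]] [-> -> ->].
Qed.
Next Obligation.
move=> X Y f; apply: dshomP => -[[] s] t; rewrite [RHS]dscomp_pure.
apply: etrans (@dspure_comp _ _ _ (dstens (dsone munit) Y) Y _ snd _ _
  (tt, t) _) _; last first.
  rewrite /= -lunit_nat; congr (_ ∘ (_ ⊗^ _)).
  exact: (@dspure_entryE _ _ (dsone munit) (dsone munit) id (fun _ => idm munit) tt).
by move=> [[] ?] [[] ?] /= ->.
Qed.
Next Obligation.
move=> X Y f; apply: dshomP => -[s []] t; rewrite [RHS]dscomp_pure.
apply: etrans (@dspure_comp _ _ _ (dstens Y (dsone munit)) Y _ fst _ _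
  (t, tt) _) _; last first.
  rewrite /= -runit_nat; congr (_ ∘ (_ ⊗^ _)).
  exact: (@dspure_entryE _ _ (dsone munit) (dsone munit) id (fun _ => idm munit) tt).
by move=> [? []] [? []] /= ->.
Qed.
Next Obligation.
move=> X Y Z W /=; rewrite !dstensm_pure !dspureM.
apply: dspure_ext => -[s1 [s2 [s3 s4]]] /=.
by congr existT; exact: pentagon.
Qed.
Next Obligation.
move=> X Y /=; rewrite !dstensm_pure !dspureM.
apply: dspure_ext => -[s1 [[] s2]] /=.
by congr existT; exact: triangle.
Qed.

End DsMon.

Arguments dsMon {F} C.

Section DsBraided.
Context {F : fieldType} {C : braidedCat F}.

Program Definition dsbraid (X Y : dsMon C) : iso (X ⊗ Y) (Y ⊗ X) := {|
  ifwd := @dspure F C (dstens X Y) (dstens Y X)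
    (fun p => (p.2, p.1)) (fun p => ifwd (braid (X p.1) (Y p.2)));
  inv := @dspure F C (dstens Y X) (dstens X Y)
    (fun p => (p.2, p.1)) (fun p => inv (braid (X p.2) (Y p.1))) |}.
Next Obligation.
move=> X Y; rewrite /= dspureM; apply: dspure_ext => -[s t] /=.
by rewrite invK.
Qed.
Next Obligation.
move=> X Y; rewrite /= dspureM; apply: dspure_ext => -[s t] /=.
by rewrite fwdK.
Qed.

Program Definition dsBraided : braidedCat F := {|
  bcat := dsMon C;
  braid := dsbraid |}.
Next Obligation.
move=> X1 X2 Y1 Y2 f g; apply: dshomP => -[s1 s2] [t1 t2].
rewrite [RHS]dscomp_pure.
apply: etrans (@dspure_comp _ _ _ (dstens X2 Y2) (dstens Y2 X2) _
  (fun p => (p.2, p.1)) _ _ (t2, t1) _) _; last exact: braid_nat.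
by move=> [? ?] [? ?] [-> ->].
Qed.
Next Obligation.
move=> X Y Z /=; rewrite !dstensm_pure !dspureM.
apply: dspure_ext => -[s1 [s2 s3]] /=.
by congr existT; exact: hexagon1.
Qed.
Next Obligation.
move=> X Y Z /=; rewrite !dstensm_pure !dspureM.
apply: dspure_ext => -[[s1 s2] s3] /=.
by congr existT; exact: hexagon2.
Qed.

End DsBraided.

Arguments dsBraided {F} C.

Section DsTwisted.
Context {F : fieldType} {C : twistedCat F}.

Program Definition dstwist (X : dsBraided C) : iso X X := {|
  ifwd := @dspure F C X X id (fun s => ifwd (twist (X s)));
  inv := @dspure F C X X id (fun s => inv (twist (X s))) |}.
Next Obligation.
by move=> X; rewrite /= dspureM; apply: dspure_ext => s /=; rewrite invK.
Qed.
Next Obligation.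
by move=> X; rewrite /= dspureM; apply: dspure_ext => s /=; rewrite fwdK.
Qed.

Program Definition dsCompletion : twistedCat F := {|
  tcat := dsBraided C;
  twist := dstwist |}.
Next Obligation.
move=> X Y f; apply: dshomP => s t; rewrite [RHS]dscomp_pure.
apply: etrans (@dspure_comp _ _ _ Y Y _ id _ _ t _) _ => //.
exact: twist_nat.
Qed.
Next Obligation.
by apply: dspure_ext => -[] /=; rewrite twist1.
Qed.
Next Obligation.
move=> X Y /=; rewrite !dstensm_pure !dspureM.
apply: dspure_ext => -[s t] /=.
by congr existT; exact: twistM.
Qed.

Definition dsum (I : choiceType) (X : I -> C) : dsCompletion := DsOb X.

Definition ds_emb (X : C) : dsCompletion := dsone X.

Definition dsum_inc (I : choiceType) (X : I -> C) (i : I) :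
    mor (ds_emb (X i)) (dsum X) :=
  @dspure F C (dsone (X i)) (DsOb X) (fun _ => i) (fun _ => idm (X i)).

End DsTwisted.

Arguments dsCompletion {F} C.

(* Main.v *)
From Pilot Require Import Defs.
From mathcomp Require Import all_boot all_order all_algebra.
From mathcomp Require Import boolp classical_sets functions cardinality fsbigop.

(** Write ⊠ for the Deligne product, A_i = U_i ⊠ V_i and X^* for duals. A-linear
    maps F(X) -> F(Y) are morphisms X -> A ⊗ Y, and inserting coev(V_i) gives
    φ : U_i ⊠ 1 -> A_i ⊗ (1 ⊠ V_i^* ) -> A ⊗ (1 ⊠ V_i^* ).
    To invert φ, let ρ be the projection of A onto the unit summand. The radical
    of the pairing ρμ on A is an ideal, so simplicity of A makes the pairing
    nondegenerate. As the U_i are pairwise non-isomorphic simples, it pairs A_i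
    with a single A_j, and nondegeneracy produces κ_a : 1 -> U_j ⊗ U_i and
    η_a : V_i^* -> V_j such that ∑_a κ_a ⊠ η_a defines
    ψ : 1 ⊠ V_i^* -> A ⊗ (U_i ⊠ 1) with ρ(φψ) = id. Since Hom(1, U_c) = 0 for
    c <> 0, φψ has no other component, so φψ is the identity. Since
    Hom(1, V_c) = 0 for c <> 0, ψφ comes from an idempotent of the division
    algebra End(U_i); it is nonzero, hence the identity.
    These vanishing statements rest on
    Hom(S ⊠ Y, X ⊠ Y') = Hom(S, X) ⊗ Hom(Y, Y'), which follows from the universal
    property of ⊠ applied to (X, Y) |-> Hom(S, X) ⊗ Y from U x V to V. *)

Set Implicit Arguments.
Unset Strict Implicit.
Unset Printing Implicit Defensive.

Import GRing.Theory.
Local Open Scope classical_set_scope.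
Local Open Scope ring_scope.
Local Open Scope cat_scope.

(* functions exports other constants named inv and invK. *)
Import Pilot.Defs.

(** Two difficulties shape the proof. The field is arbitrary, so End(U_i) is only a division
    algebra, and the pairing of A_j with A_i need not be a single product of a form on U_j ⊗ U_i and
    a form on V_j ⊗ V_i; hence the sum over a. The family is read off a matrix of morphisms V_j ->
    V_i^* indexed by bases of End(U_j) and Hom(U_j^*, U_i). Nondegeneracy on the two sides makes
    this matrix mono and epi, and in the abelian category V that already makes it invertible. The
    hypotheses on dimensions give End(1) = F in both categories, which turns morphisms 1 ⊠ Y -> 1 ⊠
    Y' into morphisms Y -> Y'. The second difficulty is that the direct sum completion need not be
    abelian, so neither kernels nor [is_deligne] are at hand there. What the argument uses of A is
    therefore isolated as hypotheses on inclusions, projections and a radical, and the formula for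
    Hom is carried along the full embedding of C. *)

Section IsoTheory.
Context {F : fieldType} {C : linCat F}.
Implicit Types X Y Z : C.

Definition iso_refl X : iso X X :=
  {| ifwd := idm X; Defs.inv := idm X; invK := comp1m _; fwdK := comp1m _ |}.

Definition iso_sym X Y (i : iso X Y) : iso Y X :=
  {| ifwd := inv i; Defs.inv := ifwd i; invK := fwdK i; fwdK := invK i |}.

Definition iso_comp X Y Z (j : iso Y Z) (i : iso X Y) : iso X Z.
Proof.
exists (ifwd j ∘ ifwd i) (inv i ∘ inv j).
  by rewrite -compA (compA (inv j)) invK comp1m invK.
by rewrite -compA (compA (ifwd i)) fwdK comp1m fwdK.
Defined.

Lemma invKl X Y Z (i : iso X Y) (f : mor Z X) : inv i ∘ (ifwd i ∘ f) = f.
Proof. by rewrite compA invK comp1m. Qed.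

Lemma fwdKl X Y Z (i : iso X Y) (f : mor Z Y) : ifwd i ∘ (inv i ∘ f) = f.
Proof. by rewrite compA fwdK comp1m. Qed.

Lemma inv_cancell X Y Z (i : iso X Y) (f g : mor Z Y) :
  inv i ∘ f = inv i ∘ g -> f = g.
Proof. by move/(congr1 (mcomp (ifwd i))); rewrite !fwdKl. Qed.

Lemma fwd_cancell X Y Z (i : iso X Y) (f g : mor Z X) :
  ifwd i ∘ f = ifwd i ∘ g -> f = g.
Proof. by move/(congr1 (mcomp (inv i))); rewrite !invKl. Qed.

Lemma fwd_cancelr X Y Z (i : iso X Y) (f g : mor Y Z) :
  f ∘ ifwd i = g ∘ ifwd i -> f = g.
Proof. by move/(congr1 (mcomp^~ (inv i))); rewrite -!compA !fwdK !compm1. Qed.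

Lemma inv_cancelr X Y Z (i : iso X Y) (f g : mor X Z) :
  f ∘ inv i = g ∘ inv i -> f = g.
Proof. by move/(congr1 (mcomp^~ (ifwd i))); rewrite -!compA !invK !compm1. Qed.

Lemma iso_mover X Y Z (i : iso X Y) (f : mor X Z) (g : mor Y Z) :
  f = g ∘ ifwd i -> f ∘ inv i = g.
Proof. by move=> ->; rewrite -compA fwdK compm1. Qed.

Lemma iso_movel X Y Z (i : iso X Y) (f : mor Z Y) (g : mor Z X) :
  f = ifwd i ∘ g -> inv i ∘ f = g.
Proof. by move=> ->; rewrite invKl. Qed.

End IsoTheory.

Definition fmap_iso (F : fieldType) (C D : linCat F) (H : linFun C D) (X Y : C)
  (i : iso X Y) : iso (H X) (H Y).
Proof.
by exists (fmap H (ifwd i)) (fmap H (inv i)); rewrite -fmapM ?invK ?fwdK fmap1.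
Defined.

(** * Coherence and duality *)

Section Coherence.
Context {F : fieldType} {C : monCat F}.
Implicit Types X Y Z W T : C.

Lemma tens_interchange X1 X2 Y1 Y2 (f : mor X1 X2) (g : mor Y1 Y2) :
  (f ⊗^ idm Y2) ∘ (idm X1 ⊗^ g) = (idm X2 ⊗^ g) ∘ (f ⊗^ idm Y1).
Proof. by rewrite -!tensM !comp1m !compm1. Qed.

Lemma assocV_nat X1 X2 Y1 Y2 Z1 Z2
    (f : mor X1 X2) (g : mor Y1 Y2) (h : mor Z1 Z2) :
  inv (assoc X2 Y2 Z2) ∘ ((f ⊗^ g) ⊗^ h)
  = (f ⊗^ (g ⊗^ h)) ∘ inv (assoc X1 Y1 Z1).
Proof.
by apply: iso_movel; rewrite compA assoc_nat -compA fwdK compm1.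
Qed.

Lemma lunitV_nat X Y (f : mor X Y) :
  (idm munit ⊗^ f) ∘ inv (lunit X) = inv (lunit Y) ∘ f.
Proof. by apply: esym; apply: iso_movel; rewrite compA lunit_nat -compA fwdK compm1. Qed.

Lemma runitV_nat X Y (f : mor X Y) :
  (f ⊗^ idm munit) ∘ inv (runit X) = inv (runit Y) ∘ f.
Proof. by apply: esym; apply: iso_movel; rewrite compA runit_nat -compA fwdK compm1. Qed.

Lemma one_tens_inj X Y (f g : mor X Y) :
  f ⊗^ idm munit = g ⊗^ idm munit -> f = g.
Proof. by move=> e; apply: (@inv_inj _ _ _ _ _ (runit X)); rewrite -!runit_nat e. Qed.

Lemma tens1K X Y Z (i : iso X Y) :
  (idm Z ⊗^ ifwd i) ∘ (idm Z ⊗^ inv i) = idm _.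
Proof. by rewrite -tens1M fwdK bmap1. Qed.

Lemma tensK1 X Y Z (i : iso X Y) :
  (ifwd i ⊗^ idm Z) ∘ (inv i ⊗^ idm Z) = idm _.
Proof. by rewrite -tensM1 fwdK bmap1. Qed.

Definition tens_iso X1 X2 Y1 Y2 (i : iso X1 X2) (j : iso Y1 Y2) :
    iso (X1 ⊗ Y1) (X2 ⊗ Y2).
Proof.
exists (ifwd i ⊗^ ifwd j) (inv i ⊗^ inv j); rewrite -tensM ?invK ?fwdK bmap1 //.
Defined.

(** Kelly's argument: the claim is tested after tensoring with 1 on the right, where pentagon and
    triangle apply. *)
Lemma runit_tens X Y :
  ifwd (runit (X ⊗ Y)) ∘ ifwd (assoc X Y munit) = idm X ⊗^ ifwd (runit Y).
Proof.
apply: one_tens_inj.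
apply: (@fwd_cancelr _ _ _ _ _ (assoc X (Y ⊗ munit) munit)).
apply: (@fwd_cancelr _ _ _ _ _ (tens_iso (iso_refl X) (assoc Y munit munit))) => /=.
rewrite tensM1 -!compA (compA (ifwd _ ⊗^ _) _ (idm X ⊗^ _)) -pentagon compA triangle.
rewrite [RHS]compA -assoc_nat -[RHS]compA -tens1M triangle.
by rewrite -(bmap1 tens X Y) -assoc_nat.
Qed.

Lemma lunit_runit_one : ifwd (lunit (munit : C)) = ifwd (runit munit).
Proof.
(* Naturality of l at the morphism l_1 itself, with l_1 cancelled. *)
have e : ifwd (lunit (munit ⊗ munit : C)) = idm munit ⊗^ ifwd (lunit munit).
  by apply: (fwd_cancell (i := lunit munit)); rewrite lunit_nat.
apply: one_tens_inj; apply: (@fwd_cancelr _ _ _ _ _ (assoc munit munit munit)).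
by rewrite -lunit_tens e triangle.
Qed.

Section Dual.
Variables (X : C) (D : dual_of X).

(** Inverse of h |-> ev (h ⊗ 1): the object D represents Z |-> Hom(Z ⊗ X, 1). *)
Definition lcurry Z (t : mor (Z ⊗ X) munit) : mor Z D :=
  ifwd (lunit D) ∘ (t ⊗^ idm D) ∘ ifwd (assoc Z X D)
    ∘ (idm Z ⊗^ coev D) ∘ inv (runit Z).

(** The same [ev] makes X represent Z |-> Hom(D ⊗ Z, 1). *)
Definition rcurry Z (t : mor (D ⊗ Z) munit) : mor Z X :=
  ifwd (runit X) ∘ (idm X ⊗^ t) ∘ inv (assoc X D Z)
    ∘ (coev D ⊗^ idm Z) ∘ inv (lunit Z).

Lemma lcurryK Z (h : mor Z D) : lcurry (ev D ∘ (h ⊗^ idm X)) = h.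
Proof.
rewrite /lcurry tensM1 -!compA (compA (_ ⊗^ idm D) (ifwd _)) -assoc_nat.
rewrite -!compA (compA (h ⊗^ _)) bmap1 tens_interchange -!compA runitV_nat.
by rewrite !compA dual_zag comp1m.
Qed.

(** Sliding t past [ev] leaves the zig identity of X, tensored with Z, in front of t. *)
Lemma lcurryP Z (t : mor (Z ⊗ X) munit) : ev D ∘ (lcurry t ⊗^ idm X) = t.
Proof.
rewrite /lcurry !tensM1.
have -> : ifwd (lunit D) ⊗^ idm X = ifwd (lunit (D ⊗ X)) ∘ inv (assoc munit D X).
  by rewrite lunit_tens -compA fwdK compm1.
rewrite -!compA (compA (inv _) ((t ⊗^ _) ⊗^ _)) assocV_nat bmap1.
rewrite compA -lunit_nat -!compA (compA _ (t ⊗^ idm _)) -tens_interchange.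
have pent : inv (assoc (Z ⊗ X) D X) ∘ (ifwd (assoc Z X D) ⊗^ idm X)
   = ifwd (assoc Z X (D ⊗ X)) ∘ (idm Z ⊗^ inv (assoc X D X)) ∘ inv (assoc Z (X ⊗ D) X).
  apply: iso_movel; rewrite !compA pentagon -!compA.
  by rewrite (compA (idm Z ⊗^ _)) tens1K comp1m fwdK compm1.
rewrite -!compA (compA (inv _) (ifwd _ ⊗^ _)) pent -!compA.
rewrite (compA (inv (assoc Z _ X))) assocV_nat.
have -> : inv (runit Z) ⊗^ idm X = ifwd (assoc Z munit X) ∘ (idm Z ⊗^ inv (lunit X)).
  apply: (fwd_cancell (i := tens_iso (runit Z) (iso_refl X))) => /=.
  by rewrite tensK1 compA triangle tens1K.
rewrite -!compA invKl (compA (idm (Z ⊗ X) ⊗^ _)) -{1}(bmap1 tens Z X) -assoc_nat.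
rewrite lunit_runit_one -!compA compA runit_nat -!compA (compA (ifwd (runit _))) runit_tens.
rewrite -!tens1M.
by have := dual_zig D; rewrite -!compA => ->; rewrite bmap1 compm1.
Qed.

Lemma lcurry_inj Z (h h' : mor Z D) :
  ev D ∘ (h ⊗^ idm X) = ev D ∘ (h' ⊗^ idm X) -> h = h'.
Proof. by move=> e; rewrite -[h]lcurryK e lcurryK. Qed.

Lemma rcurryK Z (h : mor Z X) : rcurry (ev D ∘ (idm D ⊗^ h)) = h.
Proof.
rewrite /rcurry tens1M -!compA (compA (idm X ⊗^ (idm D ⊗^ _)) (inv _)) -assocV_nat.
rewrite -!compA (compA ((idm X ⊗^ _) ⊗^ h)) bmap1 -tens_interchange -!compA lunitV_nat.
by rewrite !compA dual_zig comp1m.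
Qed.

Lemma rcurryP Z (t : mor (D ⊗ Z) munit) : ev D ∘ (idm D ⊗^ rcurry t) = t.
Proof.
rewrite /rcurry !tens1M -runit_tens.
rewrite -!compA (compA (ifwd (assoc D X munit))) assoc_nat bmap1.
rewrite compA -runit_nat -!compA (compA (ev D ⊗^ _)) tens_interchange.
have pent : ifwd (assoc (D ⊗ X) D Z) ∘ ifwd (assoc D X (D ⊗ Z)) ∘ (idm D ⊗^ inv (assoc X D Z))
   = (ifwd (assoc D X D) ⊗^ idm Z) ∘ ifwd (assoc D (X ⊗ D) Z).
  by rewrite pentagon -!compA tens1K compm1.
rewrite -lunit_runit_one -!compA compA lunit_nat lunit_tens -!compA.
rewrite -{1}(bmap1 tens D Z) (compA (ifwd (assoc munit D Z))) assoc_nat.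
move: pent; rewrite -!compA => pent.
rewrite (compA (ifwd (assoc D X _))) (compA (ifwd (assoc (D ⊗ X) _ _))) pent.
rewrite -!compA (compA (ifwd (assoc D (X ⊗ D) Z))) assoc_nat.
have -> : idm D ⊗^ inv (lunit Z) = inv (assoc D munit Z) ∘ (inv (runit D) ⊗^ idm Z).
  apply: (fwd_cancell (i := tens_iso (iso_refl D) (lunit Z))) => /=.
  by rewrite tens1K -triangle -!compA fwdKl tensK1.
rewrite -!compA fwdKl -!tensM1.
by have := dual_zag D; rewrite -!compA => ->; rewrite bmap1 compm1.
Qed.

Lemma rcurry_inj Z (h h' : mor Z X) :
  ev D ∘ (idm D ⊗^ h) = ev D ∘ (idm D ⊗^ h') -> h = h'.
Proof. by move=> e; rewrite -[h]rcurryK e rcurryK. Qed.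

Lemma lcurry0 Z (h : mor Z D) : ev D ∘ (h ⊗^ idm X) = 0 -> h = 0.
Proof. by move=> e; apply: lcurry_inj; rewrite e tens0m compm0. Qed.

Lemma rcurry0 Z (h : mor Z X) : ev D ∘ (idm D ⊗^ h) = 0 -> h = 0.
Proof. by move=> e; apply: rcurry_inj; rewrite e tensm0 compm0. Qed.

(** The witness bends the X-leg of k down with [ev]; the zig identity straightens it again. *)
Lemma coev_lP Z (k : mor munit (X ⊗ Z)) :
  exists y : mor D Z, k = (idm X ⊗^ y) ∘ coev D.
Proof.
exists (ifwd (lunit Z) ∘ (ev D ⊗^ idm Z) ∘ ifwd (assoc D X Z) ∘ (idm D ⊗^ k)
        ∘ inv (runit D)).
have rD : (idm X ⊗^ inv (runit D)) ∘ coev D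
    = inv (assoc X D munit) ∘ ((coev D ⊗^ idm munit) ∘ inv (lunit munit)).
  apply: (fwd_cancell (i := tens_iso (iso_refl X) (runit D))) => /=.
  rewrite compA tens1K comp1m -runit_tens -!compA fwdKl.
  rewrite compA runit_nat -compA -lunit_runit_one fwdK compm1 //.
have pent : ifwd (assoc X (D ⊗ X) Z) ∘ ((idm X ⊗^ ifwd (assoc D X Z)) ∘ inv (assoc X D (X ⊗ Z)))
    = (inv (assoc X D X) ⊗^ idm Z) ∘ ifwd (assoc (X ⊗ D) X Z).
  rewrite compA; apply: iso_mover; rewrite -compA.
  apply: esym; apply: (iso_movel (i := tens_iso (assoc X D X) (iso_refl Z))).
  by rewrite pentagon /= compA.
rewrite !tens1M -!compA rD (compA (idm X ⊗^ (idm D ⊗^ _))) -assocV_nat bmap1.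
rewrite -!compA (compA (idm (X ⊗ D) ⊗^ _)) -tens_interchange -!compA lunitV_nat.
rewrite -triangle -!compA (compA (ifwd (assoc X munit Z))) assoc_nat -!compA.
rewrite (compA (idm X ⊗^ ifwd _)) (compA (ifwd (assoc X _ Z))) pent -!compA.
rewrite -(bmap1 tens X Z) (compA (ifwd (assoc (X ⊗ D) X Z))) assoc_nat -!compA.
have -> : inv (lunit (X ⊗ Z)) = inv (assoc munit X Z) ∘ (inv (lunit X) ⊗^ idm Z).
  apply: (fwd_cancell (i := lunit _)); rewrite fwdK lunit_tens -compA fwdKl.
  by rewrite tensK1.
rewrite -!compA fwdKl.
have := dual_zig D; rewrite -!compA => zig.
by rewrite !compA -!tensM1 -!compA zig bmap1 comp1m.
Qed.

Lemma coev_rP Z (k : mor munit (Z ⊗ D)) :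
  exists w : mor X Z, k = (w ⊗^ idm D) ∘ coev D.
Proof.
exists (ifwd (runit Z) ∘ (idm Z ⊗^ ev D) ∘ inv (assoc Z D X) ∘ (k ⊗^ idm X)
        ∘ inv (lunit X)).
have lX : (inv (lunit X) ⊗^ idm D) ∘ coev D
    = ifwd (assoc munit X D) ∘ ((idm munit ⊗^ coev D) ∘ inv (lunit munit)).
  apply: (fwd_cancell (i := tens_iso (lunit X) (iso_refl D))) => /=.
  rewrite compA tensK1 comp1m !compA -lunit_tens lunit_nat -compA fwdK compm1 //.
have pent : (inv (assoc Z D X) ⊗^ idm D) ∘ ifwd (assoc (Z ⊗ D) X D)
    = ifwd (assoc Z (D ⊗ X) D) ∘ ((idm Z ⊗^ ifwd (assoc D X D)) ∘ inv (assoc Z D (X ⊗ D))).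
  apply: (iso_movel (i := tens_iso (assoc Z D X) (iso_refl D))) => /=.
  by rewrite !compA; apply: esym; apply: iso_mover; rewrite pentagon.
rewrite !tensM1 -!compA lX (compA ((k ⊗^ _) ⊗^ _)) -assoc_nat bmap1.
rewrite -!compA (compA (k ⊗^ _)) tens_interchange -!compA.
rewrite (_ : inv (lunit munit) = inv (runit munit)); last first.
  apply: (fwd_cancell (i := lunit munit)); rewrite fwdK lunit_runit_one.
  by rewrite fwdK.
rewrite runitV_nat (compA (inv _ ⊗^ _)) pent -!compA.
rewrite -(bmap1 tens Z D) (compA (inv (assoc Z D (X ⊗ D)))) assocV_nat -!compA.
have -> : inv (runit (Z ⊗ D)) = ifwd (assoc Z D munit) ∘ (idm Z ⊗^ inv (runit D)).
  apply: (fwd_cancell (i := runit _)); rewrite fwdK compA runit_tens.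
  by rewrite tens1K.
rewrite -!compA invKl (compA ((idm Z ⊗^ ev D) ⊗^ _)) -assoc_nat -!compA.
rewrite (compA (ifwd (runit Z) ⊗^ _)) triangle.
have := dual_zag D; rewrite -!compA => zag.
by rewrite !compA -!tens1M -!compA zag bmap1 comp1m.
Qed.

End Dual.

Lemma dual_unique X (D D' : dual_of X) : isomorphic (dual D) (dual D').
Proof.
constructor; exists (lcurry D' (ev D)) (lcurry D (ev D')).
  by apply: (lcurry_inj (D := D)); rewrite tensM1 compA !lcurryP bmap1 compm1.
by apply: (lcurry_inj (D := D')); rewrite tensM1 compA !lcurryP bmap1 compm1.
Qed.

End Coherence.

(** * Duals under a strong monoidal bifunctor *)

Section StrongBifunctor.
Context {F : fieldType} {U V C : monCat F}.

(** The monoidal part of [componentwise], isolated so that it also covers ⊠ followed by the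
    embedding into the direct sum completion. *)
Record strong_bifun (B : bifun U V C) := StrongBifun {
  sb_tens : forall (X X' : U) (Y Y' : V),
    iso (B X Y ⊗ B X' Y') (B (X ⊗ X') (Y ⊗ Y'));
  sb_one : iso munit (B munit munit);
  sb_nat : forall (X1 X2 X1' X2' : U) (Y1 Y2 Y1' Y2' : V)
      (f : mor X1 X2) (f' : mor X1' X2') (g : mor Y1 Y2) (g' : mor Y1' Y2'),
    ifwd (sb_tens X2 X2' Y2 Y2') ∘ (bmap B f g ⊗^ bmap B f' g')
    = bmap B (f ⊗^ f') (g ⊗^ g') ∘ ifwd (sb_tens X1 X1' Y1 Y1');
  sb_assoc : forall (X1 X2 X3 : U) (Y1 Y2 Y3 : V),
    bmap B (ifwd (assoc X1 X2 X3)) (ifwd (assoc Y1 Y2 Y3))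
      ∘ ifwd (sb_tens X1 (X2 ⊗ X3) Y1 (Y2 ⊗ Y3))
      ∘ (idm (B X1 Y1) ⊗^ ifwd (sb_tens X2 X3 Y2 Y3))
    = ifwd (sb_tens (X1 ⊗ X2) X3 (Y1 ⊗ Y2) Y3)
      ∘ (ifwd (sb_tens X1 X2 Y1 Y2) ⊗^ idm (B X3 Y3))
      ∘ ifwd (assoc (B X1 Y1) (B X2 Y2) (B X3 Y3));
  sb_lunit : forall (X : U) (Y : V),
    bmap B (ifwd (lunit X)) (ifwd (lunit Y)) ∘ ifwd (sb_tens munit X munit Y)
      ∘ (ifwd sb_one ⊗^ idm (B X Y))
    = ifwd (lunit (B X Y));
  sb_runit : forall (X : U) (Y : V),
    bmap B (ifwd (runit X)) (ifwd (runit Y)) ∘ ifwd (sb_tens X munit Y munit)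
      ∘ (idm (B X Y) ⊗^ ifwd sb_one)
    = ifwd (runit (B X Y)) }.

Definition biso (B : bifun U V C) X X' Y Y' (i : iso X X') (j : iso Y Y') :
  iso (B X Y) (B X' Y').
Proof.
exists (bmap B (ifwd i) (ifwd j)) (bmap B (inv i) (inv j));
  by rewrite -bmapM ?invK ?fwdK bmap1.
Defined.

Section Theory.
Variables (B : bifun U V C) (S : strong_bifun B).

Lemma sbV_nat (X1 X2 X1' X2' : U) (Y1 Y2 Y1' Y2' : V)
      (f : mor X1 X2) (f' : mor X1' X2') (g : mor Y1 Y2) (g' : mor Y1' Y2') :
  inv (sb_tens S X2 X2' Y2 Y2') ∘ bmap B (f ⊗^ f') (g ⊗^ g')
  = (bmap B f g ⊗^ bmap B f' g') ∘ inv (sb_tens S X1 X1' Y1 Y1').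
Proof. by apply: iso_movel; rewrite compA sb_nat -compA fwdK compm1. Qed.

Lemma sbV_assoc (X1 X2 X3 : U) (Y1 Y2 Y3 : V) :
  ifwd (assoc (B X1 Y1) (B X2 Y2) (B X3 Y3))
    ∘ (idm (B X1 Y1) ⊗^ inv (sb_tens S X2 X3 Y2 Y3))
    ∘ inv (sb_tens S X1 (X2 ⊗ X3) Y1 (Y2 ⊗ Y3))
  = (inv (sb_tens S X1 X2 Y1 Y2) ⊗^ idm (B X3 Y3))
    ∘ inv (sb_tens S (X1 ⊗ X2) X3 (Y1 ⊗ Y2) Y3)
    ∘ bmap B (ifwd (assoc X1 X2 X3)) (ifwd (assoc Y1 Y2 Y3)).
Proof.
apply: iso_mover; apply: (iso_mover (i := tens_iso (iso_refl _) (sb_tens S _ _ _ _))).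
rewrite /= -!compA; apply: esym.
apply: (iso_movel (i := tens_iso (sb_tens S _ _ _ _) (iso_refl _))).
by apply: iso_movel; rewrite /= !compA sb_assoc.
Qed.

Lemma sbV_lunit (X : U) (Y : V) :
  ifwd (lunit (B X Y)) ∘ (inv (sb_one S) ⊗^ idm (B X Y))
    ∘ inv (sb_tens S munit X munit Y)
  = bmap B (ifwd (lunit X)) (ifwd (lunit Y)).
Proof.
apply: iso_mover; apply: (iso_mover (i := tens_iso (sb_one S) (iso_refl _))).
by rewrite /= sb_lunit.
Qed.

Lemma sb_assoc_dual (X1 X2 X3 : U) (Y1 Y2 Y3 : V) :
  ifwd (sb_tens S X1 (X2 ⊗ X3) Y1 (Y2 ⊗ Y3))
      ∘ (idm (B X1 Y1) ⊗^ ifwd (sb_tens S X2 X3 Y2 Y3))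
      ∘ inv (assoc (B X1 Y1) (B X2 Y2) (B X3 Y3))
  = bmap B (inv (assoc X1 X2 X3)) (inv (assoc Y1 Y2 Y3))
    ∘ ifwd (sb_tens S (X1 ⊗ X2) X3 (Y1 ⊗ Y2) Y3)
      ∘ (ifwd (sb_tens S X1 X2 Y1 Y2) ⊗^ idm (B X3 Y3)).
Proof.
apply: iso_mover; rewrite -!compA.
apply: esym; apply: (iso_movel (i := biso B (assoc X1 X2 X3) (assoc Y1 Y2 Y3))).
by rewrite /= !compA sb_assoc.
Qed.

Lemma sb_lunit_dual (X : U) (Y : V) :
  ifwd (sb_tens S munit X munit Y) ∘ (ifwd (sb_one S) ⊗^ idm (B X Y))
    ∘ inv (lunit (B X Y))
  = bmap B (inv (lunit X)) (inv (lunit Y)).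
Proof.
apply: iso_mover; apply: esym; apply: (iso_movel (i := biso B (lunit X) (lunit Y))).
by rewrite /= !compA sb_lunit.
Qed.

Lemma sb_runit_dual (X : U) (Y : V) :
  ifwd (sb_tens S X munit Y munit) ∘ (idm (B X Y) ⊗^ ifwd (sb_one S))
    ∘ inv (runit (B X Y))
  = bmap B (inv (runit X)) (inv (runit Y)).
Proof.
apply: iso_mover; apply: esym; apply: (iso_movel (i := biso B (runit X) (runit Y))).
by rewrite /= !compA sb_runit.
Qed.

Section Dual.
Variables (X : U) (Y : V) (X' : dual_of X) (Y' : dual_of Y).

Definition bdual_ev : mor (B X' Y' ⊗ B X Y) munit :=
  inv (sb_one S) ∘ bmap B (ev X') (ev Y') ∘ ifwd (sb_tens S _ _ _ _).
Definition bdual_coev : mor munit (B X Y ⊗ B X' Y') :=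
  inv (sb_tens S _ _ _ _) ∘ bmap B (coev X') (coev Y') ∘ ifwd (sb_one S).

Lemma sb_nat1 (X1 X2 X3 : U) (Y1 Y2 Y3 : V) (f : mor X1 X2) (g : mor Y1 Y2) :
  ifwd (sb_tens S X2 X3 Y2 Y3) ∘ (bmap B f g ⊗^ idm (B X3 Y3))
  = bmap B (f ⊗^ idm X3) (g ⊗^ idm Y3) ∘ ifwd (sb_tens S X1 X3 Y1 Y3).
Proof. by rewrite -sb_nat bmap1. Qed.

Lemma sb_1nat (X1 X2 X3 : U) (Y1 Y2 Y3 : V) (f : mor X1 X2) (g : mor Y1 Y2) :
  ifwd (sb_tens S X3 X2 Y3 Y2) ∘ (idm (B X3 Y3) ⊗^ bmap B f g)
  = bmap B (idm X3 ⊗^ f) (idm Y3 ⊗^ g) ∘ ifwd (sb_tens S X3 X1 Y3 Y1).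
Proof. by rewrite -sb_nat bmap1. Qed.

(** Strong monoidal functors preserve duals: compatibility with associators and units gathers
    everything under B, where the zig identities of X and Y apply side by side. *)
Lemma bdual_zig :
  ifwd (runit (B X Y)) ∘ (idm (B X Y) ⊗^ bdual_ev) ∘ inv (assoc (B X Y) (B X' Y') (B X Y))
      ∘ (bdual_coev ⊗^ idm (B X Y)) ∘ inv (lunit (B X Y)) = idm (B X Y).
Proof.
have -> : ifwd (runit (B X Y)) ∘ (idm (B X Y) ⊗^ bdual_ev) =
   bmap B (ifwd (runit X) ∘ (idm X ⊗^ ev X')) (ifwd (runit Y) ∘ (idm Y ⊗^ ev Y'))
   ∘ (ifwd (sb_tens S _ _ _ _) ∘ (idm (B X Y) ⊗^ ifwd (sb_tens S _ _ _ _))).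
  rewrite -(sb_runit S) /bdual_ev !tens1M -!compA (compA (idm _ ⊗^ ifwd _)) tens1K comp1m.
  by rewrite (compA (ifwd _)) sb_1nat -!compA compA -bmapM.
rewrite -!compA (compA _ (inv (assoc _ _ _))) (compA (ifwd _)) (compA (ifwd _)).
rewrite sb_assoc_dual /bdual_coev !tensM1 -!compA.
rewrite (compA (ifwd _ ⊗^ _)) tensK1 comp1m (compA (ifwd _)) sb_nat1 -!compA.
rewrite (compA (ifwd _)) sb_lunit_dual -!bmapM.
by rewrite !compA !dual_zig bmap1.
Qed.

Lemma bdual_zag :
  ifwd (lunit (B X' Y')) ∘ (bdual_ev ⊗^ idm (B X' Y')) ∘ ifwd (assoc (B X' Y') (B X Y) (B X' Y'))
      ∘ (idm (B X' Y') ⊗^ bdual_coev) ∘ inv (runit (B X' Y')) = idm (B X' Y').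
Proof.
rewrite -(sb_lunit S) /bdual_ev !tensM1 -!compA (compA (ifwd _ ⊗^ _)) tensK1 comp1m.
rewrite (compA (ifwd _)) sb_nat1 -!compA.
rewrite (compA (ifwd _ ⊗^ _)) (compA (ifwd (sb_tens _ _ _ _ _))).
rewrite (compA (ifwd (sb_tens _ _ _ _ _)) (ifwd _ ⊗^ _)) -sb_assoc.
rewrite /bdual_coev !tens1M -!compA (compA (idm _ ⊗^ ifwd _)) tens1K comp1m.
rewrite (compA (ifwd _)) sb_1nat -!compA.
by rewrite (compA (ifwd _)) sb_runit_dual -!bmapM !compA !dual_zag bmap1.
Qed.

Definition bdual : dual_of (B X Y) := DualOf bdual_zig bdual_zag.

End Dual.
End Theory.
End StrongBifunctor.

Lemma dchoice (I : Type) (T : I -> Type) (P : forall i, T i -> Prop) :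
  (forall i, exists x, P i x) -> exists f, forall i, P i (f i).
Proof. by move=> h; exists (fun i => projT1 (cid (h i))) => i; exact: projT2. Qed.

Lemma dinhabited (I : Type) (T : I -> Type) :
  (forall i, inhabited (T i)) -> inhabited (forall i, T i).
Proof.
move=> h; constructor=> i.
by have : exists x : T i, True; [have [x] := h i; exists x | move=> /cid[]].
Qed.

(** * Abelian and semisimple categories *)

Section Abelian.
Context {F : fieldType} {C : linCat F}.
Implicit Types X Y Z T : C.

Lemma compNl X Y Z (g : mor Y Z) (f : mor X Y) : (- g) ∘ f = - (g ∘ f).
Proof. by have := compDl (-1) g 0 f; rewrite !addr0 comp0m addr0 !scaleN1r. Qed.

Lemma compNr X Y Z (g : mor Y Z) (f : mor X Y) : g ∘ (- f) = - (g ∘ f).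
Proof. by have := compDr (-1) g f 0; rewrite !addr0 compm0 addr0 !scaleN1r. Qed.

Lemma compZl X Y Z k (g : mor Y Z) (f : mor X Y) : (k *: g) ∘ f = k *: (g ∘ f).
Proof. by have := compDl k g 0 f; rewrite addr0 comp0m addr0. Qed.

Lemma compZr X Y Z k (g : mor Y Z) (f : mor X Y) : g ∘ (k *: f) = k *: (g ∘ f).
Proof. by have := compDr k g f 0; rewrite addr0 compm0 addr0. Qed.

Lemma compBl X Y Z (g h : mor Y Z) (f : mor X Y) : (g - h) ∘ f = g ∘ f - h ∘ f.
Proof. by have := compDl 1 g (- h) f; rewrite !scale1r compNl. Qed.

Lemma compBr X Y Z (g : mor Y Z) (f h : mor X Y) : g ∘ (f - h) = g ∘ f - g ∘ h.
Proof. by have := compDr 1 g f (- h); rewrite !scale1r compNr. Qed.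

Lemma compAddl X Y Z (g h : mor Y Z) (f : mor X Y) : (g + h) ∘ f = g ∘ f + h ∘ f.
Proof. by have := compDl 1 g h f; rewrite !scale1r. Qed.

Lemma compAddr X Y Z (g : mor Y Z) (f h : mor X Y) : g ∘ (f + h) = g ∘ f + g ∘ h.
Proof. by have := compDr 1 g f h; rewrite !scale1r. Qed.

Lemma is_zeroE X : is_zero X <-> idm X = 0.
Proof.
split=> [/(_ X) [e _]|e Y]; first exact: e.
by split=> f; [rewrite -[f]compm1 e compm0 | rewrite -[f]comp1m e comp0m].
Qed.

Lemma is_isoE X Y (f : mor X Y) :
  is_iso f <-> exists2 g : mor Y X, g ∘ f = idm X & f ∘ g = idm Y.
Proof.
split=> [[i <-]|[g gf fg]]; first by exists (inv i); [exact: invK | exact: fwdK].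
by exists (Iso gf fg).
Qed.

Lemma mono0 X Y (f : mor X Y) :
  (forall T (h : mor T X), f ∘ h = 0 -> h = 0) -> is_mono f.
Proof.
by move=> f0 Z g h e; apply/eqP; rewrite -subr_eq0; apply/eqP/f0; rewrite compBr e subrr.
Qed.

Lemma epi0 X Y (f : mor X Y) :
  (forall T (h : mor Y T), h ∘ f = 0 -> h = 0) -> is_epi f.
Proof.
by move=> f0 Z g h e; apply/eqP; rewrite -subr_eq0; apply/eqP/f0; rewrite compBl e subrr.
Qed.

Lemma kernel_mono X Y Z (k : mor X Y) (f : mor Y Z) : is_kernel k f -> is_mono k.
Proof.
move=> [fk0 u] T g h e; have fkg0 : f ∘ (k ∘ g) = 0 by rewrite compA fk0 comp0m.
by have [l [_ ul]] := u T _ fkg0; rewrite -(ul g) // (ul h).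
Qed.

Hypothesis abC : abelian C.

Lemma kernel_ex X Y (f : mor X Y) : exists (K : C) (k : mor K X), is_kernel k f.
Proof. by case: abC => _ _ /(_ X Y f) []. Qed.

(** Simplicity is a condition on subobjects: applied to the kernel of f it gives f = 0 or f mono,
    and applied to f itself it then gives an isomorphism. *)
Lemma Schur (S T : C) (f : mor S T) : simple S -> simple T -> f = 0 \/ is_iso f.
Proof.
move=> [_ sS] [_ sT]; have [K [k kk]] := kernel_ex f.
have [k0|[i ik]] := sS K k (kernel_mono kk); last first.
  by left; rewrite -[f]compm1 -(fwdK i) ik compA (proj1 kk) comp0m.
apply: sT; apply: mono0 => R h fh0.
by have [l [<- _]] := proj2 kk R h fh0; rewrite k0 comp0m.
Qed.

Lemma simple_idempotent (S : C) (d : mor S S) : simple S -> d ∘ d = d -> d = 0 \/ d = idm S.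
Proof.
move=> sS dd; have [|/is_isoE[g gd _]] := Schur d sS sS; first by left.
by right; have := congr1 (mcomp g) dd; rewrite compA gd comp1m.
Qed.

(** A monomorphism f is the kernel of some g; f being epi forces g = 0, so the identity of Y factors
    through f. *)
Lemma abelian_balanced X Y (f : mor X Y) : is_mono f -> is_epi f -> is_iso f.
Proof.
case: abC => _ _ _ mk _ fm fe; have [Z [g [gf0 u]]] := mk X Y f fm.
have g0 : g = 0 by apply: fe; rewrite gf0 comp0m.
have [h [fh _]] := u Y (idm Y) (etrans (congr1 (mcomp^~ _) g0) (comp0m _ _)).
by apply/is_isoE; exists h => //; apply: fm; rewrite compA fh comp1m compm1.
Qed.

(** Kernels are iterated along the list r, in place of one kernel into a product of the E i. This
    constructs radicals of pairings. *)
Lemma joint_kernel (I : eqType) X (E : I -> C) (p : forall i, mor X (E i)) (r : seq I)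
  (Q : I -> Prop) : (forall i, Q i -> i \in r) ->
  exists (K : C) (k : mor K X), [/\ is_mono k, forall i, Q i -> p i ∘ k = 0 &
   forall T (f : mor T X), (forall i, Q i -> p i ∘ f = 0) -> exists g, k ∘ g = f].
Proof.
move=> Qr.
suff [K [k [km k0 ku]]] : exists (K : C) (k : mor K X), [/\ is_mono k,
   forall i, Q i /\ i \in r -> p i ∘ k = 0 &
   forall T (f : mor T X), (forall i, Q i /\ i \in r -> p i ∘ f = 0) -> exists g, k ∘ g = f].
  exists K, k; split=> // [i Qi|T f f0]; first by apply: k0; split=> //; exact: Qr.
  by apply: ku => i [/f0].
elim: r {Qr} => [|i r [K [k [km k0 ku]]]].
  exists X, (idm X); split=> [T f g|i [_]|T f _]; first by rewrite !comp1m.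
    by rewrite in_nil.
  by exists f; rewrite comp1m.
have [Qi|nQi] := pselect (Q i); last first.
  exists K, k; split=> // [j [Qj]|T f f0].
    rewrite inE => /predU1P[ij|jr].
      by rewrite ij in Qj.
    exact: k0.
  by apply: ku => j [Qj jr]; apply: f0; rewrite inE jr orbT.
have [L [l ll]] := kernel_ex (p i ∘ k).
exists L, (k ∘ l); split=> [T f g|j [Qj]|T f f0].
- by rewrite -!compA => /km /(kernel_mono ll).
- rewrite inE => /predU1P[->|jr]; first by rewrite compA (proj1 ll).
  by rewrite compA k0 // comp0m.
have [|g kg] := ku T f; first by move=> j [Qj jr]; apply: f0; rewrite inE jr orbT.
have [|h [lh _]] := proj2 ll T g.
  by rewrite -compA kg; apply: f0; rewrite inE eqxx.
by exists h; rewrite -compA lh.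
Qed.

End Abelian.

Lemma fsum_fin (J : finType) (M : nmodType) (G : J -> M) :
  \sum_(i \in [set: J]) G i = \sum_i G i.
Proof.
rewrite (@fsum_seq _ _ (enum J)) ?enum_uniq //; first exact: big_enum.
by move=> i _; rewrite mem_enum.
Qed.

Definition bifunl (F : fieldType) (C C' D : linCat F) (B : bifun C C' D) (W : C') :
  linFun C D.
Proof.
refine (@LinFun _ C D (fun X => B X W) (fun X Y f => bmap B f (idm W)) _ _ _).
- by move=> X Y; exact: bmap_linl.
- by move=> X; exact: bmap1.
- by move=> X Y Z g f; rewrite -bmapM comp1m.
Defined.

Definition bifunr (F : fieldType) (C C' D : linCat F) (B : bifun C C' D) (W : C) :
  linFun C' D.
Proof.
refine (@LinFun _ C' D (fun X => B W X) (fun X Y f => bmap B (idm W) f) _ _ _).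
- by move=> X Y; exact: bmap_linr.
- by move=> X; exact: bmap1.
- by move=> X Y Z g f; rewrite -bmapM comp1m.
Defined.

Definition linFun_id (F : fieldType) (C : linCat F) : linFun C C.
Proof.
refine (@LinFun _ C C (fun X => X) (fun X Y f => f) _ _ _) => //.
Defined.

Definition linFun_comp (F : fieldType) (C D E : linCat F) (K : linFun D E)
  (H : linFun C D) : linFun C E.
Proof.
refine (@LinFun _ C E (fun X => K (H X)) (fun X Y f => fmap K (fmap H f)) _ _ _).
- by move=> X Y k f g; rewrite fmap_lin fmap_lin.
- by move=> X; rewrite !fmap1.
- by move=> X Y Z g f; rewrite !fmapM.
Defined.

Lemma bmap_suml (F : fieldType) (C C' D : linCat F) (B : bifun C C' D)
    X1 X2 Y1 Y2 I r (P : pred I) (G : I -> mor X1 X2) (g : mor Y1 Y2) :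
  bmap B (\sum_(i <- r | P i) G i) g = \sum_(i <- r | P i) bmap B (G i) g.
Proof. exact: (linear_sum _ _ _ (bmap_linl B g)). Qed.

Lemma bmap_sumr (F : fieldType) (C C' D : linCat F) (B : bifun C C' D)
    X1 X2 Y1 Y2 I r (P : pred I) (f : mor X1 X2) (G : I -> mor Y1 Y2) :
  bmap B f (\sum_(i <- r | P i) G i) = \sum_(i <- r | P i) bmap B f (G i).
Proof. exact: (linear_sum _ _ _ (bmap_linr B f)). Qed.

Lemma linearZ0 (F : fieldType) (M N : lmodType F) (u : M -> N) k x :
  linear u -> u (k *: x) = k *: u x.
Proof. by move=> lu; have := lu k x 0; rewrite !addr0 (linear0 lu) addr0. Qed.

Lemma bmapZ (F : fieldType) (C C' D : linCat F) (B : bifun C C' D)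
    X1 X2 Y1 Y2 k (f : mor X1 X2) (g : mor Y1 Y2) :
  bmap B (k *: f) g = bmap B f (k *: g).
Proof. by rewrite (linearZ0 _ _ (bmap_linl B g)) (linearZ0 _ _ (bmap_linr B f)). Qed.

Lemma bmap0m (F : fieldType) (C C' D : linCat F) (B : bifun C C' D)
    X1 X2 Y1 Y2 (g : mor Y1 Y2) : bmap B (0 : mor X1 X2) g = 0.
Proof. exact: linear0 (bmap_linl B g). Qed.

Lemma bmapm0 (F : fieldType) (C C' D : linCat F) (B : bifun C C' D)
    X1 X2 Y1 Y2 (f : mor X1 X2) : bmap B f (0 : mor Y1 Y2) = 0.
Proof. exact: linear0 (bmap_linr B f). Qed.

Section Semisimple.
Context {F : fieldType} {C : linCat F}.
Implicit Types X Y Z T : C.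
Hypotheses (abC : abelian C) (ssC : semisimple C).

Lemma biproduct_sum n (S : 'I_n -> C) A (d : biproduct S A) :
  \sum_i (inc d i ∘ prj d i) = idm A.
Proof. by rewrite -(inc_prj d) fsum_fin. Qed.

(* Gaussian elimination: a simple summand on which f does not vanish is mapped
   isomorphically onto a summand of Y, and can be split off. *)
Lemma semisimple_regular X Y (f : mor X Y) : exists r, f ∘ r ∘ f = f.
Proof.
have [n [S [sS [d]]]] := ssC X; have [m [S' [sS' [d']]]] := ssC Y.
suff reg q (g : mor X Y) : (forall k : 'I_n, (q <= k)%N -> g ∘ inc d k = 0) ->
    exists r, g ∘ r ∘ g = g.
  by apply: (reg n) => k; rewrite leqNgt ltn_ord.
elim: q g => [|q IH] g g0.
  exists 0; rewrite compm0 comp0m -[g]compm1 -(biproduct_sum d) comp_sumr big1 // => i _.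
  by rewrite compA g0 // comp0m.
have [qn|nq] := ltnP q n; last first.
  by apply: IH => k /(leq_trans nq); rewrite leqNgt ltn_ord.
pose k0 := Ordinal qn.
have [gk0|gk0] := pselect (g ∘ inc d k0 = 0).
  apply: IH => k; rewrite leq_eqVlt => /predU1P[qk|/g0//].
  by have -> : k = k0 by apply: val_inj.
have [b gb] : exists b, prj d' b ∘ (g ∘ inc d k0) <> 0.
  apply: contrapT => nb; apply: gk0; rewrite -[LHS]comp1m -(biproduct_sum d') comp_suml.
  rewrite big1 // => b _; rewrite -compA; have [->|/eqP e] := eqVneq (prj d' b ∘ (g ∘ inc d k0)) 0.
    exact: compm0.
  by case: nb; exists b.
have [//|/is_isoE[t tgi _]] := Schur abC (prj d' b ∘ (g ∘ inc d k0)) (sS k0) (sS' b).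
pose a := inc d k0 ∘ (t ∘ prj d' b).
pose g1 := g - g ∘ a ∘ g.
have [r r1] : exists r, g1 ∘ r ∘ g1 = g1.
  apply: IH => k; rewrite leq_eqVlt => /predU1P[qk|qk].
    have -> : k = k0 by apply: val_inj.
    by rewrite compBl /a -!compA tgi compm1 subrr.
  by rewrite compBl -compA g0 // compm0 subrr.
clearbody a; exists (a + (idm X - a ∘ g) ∘ r ∘ (idm Y - g ∘ a)).
have gl : g ∘ (idm X - a ∘ g) = g1 by rewrite compBr compm1 compA.
have gr : (idm Y - g ∘ a) ∘ g = g1 by rewrite compBl comp1m.
rewrite compAddr compAddl -!compA gr (compA g (_ - _)) gl (compA g1) r1 /g1.
by rewrite compA addrC subrK.
Qed.

(** Von Neumann regularity splits the cokernel: 1 - f r kills f, hence is t g with g t = 1. Split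
    cokernels are given by equations, which every linear functor preserves. *)
Lemma semisimple_right_exact (D : linCat F) (H : linFun C D) : right_exact H.
Proof.
move=> X Y Z f g [gf0 u]; have [r frf] := semisimple_regular f.
have [|t [tg _]] := u Y (idm Y - f ∘ r).
  by rewrite compBl comp1m frf subrr.
have gt : g ∘ t = idm Z.
  have [v [_ uv]] := u Z g gf0; rewrite -(uv (g ∘ t)) ?(uv (idm Z)) ?comp1m //.
  by rewrite -compA tg compBr compm1 compA gf0 comp0m subr0.
split; first by rewrite -fmapM gf0 (linear0 (@fmap_lin _ _ _ H X Z)).
move=> T h hf0; exists (h ∘ fmap H t); split.
  rewrite -compA -fmapM tg -scaleN1r addrC fmap_lin fmap1 compDr fmapM compA hf0.
  by rewrite comp0m scaler0 add0r compm1.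
by move=> h' <-; rewrite -compA -fmapM gt fmap1 compm1.
Qed.

End Semisimple.

(** * Finite-dimensional Hom spaces in the semisimple factor *)

Section Coordinates.
Variable F : fieldType.

Definition coord_basis (M : lmodType F) n (e : 'I_n -> M) (c : M -> 'rV[F]_n) :=
  [/\ linear c, forall x, x = \sum_k c x 0 k *: e k &
      forall l k, c (e l) 0 k = (k == l)%:R].

(** A family with linearly independent images, of the largest possible size, is a basis: by
    maximality its rows span every u x, and [pinvmx] reads off coordinates. *)
Lemma coord_basis_ex (M : lmodType F) n (u : M -> 'rV[F]_n) :
  linear u -> injective u -> exists m (e : 'I_m -> M) c, coord_basis e c.
Proof.
move=> ulin uinj.
pose P m := `[< exists e : 'I_m -> M, row_free (\matrix_k u (e k)) >].
have P0 : exists m, P m.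
  by exists 0%N; apply/asboolP; exists (fun _ => 0); rewrite /row_free flatmx0 mxrank0.
have Pn m : P m -> (m <= n)%N.
  by move=> /asboolP[e /eqP <-]; exact: rank_leq_col.
case: (ex_maxnP P0 Pn) => m /asboolP[e fe] mmax.
set A := \matrix_k u (e k) in fe.
have uA x : (u x <= A)%MS.
  apply: contrapT => /negP nuA.
  have /mmax : P (m + 1)%N; last by rewrite addn1 ltnn.
  apply/asboolP; exists (fun k => match fintype.split k with inl i => e i | inr _ => x end).
  have -> : \matrix_k u (match fintype.split k with inl i => e i | inr _ => x end)
            = col_mx A (u x).
    apply/row_matrixP => k; rewrite rowK; case: split_ordP => j ->.
      by rewrite rowKu rowK.
    by rewrite rowKd ord1 row_id.
  have lt : (A < col_mx A (u x))%MS.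
    have sub : (col_mx A (u x) <= A)%MS = false.
      by rewrite -addsmxE addsmx_sub submx_refl; exact: negbTE.
    by rewrite /ltmx sub andbT -addsmxE addsmxSl.
  rewrite /row_free eqn_leq rank_leq_row /=; move: lt; rewrite ltmxErank => /andP[_].
  by rewrite (eqP fe); apply: leq_trans; rewrite addn1.
exists m, e, (fun x => u x *m pinvmx A); split.
- by move=> k x y; rewrite ulin mulmxDl scalemxAl.
- move=> x; apply: uinj; rewrite (linear_sum _ _ _ ulin) -[LHS](mulmxKpV (uA x)).
  rewrite mulmx_sum_row; apply: eq_bigr => k _.
  by rewrite (linearZ0 _ _ ulin) rowK.
- move=> l k; have -> : u (e l) = row l A by rewrite rowK.
  by rewrite -row_mul mulmxVp // !mxE eq_sym.
Qed.

End Coordinates.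

Section HomFinite.
Context {F : fieldType} {C : monCat F}.
Hypotheses (abC : abelian C) (ssC : semisimple C) (duals : forall X : C, inhabited (dual_of X)).
Hypotheses (simple1 : simple (munit : C))
  (End1 : forall f : mor (munit : C) munit, exists s, f = s *: idm munit).

Lemma scalar_ex : exists2 u : mor (munit : C) munit -> F,
  linear (u : _ -> F^o) & forall f, f = u f *: idm munit.
Proof.
have [u uP] := choice End1; exists u => // k f g.
have id0 : idm (munit : C) <> 0 by move/is_zeroE; case: simple1.
apply/eqP; rewrite -subr_eq0; apply/eqP.
have : (u (k *: f + g) - (k * u f + u g)) *: idm munit = 0 :> mor (munit : C) munit.
  by rewrite scalerBl scalerDl -scalerA -!uP subrr.
by move/eqP; rewrite scaler_eq0 => /orP[/eqP//|/eqP].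
Qed.

(** By duality Hom(S, X) embeds in Hom(D ⊗ S, 1), and each simple summand of D ⊗ S contributes at
    most one copy of End(1) = F. *)
Lemma hom_coord_basis (S X : C) : exists n (e : 'I_n -> mor S X) c, coord_basis e c.
Proof.
have [D] := duals X; have [u ul uP] := scalar_ex.
have [n [T [sT [d]]]] := ssC (D ⊗ S).
(* z is an isomorphism when T_k is the unit, and 0 otherwise, where Hom(T_k, 1) = 0 by Schur. *)
have zP k : exists z : mor munit (T k), forall f : mor (T k) munit, f ∘ z = 0 -> f = 0.
  have [[i]|ni] := pselect (isomorphic munit (T k)).
    exists (ifwd i) => f e; apply: (@inv_inj _ _ _ _ _ i).
    by rewrite e comp0m.
  exists 0 => f _; have [//|[i ei]] := Schur abC f (sT k) simple1.
  by case: ni; constructor; exact: iso_sym i.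
have [z {}zP] := dchoice zP.
pose w (h : mor S X) : 'rV[F]_n := \row_k u (ev D ∘ (idm D ⊗^ h) ∘ inc d k ∘ z k).
apply: (@coord_basis_ex _ _ _ w).
- move=> k f g; apply/rowP => i; rewrite !mxE.
  by rewrite (bmap_linr tens) compDr !compDl ul.
- move=> f g fg; apply: (@rcurry_inj _ _ _ D); rewrite -[LHS]compm1 -[RHS]compm1.
  rewrite -(biproduct_sum d) !comp_sumr; apply: eq_bigr => k _; rewrite !compA; congr (_ ∘ _).
  apply/eqP; rewrite -subr_eq0; apply/eqP/zP; rewrite !compBl.
  move/rowP/(_ k): fg; rewrite !mxE => fg.
  by rewrite (uP (_ ∘ _)) fg -uP subrr.
Qed.

End HomFinite.

(** * Hom spaces of the Deligne product *)

Section Power.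
Context {F : fieldType} {C : linCat F}.

(** Y^n, with one Kronecker delta relation in place of the two relations of [biproduct]; this suits
    matrix computations. *)
Record power (n : nat) (Y P : C) := Power {
  pin : 'I_n -> mor Y P;
  ppr : 'I_n -> mor P Y;
  ppr_pin : forall k l, ppr k ∘ pin l = (k == l)%:R *: idm Y;
  pin_ppr : \sum_k (pin k ∘ ppr k) = idm P }.

Lemma power_ex n Y : abelian C -> exists P, inhabited (power n Y P).
Proof.
move=> abC; elim: n => [|n [A [a]]].
  case: abC => -[Z /is_zeroE Z0] _ _ _ _; exists Z; constructor.
  exists (fun _ => 0) (fun _ => 0); first by case.
  by rewrite big1 // => i _; exact: comp0m.
case: abC => _ /(_ (fun b : bool => if b then Y else A))[P [d]] _ _ _.
exists P; constructor.
pose i1 : mor Y P := inc d true; pose i2 : mor A P := inc d false.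
pose p1 : mor P Y := prj d true; pose p2 : mor P A := prj d false.
have p1i1 : p1 ∘ i1 = idm Y by exact: prj_inc d true.
have p2i2 : p2 ∘ i2 = idm A by exact: prj_inc d false.
have p1i2 : p1 ∘ i2 = 0 by apply: (@prj_inc0 _ _ _ _ _ d false true).
have p2i1 : p2 ∘ i1 = 0 by apply: (@prj_inc0 _ _ _ _ _ d true false).
exists (fun k => if unlift ord0 k is Some j then i2 ∘ pin a j else i1)
       (fun k => if unlift ord0 k is Some j then ppr a j ∘ p2 else p1).
  move=> k l; case: unliftP => [k'|] ->; case: unliftP => [l'|] ->.
  - rewrite -compA (compA p2) p2i2 comp1m ppr_pin.
    by rewrite (inj_eq (@lift_inj _ _)).
  - by rewrite -compA p2i1 compm0 eq_sym (negbTE (neq_lift _ _)) scale0r.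
  - by rewrite compA p1i2 comp0m (negbTE (neq_lift _ _)) scale0r.
  - by rewrite p1i1 eqxx scale1r.
rewrite big_ord_recl unlift_none.
under eq_bigr => k _ do rewrite liftK -compA (compA (pin a k)).
rewrite -comp_sumr -comp_suml pin_ppr comp1m.
by have := inc_prj d; rewrite fsum_fin big_bool.
Qed.

Variables (n m : nat) (Y P Z Q T : C) (a : power n Y P) (b : power m Z Q).

Lemma power_epi (f g : mor P T) : (forall l, f ∘ pin a l = g ∘ pin a l) -> f = g.
Proof.
move=> e; rewrite -[f]compm1 -[g]compm1 -(pin_ppr a) !comp_sumr.
by apply: eq_bigr => l _; rewrite !compA e.
Qed.

Lemma power_mono (f g : mor T Q) : (forall k, ppr b k ∘ f = ppr b k ∘ g) -> f = g.
Proof.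
move=> e; rewrite -[f]comp1m -[g]comp1m -(pin_ppr b) !comp_suml.
by apply: eq_bigr => l _; rewrite -!compA e.
Qed.

Lemma power_ext (f g : mor P Q) :
  (forall k l, ppr b k ∘ f ∘ pin a l = ppr b k ∘ g ∘ pin a l) -> f = g.
Proof.
move=> e; rewrite -[f]comp1m -[g]comp1m -(pin_ppr b) !comp_suml.
apply: eq_bigr => k _; rewrite -!compA; congr (_ ∘ _).
rewrite -[LHS]compm1 -[RHS]compm1 -(pin_ppr a) !comp_sumr.
by apply: eq_bigr => l _; rewrite compA e !compA.
Qed.

Definition power_mx (h : 'I_m -> 'I_n -> mor Y Z) : mor P Q :=
  \sum_k \sum_l (pin b k ∘ h k l ∘ ppr a l).

Lemma power_mx_pin h l : power_mx h ∘ pin a l = \sum_k (pin b k ∘ h k l).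
Proof.
rewrite /power_mx comp_suml; apply: eq_bigr => k _; rewrite comp_suml (bigD1 l) //=.
rewrite big1 => [|l' l'l]; rewrite -!compA ppr_pin; last by rewrite (negbTE l'l) scale0r !compm0.
by rewrite eqxx scale1r compm1 addr0.
Qed.

Lemma ppr_power_mx h k : ppr b k ∘ power_mx h = \sum_l (h k l ∘ ppr a l).
Proof.
rewrite /power_mx comp_sumr (bigD1 k) //= [X in _ + X]big1 ?addr0 => [|k' k'k].
  rewrite comp_sumr; apply: eq_bigr => l _.
  by rewrite !compA ppr_pin eqxx scale1r comp1m.
rewrite comp_sumr big1 // => l _.
by rewrite !compA ppr_pin eq_sym (negbTE k'k) scale0r !comp0m.
Qed.

Lemma power_mxE h k l : ppr b k ∘ power_mx h ∘ pin a l = h k l.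
Proof.
rewrite ppr_power_mx comp_suml (bigD1 l) //= big1 ?addr0 => [|l' l'l].
  by rewrite -compA ppr_pin eqxx scale1r compm1.
by rewrite -compA ppr_pin (negbTE l'l) scale0r compm0.
Qed.

End Power.

Section HomFormula.
Context {F : fieldType} {U V C : linCat F}.

Definition bifun_basis (B : bifun U V C) (S X : U) n (e : 'I_n -> mor S X) :=
  (forall x, exists c : 'I_n -> F, x = \sum_k c k *: e k) /\
  forall Y Y' (f : mor (B S Y) (B X Y')),
    exists! h : 'I_n -> mor Y Y', f = \sum_k bmap B (e k) (h k).

(* Hom(S ⊠ Y, X ⊠ Y') = Hom(S, X) ⊗ Hom(Y, Y'), where Hom(S, X) is finite
   dimensional. *)
Definition hom_formula (B : bifun U V C) :=
  forall S X, exists n (e : 'I_n -> mor S X), bifun_basis B e.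

Hypotheses (abU : abelian U) (ssU : semisimple U) (abV : abelian V).
Hypothesis basisU : forall S X : U, exists n (e : 'I_n -> mor S X) c, coord_basis e c.

Section CopowerFunctor.
Variable S : U.

Record hom_basis X := HomBasis {
  hb_n : nat;
  hb_e : 'I_hb_n -> mor S X;
  hb_c : mor S X -> 'rV[F]_hb_n;
  hb_P : coord_basis hb_e hb_c }.

Arguments hb_n {X}.
Arguments hb_e {X} h.
Arguments hb_c {X} h.

Lemma hom_basis_ex X : inhabited (hom_basis X).
Proof. by have [n [e [c P]]] := basisU S X; constructor; exact: HomBasis P. Qed.

Variable hb : forall X, hom_basis X.
Variable pob : nat -> V -> V.
Variable pw : forall n Y, power n Y (pob n Y).

Local Notation n_ X := (hb_n (hb X)).
Local Notation e_ := (hb_e (hb _)).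
Local Notation c_ X := (hb_c (hb X)).

(* Hom(S, X) ⊗ Y, in coordinates. *)
Definition copower X Y : V := pob (n_ X) Y.

Definition copower_map X X' Y Y' (f : mor X X') (g : mor Y Y') :
    mor (copower X Y) (copower X' Y') :=
  power_mx (pw _ _) (pw _ _) (fun k l => c_ X' (f ∘ e_ l) 0 k *: g).

Lemma hb_lin X : linear (c_ X).
Proof. by case: (hb_P (hb X)). Qed.

Lemma hb_sum X (x : mor S X) : x = \sum_k c_ X x 0 k *: e_ k.
Proof. by case: (hb_P (hb X)) => _ + _; apply. Qed.

Lemma hb_delta X l k : c_ X (e_ l) 0 k = (k == l)%:R.
Proof. by case: (hb_P (hb X)). Qed.

Lemma hb_comp X X' (f : mor X X') (x : mor S X) k :
  c_ X' (f ∘ x) 0 k = \sum_m c_ X x 0 m * c_ X' (f ∘ e_ m) 0 k.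
Proof.
rewrite {1}(hb_sum x) comp_sumr (linear_sum _ _ _ (hb_lin (X:=X'))) summxE.
by apply: eq_bigr => m _; rewrite compZr (linearZ0 _ _ (hb_lin (X:=X'))) mxE.
Qed.

Definition copower_bifun : bifun U V V.
Proof.
refine (@Bifun _ U V V copower copower_map _ _ _ _).
- move=> X1 X2 Y1 Y2 g k f f'; apply: (power_ext (a := pw _ _) (b := pw _ _)) => i j.
  rewrite compDr compDl !power_mxE compDl hb_lin.
  by rewrite !mxE scalerDl scalerA.
- move=> X1 X2 Y1 Y2 f k g g'; apply: (power_ext (a := pw _ _) (b := pw _ _)) => i j.
  by rewrite compDr compDl !power_mxE scalerDr !scalerA mulrC.
- move=> X Y; apply: (power_ext (a := pw _ _) (b := pw _ _)) => i j.
  by rewrite power_mxE comp1m hb_delta compm1 ppr_pin.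
- move=> X1 X2 X3 Y1 Y2 Y3 f' f g' g.
  apply: (power_ext (a := pw _ _) (b := pw _ _)) => i j.
  rewrite power_mxE [in RHS]compA ppr_power_mx -[in RHS]compA power_mx_pin.
  rewrite -compA hb_comp scaler_suml comp_suml; apply: eq_bigr => m _.
  rewrite comp_sumr (bigD1 m) //= big1 ?addr0 => [|m' m'm].
    by rewrite !compA -(compA _ (ppr _ _)) ppr_pin eqxx scale1r compm1 compZl compZr scalerA mulrC.
  by rewrite !compA -(compA _ (ppr _ _)) ppr_pin eq_sym (negbTE m'm) scale0r compm0 comp0m.
Defined.

Lemma copower_pin X Y Y' (g : mor Y Y') l :
  bmap copower_bifun (idm X) g ∘ pin (pw (n_ X) Y) l = pin (pw (n_ X) Y') l ∘ g.
Proof.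
rewrite power_mx_pin (bigD1 l) //= big1 ?addr0 => [|k kl].
  by rewrite comp1m hb_delta eqxx scale1r.
by rewrite comp1m hb_delta (negbTE kl) scale0r compm0.
Qed.

(** In the first variable this holds since every linear functor on the semisimple U is right exact;
    in the second the functor is Y |-> Y^n, handled summand by summand. *)
Lemma copower_right_exact : right_exact2 copower_bifun.
Proof.
split=> [X Y Z f g W fg|W X Y Z f g [gf0 u]].
  exact: (semisimple_right_exact abU ssU (bifunl copower_bifun W) fg).
split; first by rewrite -bmapM gf0 bmapm0.
move=> T h hf0.
have kP l : exists k, k ∘ g = h ∘ pin (pw (n_ W) Y) l.
  have [|k [kg _]] := u T (h ∘ pin (pw _ _) l); last by exists k.
  by rewrite -compA -copower_pin compA hf0 comp0m.
have [k {}kP] := choice kP.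
have gE : is_epi g.
  apply: epi0 => R r rg0; have [|s [_ su]] := u R (r ∘ g).
    by rewrite -compA gf0 compm0.
  by rewrite -(su r) // (su 0) // comp0m rg0.
exists (\sum_l (k l ∘ ppr (pw _ _) l)); split.
  apply: (power_epi (a := pw (n_ W) Y)) => l.
  rewrite -compA copower_pin compA -kP; congr (_ ∘ g).
  rewrite comp_suml (bigD1 l) //= big1 ?addr0 => [|l' l'l].
    by rewrite -compA ppr_pin eqxx scale1r compm1.
  by rewrite -compA ppr_pin (negbTE l'l) scale0r compm0.
move=> k' k'P; apply: (power_epi (a := pw (n_ W) Z)) => l; apply: gE.
rewrite -[RHS]compA -copower_pin compA k'P -kP; congr (_ ∘ g).
rewrite comp_suml (bigD1 l) //= big1 ?addr0 => [|l' l'l].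
  by rewrite -compA ppr_pin eqxx scale1r compm1.
by rewrite -compA ppr_pin (negbTE l'l) scale0r compm0.
Qed.

(** The extension H of [copower_bifun] to C plays the role of a right adjoint of Y |-> S ⊠ Y. Thus f
    : S ⊠ Y -> X ⊠ Y' corresponds to its transpose Y -> Hom(S, X) ⊗ Y', whose coordinates are the
    h_k. *)
Lemma deligne_bifun_basis (B : bifun U V C) X :
  is_deligne B -> bifun_basis B (hb_e (hb X)).
Proof.
move=> [abC [_ reB] dB].
have [/(_ copower_bifun copower_right_exact)[H reH [eta etaP]] _] := dB V abV.
have [_ ff] := dB C abC.
pose J := bifunr B S.
have reJ : right_exact J by move=> ? ? ? ? ?; exact: reB.
(* Evaluation S ⊠ (Hom(S, Z) ⊗ Y) -> Z ⊠ Y, the counit at product objects. *)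
pose ep Z Y : mor (B S (copower Z Y)) (B Z Y) :=
  \sum_k bmap B (e_ k) (ppr (pw (n_ Z) Y) k).
have epP Z Z' Y Y' (f : mor Z Z') (g : mor Y Y') :
    ep Z' Y' ∘ bmap B (idm S) (bmap copower_bifun f g) = bmap B f g ∘ ep Z Y.
  rewrite /ep comp_suml comp_sumr.
  under eq_bigr => k _ do rewrite -bmapM compm1 ppr_power_mx bmap_sumr.
  rewrite exchange_big; apply: eq_bigr => l _; rewrite -bmapM.
  rewrite [in RHS](hb_sum (f ∘ e_ l)) bmap_suml; apply: eq_bigr => k _.
  by rewrite bmapZ compZl.
have reJH : right_exact (linFun_comp J H).
  by move=> X1 X2 X3 f1 f2 /reH /reJ.
have reI : right_exact (linFun_id C) by [].
(* Full faithfulness extends the counit to all of C. Its naturality is then available for every f,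
   not only for f of the form x ⊠ h. *)
have [|b [[bn bE] _]] := ff (linFun_comp J H) (linFun_id C) reJH reI
    (fun Z Y => ep Z Y ∘ bmap B (idm S) (ifwd (eta Z Y))).
  move=> X1 X2 Y1 Y2 f g /=.
  rewrite -compA -bmapM comp1m etaP -[idm S in LHS]comp1m bmapM compA epP.
  by rewrite -compA.
(* The unit of the adjunction, given by the identity in Hom(S, S). *)
pose sg Y : mor Y (copower S Y) := \sum_k c_ S (idm S) 0 k *: pin (pw (n_ S) Y) k.
have psg Y k : ppr (pw (n_ S) Y) k ∘ sg Y = c_ S (idm S) 0 k *: idm Y.
  rewrite comp_sumr (bigD1 k) //= big1 ?addr0 => [|l lk].
    by rewrite compZr ppr_pin eqxx scale1r.
  by rewrite compZr ppr_pin eq_sym (negbTE lk) scale0r scaler0.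
have epsg Y : ep S Y ∘ bmap B (idm S) (sg Y) = idm (B S Y).
  rewrite /ep comp_suml; under eq_bigr => k _ do rewrite -bmapM compm1 psg -bmapZ.
  by rewrite -bmap_suml -hb_sum bmap1.
split; first by move=> x; exists (fun k => c_ X x 0 k); exact: hb_sum.
move=> Y Y' f.
(* The transpose of f. *)
pose w (f : mor (B S Y) (B X Y')) :=
  ifwd (eta X Y') ∘ fmap H f ∘ inv (eta S Y) ∘ sg Y.
exists (fun k => ppr (pw (n_ X) Y') k ∘ w f); split.
  have -> : \sum_k bmap B (e_ k) (ppr (pw (n_ X) Y') k ∘ w f)
            = ep X Y' ∘ bmap B (idm S) (w f).
    by rewrite /ep comp_suml; apply: eq_bigr => k _; rewrite -bmapM compm1.
  have := bn _ _ f; rewrite /= !bE => /(congr1 (mcomp^~ (bmap B (idm S) (inv (eta S Y) ∘ sg Y)))).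
  rewrite -!compA -!bmapM !comp1m fwdKl epsg compm1 => fE.
  by rewrite -[LHS]fE /w !compA.
move=> h ->; apply: functional_extensionality_dep => m.
have wE k : w (bmap B (e_ k) (h k)) = bmap copower_bifun (e_ k) (h k) ∘ sg Y.
  by rewrite /w etaP -!compA fwdKl.
rewrite /w (linear_sum _ _ _ (@fmap_lin _ _ _ H _ _)) comp_sumr !comp_suml comp_sumr.
under eq_bigr => k _ do rewrite -/(w _) wE compA ppr_power_mx.
have cE k : (\sum_l (c_ X (e_ k ∘ e_ l) 0 m *: h k ∘ ppr (pw (n_ S) Y) l)) ∘ sg Y
    = (m == k)%:R *: h k.
  rewrite comp_suml; under eq_bigr => l _ do rewrite -compA psg compZr compZl compm1 scalerA.
  rewrite -scaler_suml; congr (_ *: _).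
  by rewrite -hb_delta -[in RHS](compm1 (e_ k)) hb_comp.
rewrite (bigD1 m) //= [X in _ + X]big1 ?addr0 => [|k km]; rewrite cE; last first.
  by rewrite eq_sym (negbTE km) scale0r.
by rewrite eqxx scale1r.
Qed.

End CopowerFunctor.

Arguments hb_n {S X}.
Arguments hb_e {S X} h.

Lemma deligne_hom_formula (B : bifun U V C) : is_deligne B -> hom_formula B.
Proof.
move=> dB S X.
have [hb] := dinhabited (hom_basis_ex S).
have [P0 P0P] := @choice _ _ (fun p P => inhabited (power p.1 p.2 P))
  (fun p : nat * V => power_ex p.1 p.2 abV).
have [pw] : inhabited (forall n Y, power n Y (P0 (n, Y))).
  by apply: dinhabited => n; apply: dinhabited => Y; exact: (P0P (n, Y)).
by exists (hb_n (hb X)), (hb_e (hb X)); exact: (@deligne_bifun_basis S hb (fun n Y => P0 (n, Y)) pw B X dB).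
Qed.

End HomFormula.

(** * The pairing on a simple algebra *)

Section SimpleDual.
Context {F : fieldType} {U : monCat F}.
Hypotheses (abU : abelian U) (ssU : semisimple U).

(** An idempotent of X^* transposes to an idempotent d of X, where simplicity of X decides. *)
Lemma dual_idempotent (X : U) (D : dual_of X) (e : mor D D) :
  simple X -> e ∘ e = e -> e = 0 \/ e = idm (dual D).
Proof.
move=> sX ee; pose d := rcurry (ev D ∘ (e ⊗^ idm X)).
have dE : ev D ∘ (idm D ⊗^ d) = ev D ∘ (e ⊗^ idm X) by rewrite rcurryP.
have dd : d ∘ d = d.
  apply: (@rcurry_inj _ _ _ D); rewrite tens1M compA dE -compA tens_interchange.
  by rewrite compA dE -compA -tensM1 ee.
have [d0|d1] := simple_idempotent abU sX dd; [left|right].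
  by apply: lcurry0; rewrite -dE d0 tensm0 compm0.
by apply: (@lcurry_inj _ _ _ D); rewrite -dE d1.
Qed.

(** The form curries to a nonzero a : X' -> X^*. With a r a = a, both a r and r a are nonzero
    idempotents, hence identities. *)
Lemma simple_pairing_iso (X X' : U) (D : dual_of X) (f : mor (X' ⊗ X) munit) :
  simple X -> simple X' -> f <> 0 -> isomorphic X' (dual D).
Proof.
move=> sX sX' f0; pose a := lcurry D f.
have a0 : a <> 0 by move=> e; apply: f0; rewrite -(lcurryP D f) -/a e tens0m compm0.
have [r ara] := semisimple_regular abU ssU a.
have [ar0|ar1] := dual_idempotent sX (e := a ∘ r) (etrans (compA _ _ _) (congr1 (mcomp^~ r) ara)).
  by case: a0; rewrite -ara ar0 comp0m.
have [ra0|ra1] := simple_idempotent abU sX' (d := r ∘ a)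
    (etrans (esym (compA _ _ _)) (congr1 (mcomp r) (etrans (compA _ _ _) ara))).
  by case: a0; rewrite -ara -compA ra0 compm0.
by constructor; exists a r.
Qed.

Lemma simple_pairing_unique (X X' X'' : U) (D : dual_of X)
    (f : mor (X' ⊗ X) munit) (g : mor (X'' ⊗ X) munit) :
  simple X -> simple X' -> simple X'' -> f <> 0 -> g <> 0 -> isomorphic X' X''.
Proof.
move=> sX sX' sX'' f0 g0.
have [i] := simple_pairing_iso D sX sX' f0; have [j] := simple_pairing_iso D sX sX'' g0.
constructor; exists (inv j ∘ ifwd i) (inv i ∘ ifwd j).
  by rewrite -compA fwdKl invK.
by rewrite -compA fwdKl invK.
Qed.

End SimpleDual.

Section Nondegenerate.
Context {F : fieldType} {C : braidedCat F} {A : C} (alg : comAlg A).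
Variable rho : mor A munit.
Hypothesis rho_one : rho ∘ aone alg = idm munit.

Definition apairing : mor (A ⊗ A) munit := rho ∘ amul alg.

Lemma apairing_braid : apairing ∘ ifwd (braid A A) = apairing.
Proof. by rewrite /apairing -compA amulC. Qed.

Lemma apairing_swap X Y (f : mor X A) (g : mor Y A) :
  apairing ∘ (f ⊗^ g) = apairing ∘ (g ⊗^ f) ∘ ifwd (braid X Y).
Proof. by rewrite -{1}apairing_braid -!compA braid_nat. Qed.

Lemma apairing_swap0 X Y (f : mor X A) (g : mor Y A) :
  apairing ∘ (f ⊗^ g) = 0 -> apairing ∘ (g ⊗^ f) = 0.
Proof. by rewrite apairing_swap => e; apply: (@inv_inj _ _ _ _ _ (braid X Y)); rewrite e comp0m. Qed.

(* The radical of the pairing is an ideal, hence vanishes. *)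
Lemma apairing_nondegenerate :
  simple_alg alg -> idm (munit : C) <> 0 ->
  (exists (N : C) (n : mor N A), [/\ is_mono n, apairing ∘ (n ⊗^ idm A) = 0 &
     forall T (f : mor T A), apairing ∘ (f ⊗^ idm A) = 0 -> exists g, n ∘ g = f]) ->
  forall T (f : mor T A), apairing ∘ (f ⊗^ idm A) = 0 -> f = 0.
Proof.
move=> [_ sA] one0 [N [n [nm n0 nu]]].
have n0' := apairing_swap0 n0.
(* The radical is an ideal by associativity, ρ(x(yn)) = ρ((xy)n) = 0, so multiplication restricts to
   an action a on N. *)
have [|a an] := nu _ (amul alg ∘ (idm A ⊗^ n)).
  apply: apairing_swap0; rewrite tens1M /apairing -!compA (compA (amul alg)) amulA.
  rewrite -!compA assoc_nat bmap1 (compA (amul alg ⊗^ _)) tens_interchange.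
  by rewrite !compA -/apairing n0' !comp0m.
have a1 : a ∘ (aone alg ⊗^ idm N) = ifwd (lunit N).
  apply: nm; rewrite compA an -lunit_nat -(amul1m alg) -!compA.
  by rewrite tens_interchange.
have aA : a ∘ (idm A ⊗^ a) = a ∘ (amul alg ⊗^ idm N) ∘ ifwd (assoc A A N).
  apply: nm; rewrite !compA an -!compA -tens1M an tens1M compA amulA.
  rewrite -!compA assoc_nat bmap1 (compA (amul alg ⊗^ _)) tens_interchange -!compA //.
pose M : Rep alg := AMod a1 aA.
have nP : n \in @amod_hom_pred F C A alg M (regular alg) by rewrite unfold_in; apply/eqP; exact: an.
pose nn : mor M (regular alg) := @AModHom F C A alg M (regular alg) n nP.
have nnm : is_mono nn.
  by move=> Z g h e; apply: val_inj; apply: nm; exact: (congr1 (@amod_map F C A alg _ _) e).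
have [nn0 T f /nu[g <-]|/is_isoE[r _ nr]] := sA M nn nnm.
  by have -> : n = 0 by [exact: (congr1 (@amod_map F C A alg _ _) nn0)]; rewrite comp0m.
(* The other case of simplicity: n invertible makes the pairing zero, and then ρ, which is pairing
   with the unit, vanishes against [rho_one]. *)
have id0 : apairing = 0.
  have e : n ∘ amod_map r = idm A by exact: (congr1 (@amod_map F C A alg _ _) nr).
  rewrite -[LHS]compm1 -(bmap1 tens A A).
  have -> : idm A ⊗^ idm A = (idm A ⊗^ n) ∘ (idm A ⊗^ amod_map r) by rewrite -tens1M e.
  by rewrite compA n0' comp0m.
case: one0; rewrite -rho_one (_ : rho = 0) ?comp0m //.
apply: (@inv_inj _ _ _ _ _ (runit A)).
by rewrite comp0m -(amulm1 alg) compA -/apairing id0 comp0m.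
Qed.

End Nondegenerate.

Lemma bmapMl (F : fieldType) (C C' D : linCat F) (B : bifun C C' D)
    X1 X2 X3 Y (f' : mor X2 X3) (f : mor X1 X2) :
  bmap B (f' ∘ f) (idm Y) = bmap B f' (idm Y) ∘ bmap B f (idm Y).
Proof. by rewrite -bmapM comp1m. Qed.

Lemma bmapMr (F : fieldType) (C C' D : linCat F) (B : bifun C C' D)
    X Y1 Y2 Y3 (g' : mor Y2 Y3) (g : mor Y1 Y2) :
  bmap B (idm X) (g' ∘ g) = bmap B (idm X) g' ∘ bmap B (idm X) g.
Proof. by rewrite -bmapM comp1m. Qed.

Lemma bmap_interchange (F : fieldType) (C C' D : linCat F) (B : bifun C C' D)
    X1 X2 Y1 Y2 (f : mor X1 X2) (g : mor Y1 Y2) :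
  bmap B f (idm Y2) ∘ bmap B (idm X1) g = bmap B f g.
Proof. by rewrite -bmapM comp1m compm1. Qed.

(** * Consequences of the formula for Hom *)

Section HomConsequences.
Context {F : fieldType} {U V : monCat F} {C : linCat F} (B : bifun U V C).
Hypothesis hf : hom_formula B.

Lemma hom_expand (S X : U) (Y Y' : V) (f : mor (B S Y) (B X Y')) :
  exists n (e : 'I_n -> mor S X) (h : 'I_n -> mor Y Y'),
    f = \sum_k bmap B (e k) (h k).
Proof. by have [n [e [_ /(_ _ _ f)[h [fE _]]]]] := hf S X; exists n, e, h. Qed.

Lemma hom_zerol (S X : U) (Y Y' : V) (f : mor (B S Y) (B X Y')) :
  (forall x : mor S X, x = 0) -> f = 0.
Proof.
have [n [e [h ->]]] := hom_expand f; move=> x0.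
by rewrite big1 // => k _; rewrite (x0 (e k)) bmap0m.
Qed.

Lemma hom_zeror (S X : U) (Y Y' : V) (f : mor (B S Y) (B X Y')) :
  (forall h : mor Y Y', h = 0) -> f = 0.
Proof.
have [n [e [h ->]]] := hom_expand f; move=> x0.
by rewrite big1 // => k _; rewrite (x0 (h k)) bmapm0.
Qed.

Lemma bifun_basis_free (S X : U) n (e : 'I_n -> mor S X) (Y Y' : V)
    (h : 'I_n -> mor Y Y') : bifun_basis B e ->
  \sum_k bmap B (e k) (h k) = 0 -> forall k, h k = 0.
Proof.
move=> [_ eB] h0; have [h' [_ hu]] := eB Y Y' 0.
have h'0 : h' = (fun _ => 0) by apply: hu; rewrite big1 // => k _; rewrite bmapm0.
by move=> k; rewrite -(hu h) ?h'0.
Qed.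

Lemma bmap_eq0 (S X : U) (Y Y' : V) (x : mor S X) (h : mor Y Y') :
  bmap B x h = 0 -> x = 0 \/ h = 0.
Proof.
have [n [e eB]] := hf S X; have [c xE] := eB.1 x => xh0.
have ch0 : forall k, c k *: h = 0.
  apply: (bifun_basis_free eB); rewrite -[RHS]xh0 xE bmap_suml.
  by apply: eq_bigr => k _; rewrite bmapZ.
have [c0|/existsNP[k /eqP ck]] := pselect (forall k, c k = 0).
  by left; rewrite xE big1 // => k _; rewrite c0 scale0r.
by right; apply/eqP; have /eqP := ch0 k; rewrite scaler_eq0 (negbTE ck).
Qed.

Hypothesis End1U : forall f : mor (munit : U) munit, exists s, f = s *: idm munit.
Hypothesis End1V : forall f : mor (munit : V) munit, exists s, f = s *: idm munit.

Lemma hom_fullr (Y Y' : V) (f : mor (B munit Y) (B munit Y')) :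
  exists h, f = bmap B (idm munit) h.
Proof.
have [n [e [h ->]]] := hom_expand f; have [s sP] := choice (fun k => End1U (e k)).
exists (\sum_k s k *: h k); rewrite bmap_sumr; apply: eq_bigr => k _.
by rewrite {1}sP bmapZ.
Qed.

Lemma hom_fulll (X X' : U) (f : mor (B X munit) (B X' munit)) :
  exists x, f = bmap B x (idm munit).
Proof.
have [n [e [h ->]]] := hom_expand f; have [s sP] := choice (fun k => End1V (h k)).
exists (\sum_k s k *: e k); rewrite bmap_suml; apply: eq_bigr => k _.
by rewrite {1}sP bmapZ.
Qed.

Hypotheses (abU : abelian U) (ssU : semisimple U) (simple1 : simple (munit : U)).

(** Only the summands of X isomorphic to 1 admit nonzero morphisms to 1, and those are reached by
    morphisms 1 -> X. *)
Lemma hom_one_test (X : U) (Y Y' : V) (f : mor (B X Y) (B munit Y')) :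
  (forall k : mor munit X, f ∘ bmap B k (idm Y) = 0) -> f = 0.
Proof.
move=> f0; have [n [T [sT [d]]]] := ssU X.
rewrite -[LHS]compm1 -bmap1 -(biproduct_sum d) bmap_suml comp_sumr big1 // => k _.
rewrite bmapMl compA.
suff -> : f ∘ bmap B (inc d k) (idm Y) = 0 by exact: comp0m.
have [[i]|ni] := pselect (isomorphic munit (T k)).
  have := f0 (inc d k ∘ ifwd i); rewrite bmapMl compA => e.
  rewrite -[LHS]compm1 -bmap1 -(fwdK i) bmapMl compA.
  by rewrite e comp0m.
apply: hom_zerol => x; have [//|[i _]] := Schur abU x (sT k) simple1.
by case: ni; constructor; exact: iso_sym i.
Qed.

End HomConsequences.

(** * Free modules and their morphisms *)

Section FreeModules.
Context {F : fieldType} {C : braidedCat F} {A : C} (alg : comAlg A).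
Implicit Types X Y : C.

Definition free_unit X : mor X (A ⊗ X) := (aone alg ⊗^ idm X) ∘ inv (lunit X).

Lemma free_unit_nat X Y (f : mor X Y) :
  (idm A ⊗^ f) ∘ free_unit X = free_unit Y ∘ f.
Proof. by rewrite /free_unit compA -tens_interchange -!compA lunitV_nat. Qed.

Lemma ind_act_unit X : ind_act alg X ∘ (idm A ⊗^ free_unit X) = idm (A ⊗ X).
Proof.
rewrite /ind_act /free_unit tens1M -!compA (compA (ifwd _)) assoc_nat.
rewrite !compA -tensM1 amulm1 triangle -tens1M fwdK bmap1 //.
Qed.

(** Linearity recovers h from its restriction to generators, as the action composed with 1 ⊗ (h
    [free_unit]). *)
Lemma free_hom_ext X (M : Rep alg) (f g : mor (induction alg X) M) :
  amod_map f ∘ free_unit X = amod_map g ∘ free_unit X -> f = g.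
Proof.
have actE (h : mor (induction alg X) M) :
    amod_map h = act M ∘ (idm A ⊗^ (amod_map h ∘ free_unit X)).
  rewrite tens1M compA -(amod_mapP h) -compA /=.
  by rewrite -[LHS]compm1 -(ind_act_unit X).
by move=> e; apply: val_inj; rewrite /= (actE f) (actE g) e.
Qed.

Fact kleisli_subproof X Y (f : mor X (A ⊗ Y)) :
  ind_act alg Y ∘ (idm A ⊗^ f)
    \in @amod_hom_pred F C A alg (induction alg X) (induction alg Y).
Proof.
rewrite unfold_in; apply/eqP; rewrite /= tens1M !compA ind_actA -!compA assoc_nat bmap1.
by rewrite /ind_act (compA (idm A ⊗^ f)) -tens_interchange !compA.
Qed.

Definition kleisli X Y (f : mor X (A ⊗ Y)) :
    mor (induction alg X) (induction alg Y) :=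
  @AModHom F C A alg (induction alg X) (induction alg Y) _ (kleisli_subproof f).

Lemma kleisli_unit X Y (f : mor X (A ⊗ Y)) :
  amod_map (kleisli f) ∘ free_unit X = f.
Proof.
rewrite /= -compA /free_unit (compA (idm A ⊗^ f)) -tens_interchange -!compA lunitV_nat.
by rewrite !compA ind_act1 fwdK comp1m.
Qed.

End FreeModules.

(** * The isomorphism of induced modules *)

(* A is either a finite biproduct or a formal direct sum of the A_ i; the
   hypotheses on ic and pr are what the two have in common. *)
Section Mirror.
Context {F : fieldType} {U : monCat F} {V C : braidedCat F}.
Variables (B : bifun U V C) (S : strong_bifun B).
Hypotheses (hf : hom_formula B) (abU : abelian U) (ssU : semisimple U) (abV : abelian V).
Variables (dU : forall X : U, dual_of X) (dV : forall Y : V, dual_of Y).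
Hypothesis End1U : forall f : mor (munit : U) munit, exists s, f = s *: idm munit.
Hypothesis End1V : forall f : mor (munit : V) munit, exists s, f = s *: idm munit.
Hypothesis simple1 : simple (munit : U).
Variables (I : choiceType) (i0 : I) (U_ : I -> U) (V_ : I -> V).
Hypothesis U_simple : forall i, simple (U_ i).
Hypothesis U_distinct : forall i j, isomorphic (U_ i) (U_ j) -> i = j.
Hypothesis V_neq0 : forall i, ~ is_zero (V_ i).
Variables (U_0 : iso munit (U_ i0)) (V_0 : iso munit (V_ i0)).
Hypothesis HomU0 : forall i, i <> i0 -> forall f : mor munit (U_ i), f = 0.
Hypothesis HomV0 : forall i, i <> i0 -> forall f : mor munit (V_ i), f = 0.
Variables (A : C) (alg : comAlg A).
Local Notation A_ i := (B (U_ i) (V_ i)).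
Variables (ic : forall i, mor (A_ i) A) (pr : forall i, mor A (A_ i)).
Hypothesis pr_ic : forall i, pr i ∘ ic i = idm (A_ i).
Hypothesis pr_mono : forall T X (f : mor T (A ⊗ X)),
  (forall i, (pr i ⊗^ idm X) ∘ f = 0) -> f = 0.
Hypothesis ic_epi : forall X Z (f : mor (A ⊗ X) Z),
  (forall i, f ∘ (ic i ⊗^ idm X) = 0) -> f = 0.
Hypothesis pr_ic0 : forall i j, i <> j -> pr j ∘ ic i = 0.
Hypothesis simpleA : simple_alg alg.
(* The index conditions say that the pairing is block-monomial; without them
   its radical need not be a formal direct sum of objects of C. *)
Hypothesis radical_ex : forall b : mor (A ⊗ A) munit,
  (forall l m m', b ∘ (ic l ⊗^ ic m) <> 0 -> b ∘ (ic l ⊗^ ic m') <> 0 -> m = m') ->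
  (forall l l' m, b ∘ (ic l ⊗^ ic m) <> 0 -> b ∘ (ic l' ⊗^ ic m) <> 0 -> l = l') ->
  exists (N : C) (n : mor N A), [/\ is_mono n, b ∘ (n ⊗^ idm A) = 0 &
    forall T (f : mor T A), b ∘ (f ⊗^ idm A) = 0 -> exists g, n ∘ g = f].

Local Notation one_ := (sb_one S).
Local Notation iota := (aone alg).

Lemma pr_mono1 T (f : mor T A) : (forall i, pr i ∘ f = 0) -> f = 0.
Proof.
move=> f0; apply: (inv_cancell (i := runit A)); rewrite compm0; apply: pr_mono => i.
by rewrite compA runitV_nat -compA f0 compm0.
Qed.

Lemma one_neq0 : idm (munit : C) <> 0.
Proof.
move=> e; have : idm (B munit munit) = 0.
  by rewrite -(fwdK one_) -[ifwd one_]compm1 e compm0 comp0m.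
rewrite -bmap1 => /(bmap_eq0 hf)[/is_zeroE|/is_zeroE z]; first by case: simple1.
apply: (V_neq0 (i := i0)); apply/is_zeroE.
by rewrite -(fwdK V_0) -[ifwd V_0]compm1 (proj1 (is_zeroE _) z) compm0 comp0m.
Qed.

Lemma aone_neq0 : iota <> 0.
Proof.
move=> i0'; apply: one_neq0; have A0 : idm A = 0.
  by rewrite -(fwdK (lunit A)) -(amul1m alg) i0' tens0m compm0 comp0m.
case: (simpleA) => + _; case; apply/is_zeroE; apply: val_inj; exact: A0.
Qed.

(** Since Hom(1, U_c) = 0 for c <> 0, the unit of A is a scalar multiple c of the inclusion of the
    summand isomorphic to 1; ρ is the projection rescaled by c^-1. *)
Lemma counit_ex : exists2 rho : mor A munit,
  rho ∘ iota = idm munit & iota ∘ rho = ic i0 ∘ pr i0.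
Proof.
pose w := biso B U_0 V_0.
have [g gE] : exists g, inv w ∘ pr i0 ∘ iota ∘ inv one_ = bmap B (idm munit) g.
  exact: hom_fullr.
have [c cE] := End1V g.
have iE : iota = c *: (ic i0 ∘ ifwd w ∘ ifwd one_).
  have iE' : pr i0 ∘ iota = c *: (ifwd w ∘ ifwd one_).
    apply: (inv_cancell (i := w)); apply: (inv_cancelr (i := one_)).
    rewrite !compA gE cE -bmapZ compZr invKl compZl fwdK.
    by rewrite (linearZ0 _ _ (bmap_linl B _)) bmap1.
  apply/eqP; rewrite -subr_eq0; apply/eqP/pr_mono1 => i.
  have [->|/eqP ii0] := eqVneq i i0.
    by rewrite compBr iE' compZr !compA pr_ic comp1m subrr.
  rewrite compBr compZr !compA pr_ic0; last exact: nesym.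
  rewrite !comp0m scaler0 subr0; apply: (inv_cancelr (i := one_)); rewrite comp0m.
  by apply: (hom_zerol hf); exact: HomU0.
(* A vanishing unit would make A zero, against simplicity. *)
have c0 : c != 0 by apply/eqP => c0; apply: aone_neq0; rewrite iE c0 scale0r.
exists (c^-1 *: (inv one_ ∘ inv w ∘ pr i0)).
  rewrite iE compZl compZr scalerA mulVf // scale1r.
  rewrite -!compA (compA (pr i0)) pr_ic comp1m invKl invK //.
rewrite {1}iE compZl compZr scalerA mulfV // scale1r.
by rewrite -!compA fwdKl fwdKl.
Qed.

Section Counit.
Variable rho : mor A munit.
Hypotheses (rho_one : rho ∘ iota = idm munit) (one_rho : iota ∘ rho = ic i0 ∘ pr i0).

Local Notation pairing := (apairing alg rho).
Local Notation beta m l := (pairing ∘ (ic m ⊗^ ic l)).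

Lemma beta_hom m l : beta m l <> 0 -> exists f : mor (U_ m ⊗ U_ l) munit, f <> 0.
Proof.
move=> b0; apply: contrapT => /forallNP nf; apply: b0.
apply: (inv_cancelr (i := sb_tens S _ _ _ _)); apply: (fwd_cancell (i := one_)).
rewrite comp0m compm0; apply: (hom_zerol hf) => x.
exact: contrapT (nf x).
Qed.

Lemma beta_sym m l : beta m l <> 0 -> beta l m <> 0.
Proof. by move=> b0 e; apply: b0; exact: apairing_swap0. Qed.

Lemma beta_unique m m' l : beta m l <> 0 -> beta m' l <> 0 -> m = m'.
Proof.
move=> /beta_hom[f f0] /beta_hom[g g0]; apply: U_distinct.
exact: (simple_pairing_unique abU ssU (dU (U_ l)) (U_simple l) (U_simple m) (U_simple m') f0 g0).
Qed.

Lemma pairing_nd T (f : mor T A) : pairing ∘ (f ⊗^ idm A) = 0 -> f = 0.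
Proof.
apply: apairing_nondegenerate => //; first exact: one_neq0.
apply: radical_ex => [l m m' /beta_sym h /beta_sym h'|l l' m]; last exact: beta_unique.
exact: beta_unique h h'.
Qed.

(** Otherwise A_i lies in the radical, so A_i = 0, although both U_i and V_i are nonzero. *)
Lemma dual_index_ex i : exists j, beta j i <> 0.
Proof.
apply: contrapT => /forallNP nb.
have i0' : ic i = 0.
  apply: pairing_nd; apply: apairing_swap0; apply: ic_epi => j.
  by rewrite -compA -tens_interchange -tensM comp1m compm1; exact: contrapT (nb j).
have /(bmap_eq0 hf) : bmap B (idm (U_ i)) (idm (V_ i)) = 0.
  by rewrite bmap1 -(pr_ic i) i0' compm0.
case=> /is_zeroE; first by case: (U_simple i).
exact: V_neq0.
Qed.


Lemma ic_mono T i (f : mor T (A_ i)) : ic i ∘ f = 0 -> f = 0.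
Proof. by move=> e; rewrite -[f]comp1m -pr_ic -compA e compm0. Qed.

(** By [beta_unique] the block (j, i) is the only nonzero one with second index i, so a morphism
    killed there is killed by the whole pairing. *)
Lemma beta_ndr j i : beta j i <> 0 -> forall T (g : mor T (A_ i)),
  beta j i ∘ (idm _ ⊗^ g) = 0 -> g = 0.
Proof.
move=> bji T g g0; apply: ic_mono; apply: pairing_nd; apply: apairing_swap0.
apply: ic_epi => m; rewrite -compA -tens_interchange -tensM comp1m compm1.
have -> : ic m ⊗^ (ic i ∘ g) = (ic m ⊗^ ic i) ∘ (idm _ ⊗^ g) by rewrite -tensM compm1.
rewrite compA; have [b0|bmi] := pselect (beta m i = 0); first by rewrite b0 comp0m.
by rewrite (beta_unique bmi bji).
Qed.

Lemma beta_ndl j i : beta j i <> 0 -> forall T (f : mor T (A_ j)),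
  beta j i ∘ (f ⊗^ idm _) = 0 -> f = 0.
Proof.
move=> bji T f f0; apply: (beta_ndr (beta_sym bji)).
rewrite -compA -tensM compm1; apply: apairing_swap0.
by rewrite -[ic i]compm1 tensM compA.
Qed.

Section Pair.
Variables (j i : I).
Hypothesis bji : beta j i <> 0.

(** The block of the pairing, conjugated into a morphism between values of B so that [hf]
    applies. *)
Definition bpair : mor (B (U_ j ⊗ U_ i) (V_ j ⊗ V_ i)) (B munit munit) :=
  ifwd one_ ∘ beta j i ∘ inv (sb_tens S (U_ j) (U_ i) (V_ j) (V_ i)).

Lemma bpair_tens X X' Y Y' (x : mor X (U_ j)) (x' : mor X' (U_ i))
    (h : mor Y (V_ j)) (h' : mor Y' (V_ i)) :
  bpair ∘ bmap B (x ⊗^ x') (h ⊗^ h')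
  = ifwd one_ ∘ (beta j i ∘ (bmap B x h ⊗^ bmap B x' h')) ∘ inv (sb_tens S _ _ _ _).
Proof. by rewrite /bpair -!compA sbV_nat. Qed.

Lemma bpair_ndl X T n (x : 'I_n -> mor X (U_ j)) (h : 'I_n -> mor T (V_ j)) :
  \sum_k (bpair ∘ bmap B (x k ⊗^ idm _) (h k ⊗^ idm _)) = 0 ->
  \sum_k bmap B (x k) (h k) = 0.
Proof.
under eq_bigr => k _ do rewrite bpair_tens bmap1.
rewrite -comp_suml -!comp_sumr -tens_suml => e; apply: (beta_ndl bji).
apply: (fwd_cancell (i := one_)); apply: (inv_cancelr (i := sb_tens S _ _ _ _)).
by rewrite e compm0 comp0m.
Qed.

Lemma bpair_ndr X T n (x : 'I_n -> mor X (U_ i)) (h : 'I_n -> mor T (V_ i)) :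
  \sum_k (bpair ∘ bmap B (idm _ ⊗^ x k) (idm _ ⊗^ h k)) = 0 ->
  \sum_k bmap B (x k) (h k) = 0.
Proof.
under eq_bigr => k _ do rewrite bpair_tens bmap1.
rewrite -comp_suml -!comp_sumr -tens_sumr => e; apply: (beta_ndr bji).
apply: (fwd_cancell (i := one_)); apply: (inv_cancelr (i := sb_tens S _ _ _ _)).
by rewrite e compm0 comp0m.
Qed.

Lemma bpair_test X Y (f : mor (B X Y) (B munit munit)) :
  (forall k : mor munit X, f ∘ bmap B k (idm Y) = 0) -> f = 0.
Proof. exact: hom_one_test. Qed.

(* The pairing is split by morphisms 1 -> U_j ⊗ U_i: writing P for bpair,
   P (w ⊗ y) coev = 1 ⊠ eps (g w y), and the matrix g, with w and y running over
   bases of End(U_j) and Hom(U_j^*, U_i), is invertible over V. *)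
Lemma bpair_copairing : exists n (kap : 'I_n -> mor munit (U_ j ⊗ U_ i))
    (eps : 'I_n -> mor (V_ j ⊗ V_ i) munit) (eta : 'I_n -> mor (dual (dV (V_ i))) (V_ j)),
  (forall a, bpair ∘ bmap B (kap a) (idm _) = bmap B (idm munit) (eps a)) /\
  \sum_a (lcurry (dV (V_ i)) (eps a) ∘ eta a) = idm _.
Proof.
set D := dV (V_ i); set Dj := dU (U_ j).
have [nw [w wB]] := hf (U_ j) (U_ j); have [ny [y yB]] := hf Dj (U_ i).
pose kap a b := (w a ⊗^ y b) ∘ coev Dj.
have [eps epsE] : exists eps : 'I_nw * 'I_ny -> _,
    forall p, bpair ∘ bmap B (kap p.1 p.2) (idm _) = bmap B (idm munit) (eps p).
  apply: (dchoice (P := fun (p : 'I_nw * 'I_ny) e =>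
    bpair ∘ bmap B (kap p.1 p.2) (idm _) = bmap B (idm munit) e)) => p.
  exact: hom_fullr.
(* The two halves below split [kap a b] differently: mono takes f = w_a ⊗ 1, epi takes f = 1 ⊗
   y_b. *)
have key a b X T (f : mor X (U_ j ⊗ U_ i)) (k : mor munit X) (t : mor T (V_ j ⊗ V_ i)) :
    f ∘ k = kap a b ->
    bpair ∘ bmap B f t ∘ bmap B k (idm _) = bmap B (idm munit) (eps (a, b) ∘ t).
  move=> fk; rewrite -compA -bmapM compm1 fk -bmap_interchange compA.
  by rewrite (epsE (a, b)) -bmapMr.
pose g b a : mor (V_ j) D := lcurry D (eps (a, b)).
have gE b a : ev D ∘ (g b a ⊗^ idm _) = eps (a, b) by exact: lcurryP.
have [P [p]] := power_ex nw (V_ j) abV; have [Q [q]] := power_ex ny (dual D) abV.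
pose G := power_mx p q g.
(* If G h = 0, then ∑_a w_a ⊠ h_a pairs to zero with A_i: every 1 -> U_j ⊗ U_i is a combination of
   the (1 ⊗ y_b) coev, and on these the rows of G h appear. *)
have Gm : is_mono G.
  apply: mono0 => T h Gh0; pose ha a := ppr p a ∘ h.
  have sum0 b : \sum_a (g b a ∘ ha a) = 0.
    under eq_bigr => a _ do rewrite /ha compA.
    by rewrite -comp_suml -(ppr_power_mx p q) -compA Gh0 compm0.
  have ha0 : forall a, ha a = 0.
    apply: (bifun_basis_free wB); apply: bpair_ndl; apply: bpair_test => k'.
    have [y' ->] := coev_lP Dj k'; have [c ->] := yB.1 y'.
    have -> : (idm (U_ j) ⊗^ (\sum_b c b *: y b)) ∘ coev Dj
        = \sum_b c b *: ((idm _ ⊗^ y b) ∘ coev Dj).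
      rewrite tens_sumr comp_suml; apply: eq_bigr => b _.
      by rewrite (linearZ0 _ _ (bmap_linr tens _)) compZl.
    rewrite bmap_suml comp_sumr big1 // => b _.
    rewrite (linearZ0 _ _ (bmap_linl B _)) compZr comp_suml.
    under eq_bigr => a _ do rewrite (key a b) ?compA -?tensM ?comp1m ?compm1 // -gE -compA -tensM1.
    by rewrite -bmap_sumr -comp_sumr -tens_suml sum0 tens0m compm0 bmapm0 scaler0.
  by apply: (power_mono (b := p)) => a; rewrite compm0; exact: ha0.
have Ge : is_epi G.
  apply: epi0 => T c cG0; pose cb b := c ∘ pin q b.
  have sum0 a : \sum_b (cb b ∘ g b a) = 0.
    under eq_bigr => b _ do rewrite /cb -compA.
    by rewrite -comp_sumr -(power_mx_pin p q) compA cG0 comp0m.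
  (* Its currying [hb b] is the transpose T^* -> V_i of c_b : V_i^* -> T, which moves the relation c
     G = 0 into the right slot of the pairing. *)
  pose t b := ev (dV T) ∘ ifwd (braid T (dV T)) ∘ (cb b ⊗^ idm (dual (dV T))).
  pose hb b := rcurry (D := D) (t b).
  have hbE b : ev D ∘ (idm _ ⊗^ hb b) = t b by exact: rcurryP.
  have hb0 : forall b, hb b = 0.
    apply: (bifun_basis_free yB); apply: bpair_ndr; apply: bpair_test => k'.
    have [w' ->] := coev_rP (D := Dj) k'; have [d ->] := wB.1 w'.
    have -> : ((\sum_a d a *: w a) ⊗^ idm (dual Dj)) ∘ coev Dj
        = \sum_a d a *: ((w a ⊗^ idm _) ∘ coev Dj).
      rewrite tens_suml comp_suml; apply: eq_bigr => a _.
      by rewrite (linearZ0 _ _ (bmap_linl tens _)) compZl.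
    rewrite bmap_suml comp_sumr big1 // => a _.
    rewrite (linearZ0 _ _ (bmap_linl B _)) compZr comp_suml.
    under eq_bigr => b _ do rewrite (key a b) ?compA -?tensM ?comp1m ?compm1 //
      -gE -compA tens_interchange compA hbE -compA -tensM1.
    by rewrite -bmap_sumr -comp_sumr -tens_suml sum0 tens0m compm0 bmapm0 scaler0.
  apply: (power_epi (a := q)) => b; rewrite comp0m -/(cb b).
  apply: (@rcurry0 _ _ _ (dV T)).
  apply: (@inv_inj _ _ _ _ _ (braid (dual D) (dV T))); rewrite comp0m -compA -braid_nat compA.
  by rewrite -/(t b) -hbE hb0 tensm0 compm0.
have [Gi GGi GiG] := proj1 (is_isoE _) (abelian_balanced abV Gm Ge).
(* If Hom(U_j^*, U_i) were 0, there would be no nonzero 1 -> U_j ⊗ U_i, and [bpair_test] would kill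
   the pairing. *)
have ny0 : (0 < ny)%N.
  rewrite lt0n; apply/eqP => ny0; apply: bji.
  apply: (inv_cancelr (i := sb_tens S _ _ _ _)); apply: (fwd_cancell (i := one_)).
  rewrite comp0m compm0 compA -/bpair; apply: bpair_test => k'.
  have [y' ->] := coev_lP Dj k'; have [c ->] := yB.1 y'.
  rewrite big1 ?tensm0 ?comp0m ?bmap0m ?compm0 // => b _.
  by have := ltn_ord b; rewrite {2}ny0.
(* For any fixed b, the diagonal entry (b, b) of G G^-1 = 1 is the required sum over a. *)
pose b := Ordinal ny0.
exists nw, (kap^~ b), (fun a => eps (a, b)), (fun a => ppr p a ∘ Gi ∘ pin q b).
split=> [a|]; first exact: (epsE (a, b)).
have := ppr_pin q b b; rewrite eqxx scale1r => <-.
rewrite -[pin q b in RHS]comp1m -GiG !compA (ppr_power_mx p q) !comp_suml.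
by apply: eq_bigr => a _; rewrite !compA.
Qed.

End Pair.

Definition free_counit (X : C) : mor (A ⊗ X) X :=
  ifwd (lunit X) ∘ (rho ⊗^ idm X).

Lemma free_counit_unit X : free_counit X ∘ free_unit alg X = idm X.
Proof.
rewrite /free_counit /free_unit -!compA (compA (rho ⊗^ _)) -tensM1 rho_one bmap1 comp1m.
exact: fwdK.
Qed.

(** By [one_rho], the composite [free_unit] [free_counit] is the projection onto the unit
    summand. *)
Lemma unit_component T X (f : mor T (A ⊗ X)) :
  (forall c, c <> i0 -> (pr c ⊗^ idm X) ∘ f = 0) ->
  f = free_unit alg X ∘ (free_counit X ∘ f).
Proof.
move=> f0; rewrite /free_unit /free_counit -!compA invKl (compA (iota ⊗^ _)) -tensM1 one_rho.
apply/eqP; rewrite -subr_eq0; apply/eqP; apply: pr_mono => c.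
have [->|/eqP ci0] := eqVneq c i0.
  by rewrite compBr compA -tensM1 compA pr_ic comp1m subrr.
by rewrite compBr f0 // compA -tensM1 compA pr_ic0 ?comp0m ?tens0m ?comp0m ?subrr //; exact: nesym.
Qed.

Lemma component_zerol Y Y' (f : mor (B munit Y) (A ⊗ B munit Y')) :
  f = free_unit alg _ ∘ (free_counit _ ∘ f).
Proof.
apply: unit_component => c ci0; apply: (fwd_cancell (i := sb_tens S _ _ _ _)).
rewrite compm0; apply: (hom_zerol hf) => x.
by apply: (fwd_cancell (i := runit _)); rewrite compm0; exact: HomU0.
Qed.

Lemma component_zeror X X' (f : mor (B X munit) (A ⊗ B X' munit)) :
  f = free_unit alg _ ∘ (free_counit _ ∘ f).
Proof.
apply: unit_component => c ci0; apply: (fwd_cancell (i := sb_tens S _ _ _ _)).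
rewrite compm0; apply: (hom_zeror hf) => x.
by apply: (fwd_cancell (i := runit _)); rewrite compm0; exact: HomV0.
Qed.

(** One summand of ρ(φψ): k closes the U-legs, so the pairing becomes 1 ⊠ e, and the coevaluation of
    V_i inside φ then bends e into its curried form. *)
Lemma mirror_composite j i (k : mor munit (U_ j ⊗ U_ i))
    (e : mor (V_ j ⊗ V_ i) munit) Y (h : mor Y (V_ j)) :
  bpair j i ∘ bmap B k (idm _) = bmap B (idm munit) e ->
  free_counit (B munit (dV (V_ i))) ∘ (ind_act alg _ ∘ (idm A ⊗^
     ((ic i ⊗^ idm _) ∘ inv (sb_tens S _ _ _ _)
        ∘ bmap B (inv (runit (U_ i))) (coev (dV (V_ i))))))
    ∘ ((ic j ⊗^ idm _) ∘ inv (sb_tens S _ _ _ _)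
        ∘ bmap B k (inv (runit (V_ j)) ∘ h))
  = bmap B (idm munit) (lcurry (dV (V_ i)) e ∘ h).
Proof.
move=> ke; set D := dV (V_ i).
rewrite /free_counit /ind_act -!compA.
have -> X Z (f : mor X (A_ i ⊗ B munit D)) (z : mor Z (A_ j ⊗ X)) :
    (idm A ⊗^ ((ic i ⊗^ idm (B munit D)) ∘ f)) ∘ ((ic j ⊗^ idm X) ∘ z)
    = (ic j ⊗^ (ic i ⊗^ idm (B munit D))) ∘ ((idm (A_ j) ⊗^ f) ∘ z).
  by rewrite !compA -!tensM comp1m !compm1.
rewrite (compA (ifwd (assoc _ _ _))) assoc_nat -!compA.
rewrite (compA (amul alg ⊗^ _)) (compA (rho ⊗^ _)) -!tensM !comp1m compA -/pairing.
rewrite tens1M -!compA (compA (idm (A_ j) ⊗^ bmap B _ _)) -(bmap1 B (U_ j)) -sbV_nat -!compA.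
rewrite (bmap1 B (U_ j)) (compA (idm (A_ j) ⊗^ _)) (compA (ifwd (assoc _ _ _))).
rewrite (compA (ifwd (assoc _ _ _))) sbV_assoc -!compA -!bmapM.
have kE : ifwd (assoc (U_ j) (U_ i) munit) ∘ (idm (U_ j) ⊗^ inv (runit (U_ i)) ∘ k)
    = (k ⊗^ idm munit) ∘ inv (runit munit).
  rewrite runitV_nat; apply: (fwd_cancell (i := runit _)).
  by rewrite fwdKl !compA runit_tens tens1K comp1m.
rewrite kE -[X in bmap B _ X]comp1m bmapM -(bmap1 tens (V_ j ⊗ V_ i) D).
rewrite (compA (inv (sb_tens _ _ _ _ _))) sbV_nat bmap1 -!compA.
rewrite (compA (inv _ ⊗^ _)) -tensM1 (compA (_ ⊗^ idm (B munit D))) -tensM1.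
have pE : beta j i ∘ (inv (sb_tens S _ _ _ _) ∘ bmap B k (idm (V_ j ⊗ V_ i)))
   = inv one_ ∘ bmap B (idm munit) e.
  by apply: (fwd_cancell (i := one_)); rewrite fwdKl -ke /bpair !compA.
move: pE; rewrite /apairing -!compA => ->; rewrite tensM1.
rewrite -(bmap1 B munit D) -!compA (compA (bmap B _ e ⊗^ _)) -sbV_nat !bmap1.
rewrite !compA sbV_lunit -!compA -!bmapM comp1m lunit_runit_one fwdK.
by rewrite !compA.
Qed.

Lemma kleisli_comp_unit X Y Z (f : mor X (A ⊗ Y)) (g : mor Y (A ⊗ Z)) :
  amod_map (kleisli alg g ∘ kleisli alg f) ∘ free_unit alg X
  = ind_act alg Z ∘ (idm A ⊗^ g) ∘ f.
Proof.
rewrite (_ : amod_map _ = amod_map (kleisli alg g) ∘ amod_map (kleisli alg f)) //.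
by rewrite -compA kleisli_unit.
Qed.

Lemma fmap_unit X Y (f : mor X Y) :
  amod_map (fmap (induction alg) f) ∘ free_unit alg X = free_unit alg Y ∘ f.
Proof. exact: (free_unit_nat alg f). Qed.

(** The unit X -> A ⊗ X is split by [free_counit]. *)
Lemma induction_faithful X Y (f g : mor X Y) :
  fmap (induction alg) f = fmap (induction alg) g -> f = g.
Proof.
move=> e; have : free_unit alg Y ∘ f = free_unit alg Y ∘ g by rewrite -!fmap_unit e.
move/(congr1 (mcomp (free_counit Y))).
by rewrite (compA (free_counit Y) _ f) (compA (free_counit Y) _ g) free_counit_unit !comp1m.
Qed.

Theorem mirror_of_counit i : isomorphic (induction alg (B (U_ i) munit))
  (induction alg (B munit (dual (dV (V_ i))))).
Proof.
have [j bji] := dual_index_ex i; set D := dV (V_ i).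
have [n [kap [eps [eta [kapE sumE]]]]] := bpair_copairing bji.
pose phi := (ic i ⊗^ idm (B munit D)) ∘ inv (sb_tens S _ _ _ _)
        ∘ bmap B (inv (runit (U_ i))) (coev D).
pose psi := \sum_a ((ic j ⊗^ idm (B (U_ i) munit)) ∘ inv (sb_tens S _ _ _ _)
        ∘ bmap B (kap a) (inv (runit (V_ j)) ∘ eta a)).
pose Phi := kleisli alg phi; pose Psi := kleisli alg psi.
have PhiPsi : Phi ∘ Psi = idm _.
  apply: free_hom_ext; rewrite kleisli_comp_unit.
  apply: etrans (component_zerol _) _; rewrite [RHS]comp1m -[RHS]compm1.
  congr (_ ∘ _); rewrite compA /psi comp_sumr.
  under eq_bigr => a _ do rewrite (mirror_composite _ (kapE a)).
  by rewrite -bmap_sumr sumE bmap1.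
have [d dE] : exists d, free_counit _ ∘ (ind_act alg _ ∘ (idm A ⊗^ psi) ∘ phi)
    = bmap B d (idm munit) by exact: hom_fulll.
have PsiPhi : Psi ∘ Phi = fmap (induction alg) (bmap B d (idm munit)).
  apply: free_hom_ext; rewrite kleisli_comp_unit fmap_unit.
  by apply: etrans (component_zeror _) _; rewrite dE.
(* ΦΨ = 1 makes ΨΦ idempotent, and d inherits this because induction and x |-> x ⊠ 1 are
   faithful. *)
have dd : d ∘ d = d.
  apply/eqP; rewrite -subr_eq0; apply/eqP.
  have : bmap B (d ∘ d - d) (idm munit) = 0.
    rewrite -scaleN1r addrC bmap_linl scaleN1r addrC; apply/eqP; rewrite subr_eq0; apply/eqP.
    apply: induction_faithful; rewrite bmapMl fmapM -PsiPhi.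
    by rewrite -compA (compA Phi) PhiPsi comp1m.
  move/(bmap_eq0 hf) => [//|/is_zeroE z].
  case: (V_neq0 (i := i0)); apply/is_zeroE.
  by rewrite -(fwdK V_0) -[ifwd V_0]compm1 (proj1 (is_zeroE _) z) compm0 comp0m.
constructor; exists Phi Psi => //.
have [d0|d1] := simple_idempotent abU (U_simple i) dd; last first.
  by rewrite PsiPhi d1 bmap1 fmap1.
(* With d = 0, 1 = ΦΨ = Φ(ΨΦ)Ψ = 0; faithfulness then gives V_i^* = 0, and a zero dual forces V_i =
   0. *)
have Phi0 : idm (induction alg (B munit D)) = 0.
  rewrite -PhiPsi -[Phi]comp1m -PhiPsi -(compA Phi) PsiPhi d0 bmap0m.
  by rewrite (linear0 (@fmap_lin _ _ _ (induction alg) _ _)) compm0 comp0m.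
case: (V_neq0 (i := i)); apply/is_zeroE.
have : bmap B (idm munit) (idm (dual D)) = 0.
  rewrite bmap1; apply: induction_faithful.
  by rewrite fmap1 Phi0 (linear0 (@fmap_lin _ _ _ (induction alg) _ _)).
move/(bmap_eq0 hf) => [/is_zeroE|D0]; first by case: simple1.
apply: (@rcurry_inj _ _ _ D); rewrite tensm0.
by rewrite bmap1 -(bmap1 tens) D0 tens0m compm0.
Qed.

End Counit.

Theorem mirror i : isomorphic (induction alg (B (U_ i) munit))
  (induction alg (B munit (dual (dV (V_ i))))).
Proof. by have [rho r1 r2] := counit_ex; exact: (mirror_of_counit r1 r2). Qed.

End Mirror.

Section UnitDual.
Context {F : fieldType} {C : monCat F}.

Fact unit_zig :
  ifwd (runit (munit : C)) ∘ (idm munit ⊗^ ifwd (lunit munit)) ∘ inv (assoc munit munit munit)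
    ∘ (inv (lunit munit) ⊗^ idm munit) ∘ inv (lunit munit) = idm (munit : C).
Proof.
rewrite -triangle -lunit_runit_one -!compA fwdKl (compA (_ ⊗^ _)) tensK1 comp1m.
exact: fwdK.
Qed.

Fact unit_zag :
  ifwd (lunit (munit : C)) ∘ (ifwd (lunit munit) ⊗^ idm munit) ∘ ifwd (assoc munit munit munit)
    ∘ (idm munit ⊗^ inv (lunit munit)) ∘ inv (runit munit) = idm (munit : C).
Proof.
rewrite -!compA (compA (_ ⊗^ idm munit)) {2}lunit_runit_one triangle.
by rewrite (compA (idm _ ⊗^ _)) tens1K comp1m lunit_runit_one fwdK.
Qed.

(** With 1 as its own dual, [bdual] produces exactly 1 ⊠ V_i^* as a dual of 1 ⊠ V_i. *)
Definition unit_dual : dual_of (munit : C) := DualOf unit_zig unit_zag.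

End UnitDual.

Lemma has_dim0 (F : fieldType) (M : lmodType F) (x : M) : has_dim M 0 -> x = 0.
Proof.
move=> [[v vl [w vK _]]]; apply: (can_inj vK).
by rewrite [LHS]thinmx0 [RHS]thinmx0.
Qed.

Lemma has_dim1 (F : fieldType) (M : lmodType F) (x : M) : has_dim M 1 -> x <> 0 ->
  forall y, exists s, y = s *: x.
Proof.
move=> [[v vl [w vK _]]] x0 y.
have vx0 : v x 0 0 != 0.
  apply/eqP => e; apply: x0; apply: (can_inj vK); rewrite (linear0 vl).
  by apply/rowP => i; rewrite ord1 e mxE.
exists (v y 0 0 / v x 0 0); apply: (can_inj vK); rewrite (linearZ0 _ _ vl).
by apply/rowP => i; rewrite ord1 mxE divfK.
Qed.

Definition iso_of_eq (F : fieldType) (C : linCat F) (X Y : C) (e : X = Y) : iso Y X :=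
  ecast Z (iso Z X) e (iso_refl X).

Definition componentwise_strong (F : fieldType) (U V C : twistedCat F)
    (B : bifun U V C) (c : componentwise B) : strong_bifun B :=
  StrongBifun (cw_nat c) (cw_assoc c) (cw_lunit c) (cw_runit c).

(** * Finite biproducts and formal direct sums *)

Section FiniteBiproduct.
Context {F : fieldType} {C : braidedCat F}.
Variables (I : choiceType) (X_ : I -> C) (A : C) (dec : biproduct X_ A).

Lemma biproduct_seq : exists r : seq I, (forall i, i \in r) /\
  \sum_(i <- r) (inc dec i ∘ prj dec i) = idm A.
Proof.
have [r ur rP] := finite_suppP (biproduct_fin dec); exists r; split=> [i|].
  exact: rP.
rewrite -(inc_prj dec) (@fsum_seq _ _ r) // => i _; exact: rP.
Qed.

Lemma biproduct_mono T X (f : mor T (A ⊗ X)) :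
  (forall i, (prj dec i ⊗^ idm X) ∘ f = 0) -> f = 0.
Proof.
have [r [_ rE]] := biproduct_seq; move=> f0.
rewrite -[LHS]comp1m -bmap1 -rE tens_suml comp_suml big1 // => i _.
by rewrite tensM1 -compA f0 compm0.
Qed.

Lemma biproduct_epi X Z (f : mor (A ⊗ X) Z) :
  (forall i, f ∘ (inc dec i ⊗^ idm X) = 0) -> f = 0.
Proof.
have [r [_ rE]] := biproduct_seq; move=> f0.
rewrite -[LHS]compm1 -bmap1 -rE tens_suml comp_sumr big1 // => i _.
by rewrite tensM1 compA f0 comp0m.
Qed.

(** The form curries to finitely many morphisms A -> X_i^* , and the radical is their joint
    kernel. *)
Lemma biproduct_radical (abC : abelian C) (D : forall i, dual_of (X_ i))
    (b : mor (A ⊗ A) munit) :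
  exists (N : C) (n : mor N A), [/\ is_mono n, b ∘ (n ⊗^ idm A) = 0 &
    forall T (f : mor T A), b ∘ (f ⊗^ idm A) = 0 -> exists g, n ∘ g = f].
Proof.
have [r [rI rE]] := biproduct_seq.
pose p i := lcurry (D i) (b ∘ (idm A ⊗^ inc dec i)).
have pE i T (f : mor T A) : ev (D i) ∘ ((p i ∘ f) ⊗^ idm _) = b ∘ (f ⊗^ idm A) ∘ (idm _ ⊗^ inc dec i).
  by rewrite tensM1 compA lcurryP -!compA tens_interchange.
have [N [n [nm n0 nu]]] := joint_kernel abC p (r := r) (Q := fun _ => True) (fun i _ => rI i).
exists N, n; split=> // [|T f f0].
  have -> : b ∘ (n ⊗^ idm A) = b ∘ (n ⊗^ idm A) ∘ (idm N ⊗^ idm A) by rewrite bmap1 compm1.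
  rewrite -[X in idm N ⊗^ X]rE tens_sumr comp_sumr big1 // => i _.
  by rewrite tens1M compA -pE n0 // tens0m compm0 comp0m.
by apply: nu => i _; apply: lcurry0; rewrite pE f0 comp0m.
Qed.

End FiniteBiproduct.

(** * The embedding of C into its direct sum completion *)

Section DsEmbedding.
Context {F : fieldType} {C : twistedCat F}.
Implicit Types X Y Z : C.

Definition ds_map X Y (f : mor X Y) : mor (ds_emb X) (ds_emb Y) :=
  @dspure F C (dsone X) (dsone Y) id (fun _ => f).

Lemma ds_mapE X Y (f : mor X Y) : entry (ds_map f) tt tt = f.
Proof. exact: (@dspure_entryE F C (dsone X) (dsone Y) id (fun _ => f) tt). Qed.

Lemma ds_map_full X Y (f : mor (ds_emb X) (ds_emb Y)) : f = ds_map (entry f tt tt).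
Proof. by apply: dshomP => -[] []; rewrite ds_mapE. Qed.

Lemma ds_map_linear X Y : linear (@ds_map X Y).
Proof.
move=> k f g; apply: dshomP => -[] [].
transitivity (k *: entry (ds_map f) tt tt + entry (ds_map g) tt tt) => //.
by rewrite !ds_mapE.
Qed.

Lemma ds_mapM X Y Z (g : mor Y Z) (f : mor X Y) : ds_map (g ∘ f) = ds_map g ∘ ds_map f.
Proof. by rewrite /ds_map /= dspureM. Qed.

Definition ds_embed : linFun C (dsCompletion C) :=
  @LinFun F C (dsCompletion C) ds_emb ds_map ds_map_linear (fun X => erefl) ds_mapM.

Definition ds_tens X Y : iso (ds_emb X ⊗ ds_emb Y) (ds_emb (X ⊗ Y)).
Proof.
refine (@Iso F (dsCompletion C) (dstens (dsone X) (dsone Y)) (dsone (X ⊗ Y))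
  (@dspure F C (dstens (dsone X) (dsone Y)) (dsone (X ⊗ Y)) (fun _ => tt) (fun _ => idm _))
  (@dspure F C (dsone (X ⊗ Y)) (dstens (dsone X) (dsone Y)) (fun _ => (tt, tt)) (fun _ => idm _)) _ _).
- by rewrite /= dspureM; apply: dspure_ext => -[[] []] /=; rewrite comp1m.
- by rewrite /= dspureM; apply: dspure_ext => -[] /=; rewrite comp1m.
Defined.

Section DsBifun.
Variables (U V : twistedCat F) (B : bifun U V C).

Definition ds_bifun : bifun U V (dsCompletion C).
Proof.
refine (@Bifun F U V (dsCompletion C) (fun (X : U) (Y : V) => ds_emb (B X Y))
  (fun (X1 X2 : U) (Y1 Y2 : V) f g => ds_map (bmap B f g)) _ _ _ _).
- by move=> X1 X2 Y1 Y2 g k f f'; rewrite bmap_linl ds_map_linear.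
- by move=> X1 X2 Y1 Y2 g k f f'; rewrite bmap_linr ds_map_linear.
- by move=> X Y; rewrite bmap1.
- by move=> X1 X2 X3 Y1 Y2 Y3 f' f g' g; rewrite bmapM ds_mapM.
Defined.

(** The embedding is fully faithful, so the formula carries over without a universal property for
    the completion. *)
Lemma ds_hom_formula : hom_formula B -> hom_formula ds_bifun.
Proof.
move=> hf S X; have [n [e [sp eB]]] := hf S X; exists n, e; split=> // Y Y' f.
have [h [fE hu]] := eB Y Y' (entry f tt tt).
have sumE (h' : 'I_n -> mor Y Y') :
    \sum_k bmap ds_bifun (e k) (h' k) = ds_map (\sum_k bmap B (e k) (h' k)).
  by rewrite (linear_sum _ _ _ (@ds_map_linear _ _)).
exists h; split=> [|h' f'E]; first by rewrite sumE -fE; exact: ds_map_full.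
by apply: hu; rewrite f'E sumE ds_mapE.
Qed.

Definition ds_strong : strong_bifun B -> strong_bifun ds_bifun.
Proof.
move=> S.
refine (@StrongBifun F U V (dsCompletion C) ds_bifun
  (fun (X X' : U) (Y Y' : V) => iso_comp (fmap_iso ds_embed (sb_tens S X X' Y Y')) (ds_tens _ _))
  (fmap_iso ds_embed (sb_one S)) _ _ _ _).
- move=> X1 X2 X1' X2' Y1 Y2 Y1' Y2' f f' g g'.
  rewrite /= dstensm_pure !dspureM; apply: dspure_ext => -[[] []] /=; congr existT.
  by rewrite !compm1 sb_nat.
- move=> X1 X2 X3 Y1 Y2 Y3.
  rewrite /= !dspureM !dstensm_pure !dspureM; apply: dspure_ext => -[[] [[] []]] /=.
  by congr existT; rewrite !compm1 sb_assoc.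
- move=> X Y; rewrite /= !dspureM !dstensm_pure !dspureM.
  by apply: dspure_ext => -[[] []] /=; congr existT; rewrite !compm1 sb_lunit.
- move=> X Y; rewrite /= !dspureM !dstensm_pure !dspureM.
  by apply: dspure_ext => -[[] []] /=; congr existT; rewrite !compm1 sb_runit.
Qed.

End DsBifun.

Section DsSum.
Variables (I : choiceType) (X_ : I -> C).
Local Notation A := (dsum X_).

Lemma dsum_prj_fin i (s : I) :
  finite_set [set t : unit | match s =P i with
    ReflectT e => ecast j (mor (X_ s) (X_ j)) e (idm (X_ s)) | ReflectF _ => 0 end <> 0].
Proof. by apply: (@sub_finite_set _ _ [set: unit]) => //; exact: finite_finset. Qed.

Definition dsum_prj i : mor A (ds_emb (X_ i)) :=
  @DsHom F C (DsOb X_) (dsone (X_ i)) (fun s _ => _) (dsum_prj_fin i).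

Lemma dsum_prjE i : entry (dsum_prj i) i tt = idm (X_ i).
Proof. by rewrite /=; case: eqP => // e; rewrite (eq_axiomK e). Qed.

Lemma dsum_prj0 i s : s <> i -> entry (dsum_prj i) s tt = 0.
Proof. by rewrite /=; case: eqP. Qed.

Lemma dsum_prj_inc i : dsum_prj i ∘ dsum_inc X_ i = idm (ds_emb (X_ i)).
Proof.
apply: dshomP => -[] []; apply: etrans (dscomp_pure _ _ _ _) _.
rewrite dsum_prjE compm1; apply: esym.
exact: (@dspure_entryE F C (dsone (X_ i)) (dsone (X_ i)) id (fun _ => idm _) tt).
Qed.

Lemma dsum_prj_inc0 i j : i <> j -> dsum_prj j ∘ dsum_inc X_ i = 0.
Proof.
move=> ij; apply: dshomP => -[] []; apply: etrans (dscomp_pure _ _ _ _) _.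
by rewrite dsum_prj0 // comp0m.
Qed.

Lemma dsum_mono (T X : dsCompletion C) (f : mor T (A ⊗ X)) :
  (forall i, (dsum_prj i ⊗^ idm X) ∘ f = 0) -> f = 0.
Proof.
move=> f0; apply: dshomP => s [i x].
have := congr1 (fun g : dshom T (dstens (dsone (X_ i)) X) => g s (tt, x)) (f0 i).
rewrite /= (@fsum1 _ _ (i, x)) => [|[i' x'] ix].
  case: eqP => // e; rewrite (eq_axiomK e) /=.
  by rewrite (@dspure_entryE F C X X id (fun _ => idm _) x) bmap1 comp1m.
have [ii|ii] := pselect (i' = i); last by case: eqP => //= _; rewrite tens0m comp0m.
have xx : x <> x' by move=> xx; apply: ix; rewrite ii xx.
by rewrite (@dspure_entry0 F C X X id (fun _ => idm _) x' x xx) tensm0 comp0m.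
Qed.

Lemma dsum_incE2 (X : dsCompletion C) (Z : dsCompletion C) (f : mor (A ⊗ X) Z) i x t :
  entry (f ∘ (dsum_inc X_ i ⊗^ idm X)) (tt, x) t = entry f (i, x) t.
Proof.
rewrite [_ ⊗^ _]dstensm_pure; apply: etrans (dscomp_pure _ _ _ _) _.
by rewrite /= bmap1 compm1.
Qed.

Lemma dsum_epi (X Z : dsCompletion C) (f : mor (A ⊗ X) Z) :
  (forall i, f ∘ (dsum_inc X_ i ⊗^ idm X) = 0) -> f = 0.
Proof. by move=> f0; apply: dshomP => -[i x] t; rewrite -dsum_incE2 f0. Qed.

Lemma dsum_inc_pair (b : mor (A ⊗ A) munit) l m :
  entry (b ∘ (dsum_inc X_ l ⊗^ dsum_inc X_ m)) (tt, tt) tt = entry b (l, m) tt.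
Proof.
rewrite [_ ⊗^ _]dstensm_pure; apply: etrans (dscomp_pure _ _ _ _) _.
by rewrite /= bmap1 compm1.
Qed.

(** The radical is built summand by summand. Each l has at most one partner m, so K_l is a single
    kernel in C; each m has at most one partner, so the condition on f separates into conditions on
    its entries. *)
Lemma dsum_radical (abC : abelian C) (D : forall i, dual_of (X_ i))
    (b : mor (A ⊗ A) munit) :
  (forall l m m', b ∘ (dsum_inc X_ l ⊗^ dsum_inc X_ m) <> 0 ->
    b ∘ (dsum_inc X_ l ⊗^ dsum_inc X_ m') <> 0 -> m = m') ->
  (forall l l' m, b ∘ (dsum_inc X_ l ⊗^ dsum_inc X_ m) <> 0 ->
    b ∘ (dsum_inc X_ l' ⊗^ dsum_inc X_ m) <> 0 -> l = l') ->
  exists (N : dsCompletion C) (n : mor N A), [/\ is_mono n, b ∘ (n ⊗^ idm A) = 0 &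
    forall T (f : mor T A), b ∘ (f ⊗^ idm A) = 0 -> exists g, n ∘ g = f].
Proof.
pose be l m : mor (X_ l ⊗ X_ m) munit := entry b (l, m) tt.
have beN l m : be l m <> 0 -> b ∘ (dsum_inc X_ l ⊗^ dsum_inc X_ m) <> 0.
  by move=> be0 e; apply: be0; rewrite /be -dsum_inc_pair e.
move=> bl br.
have bel l m m' : be l m <> 0 -> be l m' <> 0 -> m = m' by move=> /beN h /beN; exact: bl.
have ber l l' m : be l m <> 0 -> be l' m <> 0 -> l = l' by move=> /beN h /beN; exact: br.
have kerP l : exists (Kk : {K : C & mor K (X_ l)}), [/\ is_mono (projT2 Kk),
   forall m, be l m ∘ (projT2 Kk ⊗^ idm _) = 0 &
   forall T (f : mor T (X_ l)), (forall m, be l m ∘ (f ⊗^ idm _) = 0) ->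
     exists g, projT2 Kk ∘ g = f].
  have [[m bm]|nb] := pselect (exists m, be l m <> 0); last first.
    exists (existT _ (X_ l) (idm _)); split=> /= [T f g|m|T f _].
    - by rewrite !comp1m.
    - have [->|e] := pselect (be l m = 0); first exact: comp0m.
      by case: nb; exists m.
    - by exists f; rewrite comp1m.
  have tt_in (u : unit) : u \in [:: tt] by case: u.
  have [K [k [km k0 ku]]] := joint_kernel abC (fun _ : unit => lcurry (D m) (be l m))
    (r := [:: tt]) (Q := fun _ => True) (fun u _ => tt_in u).
  exists (existT _ K k); split=> //= [m'|T f f0].
    have [->|e] := pselect (be l m' = 0); first exact: comp0m.
    rewrite -(bel l m m' bm e).
    by rewrite -(lcurryP (D m) (be l m)) -compA -tensM1 k0 // tens0m compm0.
  by apply: ku => _ _; apply: lcurry0; rewrite tensM1 compA lcurryP f0.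
have [K {}kerP] := dchoice kerP.
pose N : dsCompletion C := DsOb (fun l => projT1 (K l)).
pose n : mor N A := @dspure F C N A id (fun l => projT2 (K l)).
have nE (T : dsCompletion C) (g : mor T N) s t : entry (n ∘ g) s t = projT2 (K t) ∘ entry g s t.
  exact: (@dspure_comp F C T N A g id).
exists N, n; split=> [T g h e||T f f0].
- apply: dshomP => s t; have [km _ _] := kerP t; apply: km.
  by rewrite -!nE e.
- apply: dshomP => -[l m] []; rewrite [_ ⊗^ _]dstensm_pure; apply: etrans (dscomp_pure _ _ _ _) _.
  by have [_ k0 _] := kerP l; exact: k0.
have gP s t : exists g, projT2 (K t) ∘ g = entry f s t.
  have [_ _ ku] := kerP t; apply: ku => m.
  have [->|bm] := pselect (be t m = 0); first exact: comp0m.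
  have := congr1 (fun g : dshom (dstens T A) (dsone munit) => g (s, m) tt) f0.
  rewrite /= (@fsum1 _ _ (t, m)) => [<-|[t' m'] tm] /=.
    by rewrite (@dspure_entryE F C A A id (fun _ => idm _) m).
  have [mm|mm] := pselect (m' = m); last first.
    by rewrite (@dspure_entry0 F C A A id (fun _ => idm _) m m') // tensm0 compm0.
  have [b0|b0] := pselect (be t' m' = 0).
    by rewrite -/(be t' m') b0 comp0m.
  by case: tm; rewrite mm; congr (_, _); apply: ber bm; rewrite -mm.
have [g {}gP] := dchoice (fun s => dchoice (gP s)).
(* Each K_t -> X_t is mono, so g has no larger support than f. *)
have gfin s : finite_set [set t | g s t <> 0].
  apply: sub_finite_set (entry_fin f s) => t /= g0 e; apply: g0.
  have [km _ _] := kerP t; apply: km; rewrite gP e compm0 //.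
exists (@DsHom F C T N g gfin); apply: dshomP => s t.
by rewrite nE /= gP.
Qed.

End DsSum.

End DsEmbedding.

(** * The theorem, for finite and infinite index sets *)

Theorem mainTheorem3 (F : fieldType) (U V : ribbonCat F)
  (C : twistedCat F) (P : deligneProduct U V C)
  (U_semisimple : semisimple U)
  (I : choiceType) (i0 : I) (U_ : I -> U) (V_ : I -> V)
  (U_simple : forall i, simple (U_ i))
  (U_distinct : forall i j, isomorphic (U_ i) (U_ j) -> i = j)
  (V_neq0 : forall i, ~ is_zero (V_ i))
  (U_0 : U_ i0 = munit) (V_0 : V_ i0 = munit)
  (dim_U : forall i, has_dim (mor (U_ i0) (U_ i)) (i == i0))
  (dim_V : forall i, has_dim (mor (V_ i0) (V_ i)) (i == i0))
  (I0 I1 : set I)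
  (I01_cover : I0 `|` I1 = [set: I]) (I01_disjoint : I0 `&` I1 = set0)
  (i0_I0 : I0 i0) :
  (finite_set [set: I] ->
   forall (A : C) (dec : biproduct (fun i => dprod P (U_ i) (V_ i)) A)
     (alg : comAlg A),
   simple_alg alg ->
   (forall i, I0 i -> ifwd (twist A) ∘ inc dec i = inc dec i) ->
   (forall i, I1 i -> ifwd (twist A) ∘ inc dec i = - inc dec i) ->
   forall (i : I) (W : dual_of (dprod P munit (V_ i))),
   isomorphic (induction alg (dprod P (U_ i) munit))
              (induction alg (dual W)))
  /\
  (infinite_set [set: I] ->
   let A := dsum (fun i => dprod P (U_ i) (V_ i)) in
   let inA := dsum_inc (fun i => dprod P (U_ i) (V_ i)) in
   forall alg : @comAlg F (dsCompletion C) A,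
   simple_alg alg ->
   (forall i, I0 i -> ifwd (twist A) ∘ inA i = inA i) ->
   (forall i, I1 i -> ifwd (twist A) ∘ inA i = - inA i) ->
   forall (i : I) (W : dual_of (dprod P munit (V_ i))),
   isomorphic (induction alg (ds_emb (dprod P (U_ i) munit)))
              (induction alg (ds_emb (dual W)))).
Proof.
have cB := dprod_componentwise P; have [abC _ _] := dprod_universal P.
have abU : abelian U by case: (ribbon_tensorCat U).
have abV : abelian V by case: (ribbon_tensorCat V).
have isoU : iso munit (U_ i0) := iso_of_eq U_0.
have isoV : iso munit (V_ i0) := iso_of_eq V_0.
have simple1 : simple (munit : U) by rewrite -U_0.
have HomU0 i : i <> i0 -> forall f : mor munit (U_ i), f = 0.
  move=> /eqP ii0 f; apply: has_dim0; have := dim_U i.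
  by rewrite (negbTE ii0) U_0.
have HomV0 i : i <> i0 -> forall f : mor munit (V_ i), f = 0.
  move=> /eqP ii0 f; apply: has_dim0; have := dim_V i.
  by rewrite (negbTE ii0) V_0.
have End1U (f : mor (munit : U) munit) : exists s, f = s *: idm munit.
  apply: has_dim1; first by have := dim_U i0; rewrite eqxx U_0.
  by move/is_zeroE; case: simple1.
have End1V (f : mor (munit : V) munit) : exists s, f = s *: idm munit.
  apply: has_dim1; first by have := dim_V i0; rewrite eqxx V_0.
  by move/is_zeroE; rewrite -V_0; exact: V_neq0.
have hf : hom_formula (dprod P).
  apply: deligne_hom_formula (dprod_universal P) => // S X.
  by apply: hom_coord_basis => // Z; constructor; exact: rdual.
have S := componentwise_strong cB.
(* W is an arbitrary dual of 1 ⊠ V_i; uniqueness of duals reduces the claim to 1 ⊠ V_i^* , and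
   induction preserves the isomorphism. *)
have Wiso i (W : dual_of (dprod P munit (V_ i))) :
    isomorphic (dprod P munit (dual (rdual (V_ i)))) (dual W).
  exact: (dual_unique (bdual S unit_dual (rdual (V_ i))) W).
pose D i := bdual S (rdual (U_ i)) (rdual (V_ i)).
split=> [_ A dec alg sA _ _ i W|_ A inA alg sA _ _ i W].
  have [m] : isomorphic (induction alg (dprod P (U_ i) munit))
      (induction alg (dprod P munit (dual (rdual (V_ i))))).
    apply: (mirror S hf abU U_semisimple abV (@rdual _ U) (@rdual _ V) End1U End1V simple1
      U_simple U_distinct V_neq0 isoU isoV HomU0 HomV0 (prj_inc dec)
      (biproduct_mono (dec := dec)) (biproduct_epi (dec := dec)) (prj_inc0 dec) sA) => b _ _.
    exact: (biproduct_radical dec abC D).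
  have [w] := Wiso i W; constructor.
  exact: iso_comp (fmap_iso (induction alg) w) m.
have [m] : isomorphic (induction alg (ds_emb (dprod P (U_ i) munit)))
    (induction alg (ds_emb (dprod P munit (dual (rdual (V_ i)))))).
  exact: (mirror (ds_strong S) (ds_hom_formula hf) abU U_semisimple abV
    (@rdual _ U) (@rdual _ V) End1U End1V simple1
    U_simple U_distinct V_neq0 isoU isoV HomU0 HomV0 (@dsum_prj_inc _ _ _ _)
    (@dsum_mono _ _ _ _) (@dsum_epi _ _ _ _) (@dsum_prj_inc0 _ _ _ _) sA
    (dsum_radical abC D)).
have [w] := Wiso i W; constructor.
exact: iso_comp (fmap_iso (induction alg) (fmap_iso ds_embed w)) m.
Qed.
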